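(* Let $\omega\in\mathbb{T}$, let $\mathcal{T}_\omega:\mathcal{D}(\mathcal{T})\to\mathcal{X}$ be the renormalization operator in the $C^r$-topology, and let $\Phi$ be a fixed point of the operator. If $\Phi\in\mathcal{D}_0(\mathcal{T})\cap C^{r+s}(\mathbb{T}\times I_\delta,I_\delta)$, then there exists an open neighborhood $U$ of $\Phi$ in $\mathcal{D}_0(\mathcal{T})\cap C^{r+s}(\mathbb{T}\times I_\delta,I_\delta)$ such that $\mathcal{T}_\omega$ is a $C^s$ operator in $U$ (with values in $\mathcal{X}$ with the $C^r$-topology). Moreover, if $s\ge1$, for any point $\Psi\in U$ the Gateaux derivative of $\mathcal{T}_\omega$ at $\Psi$ in the direction $h$ is given by $$[d\mathcal{T}_\omega(\Psi,h)](\theta,x)=\frac1a\psi'(\psi(ax))\,h(\theta,ax)+\frac1ah(\theta+\omega,\psi(ax))+\frac ba\psi'(\psi(ax))\,\psi'(ax)\,x-\frac b{a^2}\psi(\psi(ax)),$$ where $\psi=p_0(\Psi)$, $a=\psi(1)$ and $b=\int_0^1h(\theta,1)\,d\theta$.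
   Context: $\mathbb{T}=\mathbb{R}/\mathbb{Z}$; $\delta>0$ is a fixed small number; $I_\delta=[-1-\delta,1+\delta]$; $r\ge1$ and $s\ge0$ are integers. $\mathcal{M}_\delta$ is the set of continuously differentiable even maps $\psi:I_\delta\to I_\delta$ with $\psi(0)=1$ and $x\psi'(x)<0$ for $x\neq0$. With $a=\psi(1)$, $a'=(1+\delta)a$, $b'=\psi(a')$, $\mathcal{D}(\mathcal{R}_\delta)$ consists of those $\psi\in\mathcal{M}_\delta$ with $a<0$, $1>b'>-a'$, $\psi(b')<-a'$. $p_0(f)(x)=\int_0^1f(\theta,x)\,d\theta$; $\mathcal{X}=\{f\in C^r(\mathbb{T}\times I_\delta,I_\delta):p_0(f)\in\mathcal{M}_\delta\}$; $\mathcal{X}_0=\{f\in\mathcal{X}:p_0(f)=f\}$, identified with one-dimensional maps. $[\mathcal{T}_\omega(g)](\theta,x)=\frac1{\hat a}g(\theta+\omega,g(\theta,\hat ax))$ with $\hat a=\int_0^1g(\theta,1)\,d\theta$; $\mathcal{D}(\mathcal{T})=\{g\in\mathcal{X}:\mathcal{T}_\omega(g)\in\mathcal{X}\}$; $\mathcal{D}_0(\mathcal{T})$ is the set of functions in $\mathcal{X}_0$ corresponding to functions of $\mathcal{D}(\mathcal{R}_\delta)$. $C^{r+s}$ spaces carry the $C^{r+s}$ topology. The Gateaux derivative is $\lim_{t\to0}\frac1t(\mathcal{T}_\omega(\Psi+th)-\mathcal{T}_\omega(\Psi))$ for $h\in C^r(\mathbb{T}\times I_\delta,\mathbb{R})$,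 with $\mathcal{T}_\omega$ evaluated by its formula. *)

(* Defs.v *)
From HB Require Import structures.
From mathcomp Require Import all_boot all_order all_algebra.
From mathcomp Require Import all_classical all_reals all_analysis.
From mathcomp Require Import lra.

Set Implicit Arguments.
Unset Strict Implicit.
Unset Printing Implicit Defensive.

Import Order.TTheory GRing.Theory Num.Theory.
Import numFieldNormedType.Exports.

Local Open Scope classical_set_scope.
Local Open Scope ring_scope.

Section BoundedLinear.
Context {R : realType} (E F : normedModType R).

Definition blin : {pred E -> F} :=
  mem [set f | linear f /\ exists M, forall x, `|f x| <= M * `|x|].

Record boundedLinear := BoundedLinear {
  boundedLinear_fun :> E -> F;
  boundedLinearP : boundedLinear_fun \in blin }.

HB.instance Definition _ := [isSub for boundedLinear_fun].
HB.instance Definition _ := [Choice of boundedLinear by <:].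

Lemma blin_submod_closed : submod_closed blin.
Proof.
split=> [|a f g].
  rewrite inE; split=> [k x y|]; first by rewrite scaler0 addr0.
  by exists 0 => x; rewrite normr0 mul0r.
rewrite !inE => -[lf [M fM]] [lg [N gN]]; split=> [k x y|].
  rewrite !fctE lf lg !scalerDr !scalerA (mulrC a k) -!addrA; congr (_ + _).
  by rewrite addrCA.
exists (`|a| * M + N) => x; rewrite !fctE (le_trans (ler_normD _ _))// mulrDl.
by rewrite lerD// normrZ -mulrA ler_wpM2l.
Qed.

HB.instance Definition _ := GRing.isSubmodClosed.Build _ _ blin blin_submod_closed.
HB.instance Definition _ := [SubChoice_isSubLmodule of boundedLinear by <:].

Let bounds (f : boundedLinear) :=
  [set M | 0 <= M /\ forall x, `|f x| <= M * `|x|].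

Definition opnorm (f : boundedLinear) : R :=
  inf [set M | 0 <= M /\ forall x, `|f x| <= M * `|x|].

Let has_inf_bounds (f : boundedLinear) : has_inf (bounds f).
Proof.
split; last by exists 0 => M [].
have := boundedLinearP f; rewrite inE => -[_ [M fM]].
exists `|M|; split=> // x; rewrite (le_trans (fM x))// ler_wpM2r//.
exact: ler_norm.
Qed.

Lemma opnorm_ge0 (f : boundedLinear) : 0 <= opnorm f.
Proof. by apply: lb_le_inf (has_inf_bounds f).1 _ => M []. Qed.

Lemma opnormP (f : boundedLinear) x : `|f x| <= opnorm f * `|x|.
Proof.
have [->|x0] := eqVneq x 0.
  have := boundedLinearP f; rewrite inE => -[_ [M fM]].
  by have := fM 0; rewrite normr0 !mulr0.
rewrite -ler_pdivrMr ?normr_gt0//; apply: lb_le_inf (has_inf_bounds f).1 _.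
by move=> M [M0 fM]; rewrite ler_pdivrMr ?normr_gt0.
Qed.

Lemma opnorm_le (f : boundedLinear) M :
  0 <= M -> (forall x, `|f x| <= M * `|x|) -> opnorm f <= M.
Proof.
move=> M0 fM; apply: ge_inf; last by split.
by exists 0 => N [].
Qed.

Let opnormD (f g : boundedLinear) : opnorm (f + g) <= opnorm f + opnorm g.
Proof.
apply: opnorm_le => [|x]; first by rewrite addr_ge0// opnorm_ge0.
by rewrite mulrDl (le_trans (ler_normD _ _))// lerD// opnormP.
Qed.

Let opnormZ_le (l : R) (f : boundedLinear) : opnorm (l *: f) <= `|l| * opnorm f.
Proof.
apply: opnorm_le => [|x]; first by rewrite mulr_ge0// opnorm_ge0.
by rewrite [X in `|X|]/(l *: f x) normrZ -mulrA ler_wpM2l// opnormP.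
Qed.

Let opnormZ (l : R) (f : boundedLinear) : opnorm (l *: f) = `|l| * opnorm f.
Proof.
apply/eqP; rewrite eq_le opnormZ_le/=; have [->|l0] := eqVneq l 0.
  by rewrite normr0 mul0r opnorm_ge0.
rewrite -ler_pdivlMl ?normr_gt0// -normfV.
by rewrite -[X in opnorm X <= _]scale1r -(mulVf l0) -scalerA opnormZ_le.
Qed.

Let opnorm_eq0 (f : boundedLinear) : opnorm f = 0 -> f = 0.
Proof.
move=> f0; apply/val_inj/funext => x; apply/eqP.
by rewrite -normr_le0 (le_trans (opnormP f x))// f0 mul0r.
Qed.

HB.instance Definition _ :=
  Lmodule_isNormed.Build R boundedLinear opnormD opnormZ opnorm_eq0.

End BoundedLinear.

(** For [W] open, [Cn n W f] says that [f] is [n] times continuously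
    Frechet-differentiable on [W], derivatives being continuous for the
    operator norm. *)
Fixpoint Cn (R : realType) (n : nat) (E F : normedModType R) (W : set E)
    (f : E -> F) : Prop :=
  if n is m.+1 then
    exists2 df : E -> boundedLinear E F,
      forall x, W x -> is_diff x f (df x) & Cn m W df
  else forall x, W x -> {for x, continuous f}.

(** A map on an arbitrary subset [U] of a normed space is C^n when it is
    locally the restriction of a C^n map defined on an open set. *)
Definition Cn_on (R : realType) (n : nat) (E F : normedModType R) (U : set E)
    (f : E -> F) : Prop :=
  forall x, U x -> exists (W : set E) (g : E -> F),
    [/\ open W, W x, Cn n W g & forall y, W y -> U y -> f y = g y].

Section Cylinder.
Context {R : realType} (delta : {posnum R}).

Definition Idelta : set R := `[- 1 - delta%:num, 1 + delta%:num]%classic.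

(** Functions on the cylinder are functions on R * R that are 1-periodic in
    the first variable and, so that equality is the equality on the cylinder,
    vanish when the second variable is outside [Idelta]. *)
Definition cyl : set (R * R) := setT `*` Idelta.

Definition diff_quotient (u : R -> R) (x y : R) : R := (y - x)^-1 * (u y - u x).

(** Derivatives relative to [Idelta]: one-sided at the two endpoints. *)
Definition derivableI (u : R -> R) (x : R) : Prop :=
  cvg (diff_quotient u x y @[y --> within Idelta x^']).

Definition deriveI (u : R -> R) (x : R) : R :=
  lim (diff_quotient u x y @[y --> within Idelta x^']).

Definition partial1 (f : R * R -> R) : R * R -> R :=
  (fun p => derive1 (fun t => f (t, p.2)) p.1) \_ cyl.

Definition partial2 (f : R * R -> R) : R * R -> R :=
  (fun p => deriveI (fun y => f (p.1, y)) p.2) \_ cyl.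

Fixpoint smooth (k : nat) (f : R * R -> R) : Prop :=
  {within cyl, continuous f} /\
  if k is m.+1 then
    [/\ forall p, cyl p -> derivable (fun t => f (t, p.2)) p.1 1,
        forall p, cyl p -> derivableI (fun y => f (p.1, y)) p.2,
        smooth m (partial1 f) & smooth m (partial2 f)]
  else True.

Definition sup_norm (f : R * R -> R) : R := sup [set `|f p| | p in cyl].

(** The maximum of the sup norms of all partial derivatives of order <= k. *)
Fixpoint Ck_norm (k : nat) (f : R * R -> R) : R :=
  if k is m.+1 then
    Num.max (sup_norm f)
      (Num.max (Ck_norm m (partial1 f)) (Ck_norm m (partial2 f)))
  else sup_norm f.

Definition periodic1 (f : R * R -> R) := forall t x, f (t + 1, x) = f (t, x).

Definition isCk (k : nat) : {pred R * R -> R} :=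
  mem [set f | [/\ smooth k f, periodic1 f & forall p, ~ cyl p -> f p = 0]].

Record Ck (k : nat) := MkCk {
  Ck_fun :> R * R -> R;
  CkP : Ck_fun \in isCk k }.

HB.instance Definition _ k := [isSub for @Ck_fun k].
HB.instance Definition _ k := [Choice of Ck k by <:].

Let I_proper x : Idelta x -> ProperFilter (within Idelta x^').
Proof.
move=> Ix; apply: Build_ProperFilter => /= wA.
have {}wA : \forall y \near x^', ~ Idelta y by exact: wA.
have d0 : 0 < delta%:num by [].
move: (Ix); rewrite /Idelta/= in_itv/= => /andP[x1 x2].
have [xd|dx] := ltP x (1 + delta%:num).
- have : \forall y \near x^'+, False.
    near=> y; have : ~ Idelta y.
      near: y; move: wA; rewrite /at_right !near_withinE.
      by apply: filterS => y Ny xy; apply: Ny; rewrite gt_eqF.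
    apply; rewrite /Idelta/= in_itv/=; apply/andP; split.
      by rewrite (le_trans x1).
    by near: y; exact: nbhs_right_le.
  by move=> /filter_ex[].
- have : \forall y \near x^'-, False.
    near=> y; have : ~ Idelta y.
      near: y; move: wA; rewrite /at_left !near_withinE.
      by apply: filterS => y Ny xy; apply: Ny; rewrite lt_eqF.
    apply; rewrite /Idelta/= in_itv/=; apply/andP; split.
      by near: y; apply: nbhs_left_ge; lra.
    by rewrite (le_trans _ x2).
  by move=> /filter_ex[].
Unshelve. all: by end_near. Qed.

Lemma deriveID u v x : Idelta x -> derivableI u x -> derivableI v x ->
  derivableI (u + v) x /\ deriveI (u + v) x = deriveI u x + deriveI v x.
Proof.
move=> Ix du dv; have FF := I_proper Ix.
have h : diff_quotient (u + v) x y @[y --> within Idelta x^'] -->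
    deriveI u x + deriveI v x.
  rewrite [X in X @ _](_ : _ = diff_quotient u x \+ diff_quotient v x).
    exact: cvgD.
  by apply/funext => y; rewrite /diff_quotient !fctE/= -mulrDr opprD addrACA.
split; first by apply/cvg_ex; eexists; exact: h.
exact: cvg_lim h.
Qed.

Lemma deriveIZ a u x : Idelta x -> derivableI u x ->
  derivableI (a *: u) x /\ deriveI (a *: u) x = a * deriveI u x.
Proof.
move=> Ix du; have FF := I_proper Ix.
have h : diff_quotient (a *: u) x y @[y --> within Idelta x^'] -->
    a * deriveI u x.
  rewrite [X in X @ _](_ : _ = (fun y => a * diff_quotient u x y)).
    by apply: cvgM => //; exact: cvg_cst.
  apply/funext => y; rewrite /diff_quotient !fctE/= /GRing.scale/=.
  by rewrite -mulrBr mulrCA.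
split; first by apply/cvg_ex; eexists; exact: h.
exact: cvg_lim h.
Qed.

Let partial1D f g : (forall p, cyl p -> derivable (fun t => f (t, p.2)) p.1 1) ->
  (forall p, cyl p -> derivable (fun t => g (t, p.2)) p.1 1) ->
  partial1 (f + g) = partial1 f + partial1 g.
Proof.
move=> df dg; apply/funext => p; rewrite /partial1 !fctE /patch.
case: ifPn => [/set_mem cp|_]; last by rewrite addr0.
rewrite !derive1E -deriveD//; [exact: df|exact: dg].
Qed.

Let partial1Z a f : (forall p, cyl p -> derivable (fun t => f (t, p.2)) p.1 1) ->
  partial1 (a *: f) = a *: partial1 f.
Proof.
move=> df; apply/funext => p; rewrite /partial1 !fctE /patch.
case: ifPn => [/set_mem cp|_]; last by rewrite scaler0.
rewrite !derive1E -deriveZ//; exact: df.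
Qed.

Let partial2D f g : (forall p, cyl p -> derivableI (fun y => f (p.1, y)) p.2) ->
  (forall p, cyl p -> derivableI (fun y => g (p.1, y)) p.2) ->
  partial2 (f + g) = partial2 f + partial2 g.
Proof.
move=> df dg; apply/funext => p; rewrite /partial2 !fctE /patch.
case: ifPn => [/set_mem cp|_]; last by rewrite addr0.
by have [_ <-] := deriveID cp.2 (df _ cp) (dg _ cp).
Qed.

Let partial2Z a f : (forall p, cyl p -> derivableI (fun y => f (p.1, y)) p.2) ->
  partial2 (a *: f) = a *: partial2 f.
Proof.
move=> df; apply/funext => p; rewrite /partial2 !fctE /patch.
case: ifPn => [/set_mem cp|_]; last by rewrite scaler0.
by have [_] := deriveIZ a cp.2 (df _ cp).
Qed.

Let smoothD k f g : smooth k f -> smooth k g -> smooth k (f + g).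
Proof.
elim: k f g => [|k IH] f g /=.
  by move=> [cf _] [cg _]; split=> //; exact: within_continuousD.
move=> [cf [f1 f2 sf1 sf2]] [cg [g1 g2 sg1 sg2]].
split; first exact: within_continuousD.
split.
- by move=> p cp; apply: derivableD; [exact: f1|exact: g1].
- by move=> p cp; have [] := deriveID cp.2 (f2 _ cp) (g2 _ cp).
- by rewrite partial1D//; exact: IH.
- by rewrite partial2D//; exact: IH.
Qed.

Let within_continuousZ a (f : R * R -> R) : {within cyl, continuous f} ->
  {within cyl, continuous (a *: f)}.
Proof. by move=> cf x; apply: cvgM; [exact: cvg_cst|exact: cf]. Qed.

Let smoothZ k a f : smooth k f -> smooth k (a *: f).
Proof.
elim: k f => [|k IH] f /=; first by move=> [cf _]; split=> //; exact: within_continuousZ.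
move=> [cf [f1 f2 sf1 sf2]]; split; first exact: within_continuousZ.
split.
- by move=> p cp; apply: derivableZ; exact: f1.
- by move=> p cp; have [] := deriveIZ a cp.2 (f2 _ cp).
- by rewrite partial1Z//; exact: IH.
- by rewrite partial2Z//; exact: IH.
Qed.

Let partial1_0 : partial1 0 = 0.
Proof.
apply/funext => p; rewrite /partial1 /patch; case: ifPn => // _.
by rewrite derive1_cst.
Qed.

Let diff_quotient0 x : diff_quotient 0 x = fun=> 0.
Proof. by apply/funext => y; rewrite /diff_quotient subr0 mulr0. Qed.

Let partial2_0 : partial2 0 = 0.
Proof.
apply/funext => p; rewrite /partial2 /patch; case: ifPn => // /set_mem cp.
have FF := I_proper cp.2; rewrite /deriveI -/(0 : R -> R) diff_quotient0.
by apply: cvg_lim => //; exact: cvg_cst.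
Qed.

Let within_continuous0 : {within cyl, continuous (0 : R * R -> R)}.
Proof. by move=> x; exact: cvg_cst. Qed.

Let smooth0 k : smooth k 0.
Proof.
elim: k => [|k IH] /=; first by split=> //; exact: within_continuous0.
rewrite partial1_0 partial2_0; split; first exact: within_continuous0.
split=> // p cp; first exact: (@derivable_cst R R R 0).
have FF := I_proper cp.2; rewrite /derivableI -/(0 : R -> R) diff_quotient0.
exact: is_cvg_cst.
Qed.

Lemma isCk_submod_closed k : submod_closed (isCk k).
Proof.
split=> [|a f g].
  by rewrite inE; split=> //; exact: smooth0.
rewrite !inE => -[sf pf zf] [sg pg zg]; split.
- by apply: smoothD => //; exact: smoothZ.
- by move=> t x; rewrite !fctE pf pg.
- by move=> p cp; rewrite !fctE zf// zg// scaler0 addr0.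
Qed.

HB.instance Definition _ k :=
  GRing.isSubmodClosed.Build _ _ (isCk k) (isCk_submod_closed k).
HB.instance Definition _ k := [SubChoice_isSubLmodule of Ck k by <:].

Let periodic_partial1 f : periodic1 f -> periodic1 (partial1 f).
Proof.
move=> pf t x; rewrite /partial1 /patch.
have -> : ((t + 1, x) \in cyl) = ((t, x) \in cyl) by [].
case: ifPn => //= _; rewrite /derive1; set u := (fun _ => _).
by rewrite [u](_ : _ = fun h => h^-1 *: (f (h + t, x) - f (t, x)))//;
  apply/funext => h; rewrite /u addrA !pf.
Qed.

Let periodic_partial2 f : periodic1 f -> periodic1 (partial2 f).
Proof.
move=> pf t x; rewrite /partial2 /patch.
have -> : ((t + 1, x) \in cyl) = ((t, x) \in cyl) by [].
by case: ifPn => //= _; congr deriveI; apply/funext => y; rewrite pf.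
Qed.

Let cyl00 : cyl (0, 0).
Proof.
split=> //=; rewrite /Idelta/= in_itv/=.
by have d0 : 0 < delta%:num by []; apply/andP; split; lra.
Qed.

Let bounded f : {within cyl, continuous f} -> periodic1 f ->
  has_sup [set `|f p| | p in cyl].
Proof.
move=> cf pf; split.
  by exists `|f (0, 0)|; exists (0, 0) => //; exact: cyl00.
have K : compact (`[0, 1]%classic `*` Idelta : set (R * R)).
  by apply: compact_setX; exact: segment_compact.
have /compact_bounded[M [_ MP]] : compact (f @` (`[0, 1] `*` Idelta)).
  apply: continuous_compact => //.
  by apply: continuous_subspaceW cf => -[t x] [].
exists (M + 1) => _ [[t x] [_ Ix] <-].
have pfn n u : f (u + n%:R, x) = f (u, x).
  elim: n u => [|n IH] u; first by rewrite addr0.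
  by rewrite -natr1 addrA pf.
have pfz (z : int) u : f (u + z%:~R, x) = f (u, x).
  case: z => n; first exact: pfn.
  by rewrite NegzE -(pfn n.+1) mulrNz pmulrn subrK.
rewrite -(pfz (- Num.floor t)); apply: (MP (M + 1)); first by rewrite ltrDl.
exists (t + (- Num.floor t)%:~R, x) => //; split=> //=.
rewrite in_itv/= mulrNz subr_ge0 floor_le/= lerBlDr addrC ltW//.
by rewrite -intrD1 floorD1_gt.
Qed.

Let sup_norm_ge f p : {within cyl, continuous f} -> periodic1 f ->
  cyl p -> `|f p| <= sup_norm f.
Proof.
by move=> cf pf cp; apply: sup_upper_bound; [exact: bounded|exists p].
Qed.

Let sup_norm_le f M : (forall p, cyl p -> `|f p| <= M) -> sup_norm f <= M.
Proof.
move=> fM; apply: ge_sup; last by move=> _ [p cp <-]; exact: fM.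
by exists `|f (0, 0)|; exists (0, 0) => //; exact: cyl00.
Qed.

Let smoothW k f : smooth k f -> {within cyl, continuous f}.
Proof. by case: k => [|k] []. Qed.

Let sup_normD f g : {within cyl, continuous f} -> periodic1 f ->
  {within cyl, continuous g} -> periodic1 g ->
  sup_norm (f + g) <= sup_norm f + sup_norm g.
Proof.
move=> cf pf cg pg; apply: sup_norm_le => p cp.
by rewrite (le_trans (ler_normD _ _))// lerD// sup_norm_ge.
Qed.

Let sup_normZ a f : {within cyl, continuous f} -> periodic1 f ->
  sup_norm (a *: f) = `|a| * sup_norm f.
Proof.
move=> cf pf.
have le b g : {within cyl, continuous g} -> periodic1 g ->
    sup_norm (b *: g) <= `|b| * sup_norm g.
  move=> cg pg; apply: sup_norm_le => p cp.
  by rewrite fctE normrZ ler_wpM2l// sup_norm_ge.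
apply/eqP; rewrite eq_le le//=; have [->|a0] := eqVneq a 0.
  rewrite normr0 mul0r scale0r.
  exact: le_trans (normr_ge0 _) (sup_norm_ge within_continuous0 _ cyl00).
rewrite -ler_pdivlMl ?normr_gt0// -normfV.
rewrite -[X in sup_norm X <= _]scale1r -(mulVf a0) -scalerA le//.
  exact: within_continuousZ.
by move=> t x; rewrite !fctE pf.
Qed.

Let Ck_normD_raw k f g : smooth k f -> periodic1 f -> smooth k g ->
  periodic1 g -> Ck_norm k (f + g) <= Ck_norm k f + Ck_norm k g.
Proof.
elim: k f g => [|k IH] f g sf pf sg pg /=.
  by move: (smoothW sf) (smoothW sg) => cf cg; exact: sup_normD.
have [cf cg] := (smoothW sf, smoothW sg).
case: sf sg => _ [f1 f2 sf1 sf2] [_ [g1 g2 sg1 sg2]].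
rewrite partial1D// partial2D// !ge_max; apply/and3P; split.
- by rewrite (le_trans (sup_normD cf pf cg pg))// lerD// le_max lexx.
- have [p1 p2] := (periodic_partial1 pf, periodic_partial1 pg).
  rewrite (le_trans (IH _ _ sf1 p1 sg1 p2))//.
  by rewrite lerD// !le_max lexx/= orbT.
- have [p1 p2] := (periodic_partial2 pf, periodic_partial2 pg).
  rewrite (le_trans (IH _ _ sf2 p1 sg2 p2))//.
  by rewrite lerD// !le_max lexx/= !orbT.
Qed.

Let Ck_normZ_raw k a f : smooth k f -> periodic1 f ->
  Ck_norm k (a *: f) = `|a| * Ck_norm k f.
Proof.
elim: k f => [|k IH] f sf pf /=; first exact: sup_normZ (smoothW sf) pf.
have cf := smoothW sf; case: sf => _ [f1 f2 sf1 sf2].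
have [p1 p2] := (periodic_partial1 pf, periodic_partial2 pf).
by rewrite partial1Z// partial2Z// sup_normZ// !IH// !maxr_pMr.
Qed.

Lemma sup_norm_le_Ck_norm k f : sup_norm f <= Ck_norm k f.
Proof. by case: k => //= k; rewrite le_max lexx. Qed.

Let smoothP k (f : Ck k) : smooth k f /\ periodic1 f.
Proof. by have := CkP f; rewrite inE => -[]. Qed.

Let Ck_normD k (f g : Ck k) : Ck_norm k (f + g : Ck k) <= Ck_norm k f + Ck_norm k g.
Proof. by have [[? ?] [? ?]] := (smoothP f, smoothP g); exact: Ck_normD_raw. Qed.

Let Ck_normZ k (a : R) (f : Ck k) : Ck_norm k (a *: f : Ck k) = `|a| * Ck_norm k f.
Proof. by have [? ?] := smoothP f; exact: Ck_normZ_raw. Qed.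

Let Ck_norm_eq0 k (f : Ck k) : Ck_norm k f = 0 -> f = 0.
Proof.
move=> f0; apply/val_inj/funext => p; have [sf pf] := smoothP f.
have [cp|cp] := pselect (cyl p); last first.
  by have := CkP f; rewrite inE => -[_ _ zf]; exact: zf.
suff : `|f p| <= 0 by rewrite normr_le0 => /eqP.
rewrite (le_trans (sup_norm_ge (smoothW sf) pf cp))//.
by rewrite -f0 sup_norm_le_Ck_norm.
Qed.

HB.instance Definition _ k :=
  Lmodule_isNormed.Build R (Ck k) (@Ck_normD k) (@Ck_normZ k) (@Ck_norm_eq0 k).

End Cylinder.

Section Renormalization.
Context {R : realType} (delta : {posnum R}).

Local Notation I := (Idelta delta).

Definition p0 (f : R * R -> R) (x : R) : R :=
  \int[lebesgue_measure]_(t in `[0, 1]) f (t, x).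

Definition M_delta : set (R -> R) := [set psi |
  (forall x, I x -> derivableI delta psi x) /\
  {within I, continuous (deriveI delta psi)} /\
  (forall x, I x -> I (psi x)) /\
  (forall x, I x -> psi (- x) = psi x) /\
  psi 0 = 1 /\
  (forall x, I x -> x != 0 -> x * deriveI delta psi x < 0)].

(** The clause [I a'] only says that [psi] may be evaluated at [a']; the point
    [b'] is then in [I] as a value of [psi]. *)
Definition D_R : set (R -> R) := [set psi |
  let a := psi 1 in
  let a' := (1 + delta%:num) * a in
  let b' := psi a' in
  [/\ M_delta psi, a < 0, I a', - a' < b' < 1 & psi b' < - a']].

Definition X (r : nat) : set (R * R -> R) := [set f |
  [/\ f \in isCk delta r, forall p, cyl delta p -> I (f p) & M_delta (p0 f)]].

Definition X0 (r : nat) : set (R * R -> R) := [set f |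
  X r f /\ forall t x, cyl delta (t, x) -> p0 f x = f (t, x)].

(** [omega] is a real representative of an element of R/Z. *)
Definition renorm (omega : R) (g : R * R -> R) : R * R -> R :=
  let a := p0 g 1 in
  (fun p => a^-1 * g (p.1 + omega, g (p.1, a * p.2))) \_ (cyl delta).

(** The formula of [renorm] evaluates [g] only at points of the cylinder and
    does not divide by 0. *)
Definition renorm_defined (g : R * R -> R) : Prop :=
  let a := p0 g 1 in
  a != 0 /\ forall p, cyl delta p -> I (a * p.2) /\ I (g (p.1, a * p.2)).

Definition D_T (r : nat) (omega : R) : set (R * R -> R) := [set g |
  [/\ X r g, renorm_defined g & X r (renorm omega g)]].

Definition D0_T (r : nat) : set (R * R -> R) := [set f | X0 r f /\ D_R (p0 f)].

(** [l] is the Gateaux derivative of [T] at [f] in the direction [h]: for small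
    [t != 0] the difference quotient is of class C^r, and it converges to [l]
    in the C^r norm. *)
Definition is_gateaux (r : nat) (T : (R * R -> R) -> (R * R -> R))
    (f h l : R * R -> R) : Prop :=
  exists (Q : R -> Ck delta r) (L : Ck delta r),
    [/\ \forall t \near 0^',
          Q t = (fun p => t^-1 * (T (fun q => f q + t * h q) p - T f p))
            :> (R * R -> R),
        L = l :> (R * R -> R) & Q t @[t --> 0^'] --> L].

Definition renorm_derivative (omega : R) (Psi h : R * R -> R) : R * R -> R :=
  let psi := p0 Psi in
  let psi' := deriveI delta psi in
  let a := psi 1 in
  let b := p0 h 1 in
  (fun p => let: (t, x) := p in
     a^-1 * psi' (psi (a * x)) * h (t, a * x)
   + a^-1 * h (t + omega, psi (a * x))
   + b / a * psi' (psi (a * x)) * psi' (a * x) * x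
   - b / a ^+ 2 * psi (psi (a * x))) \_ (cyl delta).

End Renormalization.

(* Main.v *)
Require Import Defs.
From HB Require Import structures.
From mathcomp Require Import all_boot all_order all_algebra.
From mathcomp Require Import all_classical all_reals all_analysis.
From mathcomp Require Import lra ring.

Set Implicit Arguments.
Unset Strict Implicit.
Unset Printing Implicit Defensive.

Import Order.TTheory GRing.Theory Num.Theory.
Import numFieldNormedType.Exports.

Local Open Scope classical_set_scope.
Local Open Scope ring_scope.

(** The operator is T(g) = a^-1 g(theta + omega, g(theta, a x)) with
    a = p0 g 1: up to the factor a^-1, it composes g with maps that are themselves
    built from g. Everything rests on the composition of maps of the cylinder,
    [skew_comp om g f (t, x) = f (t + om, g (t, x))].

    This expression is linear in f, and each derivative in g costs one
    derivative of f: its derivative at g in the direction k is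
    k * skew_comp om g (d f / d x). For f in C^(r + 1) the Taylor remainder is
    o(|k|) in the C^r norm ([skew_comp_taylor]), and it is so uniformly for f in
    the unit ball of C^(r + 2). The latter says that
    g |-> (f |-> skew_comp om g f), with values in the bounded operators from
    C^m to C^r, is differentiable when r + 1 < m, with a derivative which is a
    bounded linear image of the same family of operators defined on C^(m - 1).
    By induction this family is C^s in g when r + s < m ([Cn_comp_op]); another
    induction gives that (g, f) |-> skew_comp om g f is C^s from C^r x C^(r + s)
    to C^r ([Cn_comp_op_eval]).

    The estimates in the C^r norm are by induction on r. The chain rule writes
    the partial derivatives of a composition as sums of products of partial
    derivatives of g and compositions of partial derivatives of f; for the Taylor
    remainder, the result closes up because the mixed partial derivatives of f
    agree ([partial_comm]).

    All points Psi of D0_T that are of class C^(r + s) can be taken for the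
    neighborhood. The strict inequalities that define D_R make every
    point at which Psi is evaluated in T(Psi) lie in the interior of the cylinder
    ([D0_stable]), so that the formula of T, with a replaced by the value at
    (0, 1), is a C^s map on a whole ball about Psi in C^(r + s)
    ([Cn_renorm_ext]); it is T itself at the points of D0_T.

    For the Gateaux derivative in a direction h of class C^r only, write
    T(Psi + t h) as the sum of a composition applied to Psi and t times a
    composition applied to h. The first summand is differentiable since Psi has
    a derivative to spare; for the second one it is enough that the cofactor of t
    is continuous at 0 ([gateaux_diff]). *)

(** * Bounded linear maps *)

Section BoundedLinearTheory.
Context {R : realType}.
Implicit Types E F G : normedModType R.

Lemma bl_linear E F (f : boundedLinear E F) : linear f.
Proof. by have := boundedLinearP f; rewrite inE => -[]. Qed.

HB.instance Definition _ E F (f : boundedLinear E F) :=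
  GRing.isLinear.Build R E F _ (boundedLinear_fun f) (bl_linear f).

Lemma bounded_linear_subproof E F (f : E -> F) (M : R) (lf : linear f)
  (fM : forall x, `|f x| <= M * `|x|) : f \in @blin R E F.
Proof. by rewrite inE; split=> //; exists M. Qed.

Definition bounded_linear E F (f : E -> F) (M : R) lf fM : boundedLinear E F :=
  BoundedLinear (@bounded_linear_subproof E F f M lf fM).

Lemma bl_norm E F (f : boundedLinear E F) x : `|f x| <= `|f| * `|x|.
Proof. exact: opnormP. Qed.

Lemma bl_norm_le E F (f : boundedLinear E F) M :
  0 <= M -> (forall x, `|f x| <= M * `|x|) -> `|f| <= M.
Proof. exact: opnorm_le. Qed.

Lemma blB E F (f g : boundedLinear E F) x : (f - g) x = f x - g x.
Proof. by []. Qed.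

Lemma bl_ext E F (f g : boundedLinear E F) : (forall x, f x = g x) -> f = g.
Proof. by move=> fg; apply/val_inj/funext. Qed.

Definition bcomp E F G (g : boundedLinear F G) (f : boundedLinear E F) :
  boundedLinear E G.
Proof.
apply: (@bounded_linear _ _ (fun x => g (f x)) (`|g| * `|f|)).
  by move=> a x y; rewrite !linearP.
move=> x; rewrite (le_trans (bl_norm _ _))// -mulrA ler_wpM2l//.
exact: bl_norm.
Defined.

Lemma bcomp_norm E F G (g : boundedLinear F G) (f : boundedLinear E F) :
  `|bcomp g f| <= `|g| * `|f|.
Proof.
apply: bl_norm_le => [|x]; first by rewrite mulr_ge0.
rewrite (le_trans (bl_norm g _))// -mulrA ler_wpM2l//.
exact: bl_norm.
Qed.

Definition bcompr E F G (g : boundedLinear F G) :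
  boundedLinear (boundedLinear E F) (boundedLinear E G).
Proof.
apply: (@bounded_linear _ _ (bcomp g) `|g|) => [a f h|f]; last exact: bcomp_norm.
by apply: bl_ext => x; exact: (linearP g).
Defined.
Arguments bcompr E {F G}.

(** Composition is itself a bounded bilinear map between operator spaces; the
    derivative of a composite is then an instance of [Cn_bilin]. *)
Definition bcompE E F G :
  boundedLinear (boundedLinear F G)
    (boundedLinear (boundedLinear E F) (boundedLinear E G)).
Proof.
apply: (@bounded_linear _ _ (@bcompr E F G) 1) => [a f h|f].
  by do 2!apply: bl_ext => ?.
by rewrite mul1r; apply: bl_norm_le => // g; exact: bcomp_norm.
Defined.

Lemma bl_norm2 E F G (B : boundedLinear E (boundedLinear F G)) x y :
  `|B x y| <= `|B| * `|x| * `|y|.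
Proof. by rewrite (le_trans (bl_norm (B x) y))// ler_wpM2r// bl_norm. Qed.

Definition bflip_at E F G (B : boundedLinear E (boundedLinear F G)) (y : F) :
  boundedLinear E G.
Proof.
apply: (@bounded_linear _ _ (fun x => B x y) (`|B| * `|y|)) => [a x z|x].
  by rewrite linearP.
by rewrite mulrAC; exact: bl_norm2.
Defined.

Definition bflip E F G (B : boundedLinear E (boundedLinear F G)) :
  boundedLinear F (boundedLinear E G).
Proof.
apply: (@bounded_linear _ _ (bflip_at B) `|B|) => [a x z|y].
  by apply: bl_ext => x'; exact: (linearP (B x')).
apply: bl_norm_le => [|x]; first by rewrite mulr_ge0.
by rewrite mulrAC; exact: bl_norm2.
Defined.

Definition precomp E F G (Z : boundedLinear E F) :
  boundedLinear (boundedLinear F G) (boundedLinear E G) :=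
  bflip (bcompE E F G) Z.

Definition bscale1 E (a : R^o) : boundedLinear E E.
Proof.
apply: (@bounded_linear _ _ (fun x : E => a *: x) `|a|) => [b x y|x].
  by rewrite scalerDr !scalerA mulrC.
by rewrite normrZ.
Defined.

Definition bscale E : boundedLinear R^o (boundedLinear E E).
Proof.
apply: (@bounded_linear _ _ (@bscale1 E) 1) => [b x y|x].
  by apply: bl_ext => z; rewrite /= scalerDl scalerA.
by rewrite mul1r; apply: bl_norm_le => // y; rewrite normrZ.
Defined.

End BoundedLinearTheory.
Arguments bcompE {R} E F G.
Arguments precomp {R E F} G Z.

Section Frechet.
Context {R : realType}.
Implicit Types E F G : normedModType R.

Lemma near_epsP E x (P : E -> Prop) :
  (\forall y \near x, P y) <-> exists2 d, 0 < d & forall y, `|y - x| < d -> P y.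
Proof.
split=> [/nbhs_normP[d d0 H]|[d d0 H]].
  by exists d => // y yd; apply: H; rewrite /ball_/= distrC.
by apply/nbhs_normP; exists d => // y /=; rewrite distrC; exact: H.
Qed.

Lemma near_dist_lt E (x : E) d : 0 < d -> \forall y \near x, `|y - x| < d.
Proof. by move=> d0; apply/near_epsP; exists d. Qed.

Lemma continuous_epsP E F (f : E -> F) x : {for x, continuous f} <->
  forall e, 0 < e -> \forall y \near x, `|f y - f x| < e.
Proof.
split=> [cf e e0|H].
  have := cf _ (near_dist_lt (f x) e0).
  by [].
move=> A /near_epsP[d d0 dA]; have := H _ d0.
by apply: filterS => y; exact: dA.
Qed.

Lemma bl_continuous E F (L : boundedLinear E F) : continuous L.
Proof.
move=> y; apply/continuous_epsP => e e0.
have M0 : 0 < `|L| + 1 by rewrite ltr_wpDl.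
near=> z; rewrite -linearB (le_lt_trans (bl_norm _ _))//.
rewrite (@le_lt_trans _ _ ((`|L| + 1) * `|z - y|))//.
  by rewrite ler_wpM2r// lerDl.
rewrite -ltr_pdivlMl//; near: z.
by apply: near_dist_lt; rewrite mulr_gt0// invr_gt0.
Unshelve. all: by end_near. Qed.

Lemma is_diff_epsP E F (f : E -> F) x (L : boundedLinear E F) :
  is_diff x f L <->
  forall e, 0 < e -> \forall y \near x, `|f y - f x - L (y - x)| <= e * `|y - x|.
Proof.
have cL := @bl_continuous _ _ L.
split=> [[df dfL] e e0|H].
  have /diff_locally/eqaddoP H := df.
  have [d d0 Hd] := (near_epsP _ _).1 (H e e0).
  apply/near_epsP; exists d => // y yd.
  have := Hd (y - x); rewrite subr0 => /(_ yd).
  by rewrite !fctE /= subrK dfL opprD addrA.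
have D : f \o shift x = cst (f x) + (L : E -> F) +o_ (0 : E) id.
  apply/eqaddoP => e e0; have [d d0 Hd] := (near_epsP _ _).1 (H e e0).
  apply/near_epsP; exists d => // y; rewrite subr0 => yd.
  have := Hd (y + x); rewrite addrK => /(_ yd).
  by rewrite !fctE /= opprD addrA.
have dL := diff_unique cL D.
by split => //; apply/diff_locallyP; rewrite dL.
Qed.

Lemma is_diff_lip E F (f : E -> F) x (L : boundedLinear E F) :
  is_diff x f L -> \forall y \near x, `|f y - f x| <= (`|L| + 1) * `|y - x|.
Proof.
move=> /is_diff_epsP/(_ _ ltr01); apply: filterS => y H.
rewrite -[f y - f x](subrK (L (y - x))) (le_trans (ler_normD _ _))//.
by rewrite addrC mulrDl lerD// bl_norm.
Qed.

(** Let r_f and r_g be the first-order remainders of [f] and [g]. The remainder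
    of the product is B(r_f, g x) + B(f x, r_g) + B(f y - f x, g y - g x), and
    the last summand is of second order. *)
Lemma is_diff_bilinear E F G H (B : boundedLinear F (boundedLinear G H))
  (f : E -> F) (g : E -> G) x (df : boundedLinear E F) (dg : boundedLinear E G) :
  is_diff x f df -> is_diff x g dg ->
  is_diff x (fun y => B (f y) (g y))
    (bcomp (bflip B (g x)) df + bcomp (B (f x)) dg).
Proof.
move=> Df Dg; apply/is_diff_epsP => e e0.
(* the coefficients of e' in the final estimate add up to K - 1 *)
pose K := `|B| * (`|g x| + `|f x| + (`|df| + 1)) + 1.
have K0 : 0 < K by rewrite ltr_wpDl// mulr_ge0// !addr_ge0.
have [e' e'0 eK] : exists2 e', 0 < e' & e = e' * K.
  by exists (e / K); rewrite ?divr_gt0// divfK// gt_eqF.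
have cg : {for x, continuous g}.
  by apply: differentiable_continuous; exact: ex_diff.
near=> y; set v := y - x.
have -> : B (f y) (g y) - B (f x) (g x) -
    (bcomp (bflip B (g x)) df + bcomp (B (f x)) dg) v =
    B (f y - f x - df v) (g x) + B (f x) (g y - g x - dg v) +
    B (f y - f x) (g y - g x).
  have -> : (bcomp (bflip B (g x)) df + bcomp (B (f x)) dg) v =
    B (df v) (g x) + B (f x) (dg v) by [].
  have BBl u w z : B (u - w) z = B u z - B w z by rewrite linearB.
  have BBr u w z : B z (u - w) = B z u - B z w by rewrite linearB.
  move: (df v) (dg v) => dfv dgv; rewrite !BBl !BBr.
  move: (B (f y) (g y)) (B (f x) (g x)) (B (f y) (g x)) (B (f x) (g y)) => p q r s.
  move: (B dfv (g x)) (B (f x) dgv) => t u.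
  rewrite [r - q - t + _]addrACA -opprD [RHS]addrAC; congr (_ - _).
  have tele (X Y P : H) : X + Y + (P - Y) = P + X
    by rewrite -addrA [Y + _]addrC subrK addrC.
  by rewrite tele subrKA.
have H1 : `|f y - f x - df v| <= e' * `|v|.
  by rewrite /v; near: y; exact: ((is_diff_epsP f x df).1 Df).
have H2 : `|g y - g x - dg v| <= e' * `|v|.
  by rewrite /v; near: y; exact: ((is_diff_epsP g x dg).1 Dg).
have H3 : `|f y - f x| <= (`|df| + 1) * `|v|.
  by rewrite /v; near: y; exact: is_diff_lip.
have H4 : `|g y - g x| <= e'.
  by apply: ltW; near: y; exact: ((continuous_epsP g x).1 cg).
rewrite eK.
apply: (@le_trans _ _ (`|B| * (e' * `|v|) * `|g x| + `|B| * `|f x| * (e' * `|v|)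
   + `|B| * ((`|df| + 1) * `|v|) * e')).
  rewrite (le_trans (ler_normD _ _))// lerD//.
    rewrite (le_trans (ler_normD _ _))// lerD//.
      by rewrite (le_trans (bl_norm2 _ _ _))// ler_wpM2r// ler_wpM2l.
    by rewrite (le_trans (bl_norm2 _ _ _))// ler_wpM2l// mulr_ge0.
  rewrite (le_trans (bl_norm2 _ _ _))// ler_pM// ?mulr_ge0//.
  by rewrite ler_wpM2l.
rewrite /K.
rewrite [leRHS](_ : _ = (`|B| * (e' * `|v|) * `|g x| + `|B| * `|f x| * (e' * `|v|)
   + `|B| * ((`|df| + 1) * `|v|) * e') + e' * `|v|); last by ring.
by rewrite lerDl mulr_ge0// ltW.
Unshelve. all: by end_near. Qed.

Lemma is_diff_bl E F (L : boundedLinear E F) x : is_diff x L L.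
Proof.
apply/is_diff_epsP => e e0; apply: nearW => y.
by rewrite linearB subrr normr0 mulr_ge0// ltW.
Qed.

Lemma is_diff_bcomp E F G (f : E -> F) (g : F -> G) x
    (df : boundedLinear E F) (dg : boundedLinear F G) :
  is_diff x f df -> is_diff (f x) g dg ->
  is_diff x (fun y => g (f y)) (bcomp dg df).
Proof. by move=> Df Dg; exact: is_diff_comp. Qed.

Lemma bilin_continuous E F G H (B : boundedLinear F (boundedLinear G H))
  (f : E -> F) (g : E -> G) x :
  {for x, continuous f} -> {for x, continuous g} ->
  {for x, continuous (fun y => B (f y) (g y))}.
Proof.
move=> /continuous_epsP cf /continuous_epsP cg; apply/continuous_epsP => e e0.
pose K := `|B| * (`|g x| + 1 + `|f x|) + 1.
have K0 : 0 < K by rewrite ltr_wpDl// mulr_ge0// !addr_ge0.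
have [e' e'0 eK] : exists2 e', 0 < e' & e = e' * K.
  by exists (e / K); rewrite ?divr_gt0// divfK// gt_eqF.
near=> y.
have -> : B (f y) (g y) - B (f x) (g x) =
    B (f y - f x) (g y) + B (f x) (g y - g x).
  by rewrite linearB (linearB (B (f x))) /= subrKA.
have H1 : `|f y - f x| <= e' by apply: ltW; near: y; exact: cf.
have H2 : `|g y - g x| <= e' by apply: ltW; near: y; exact: cg.
have H3 : `|g y| <= `|g x| + 1.
  rewrite -[g y](subrK (g x)) (le_trans (ler_normD _ _))// addrC lerD2l.
  by apply: ltW; near: y; exact: cg.
apply: (@le_lt_trans _ _ (`|B| * e' * (`|g x| + 1) + `|B| * `|f x| * e')).
  rewrite (le_trans (ler_normD _ _))// lerD//.
    by rewrite (le_trans (bl_norm2 _ _ _))// ler_pM// ?mulr_ge0// ler_wpM2l.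
  by rewrite (le_trans (bl_norm2 _ _ _))// ler_wpM2l// mulr_ge0.
rewrite eK /K [ltRHS](_ : _ = `|B| * e' * (`|g x| + 1) + `|B| * `|f x| * e' + e').
  by rewrite ltrDl.
by ring.
Unshelve. all: by end_near. Qed.

End Frechet.

Section Cn_theory.
Context {R : realType}.
Implicit Types E F G H : normedModType R.

Lemma Cn_cst n E F (W : set E) (c : F) : Cn n W (fun=> c).
Proof.
elim: n F c => [|n IH] F c; first by move=> x _; exact: cvg_cst.
by exists (fun=> 0); [move=> x _; exact: is_diff_cst|exact: IH].
Qed.

Lemma CnW n E F (W : set E) (f : E -> F) : Cn n.+1 W f -> Cn n W f.
Proof.
elim: n F f => [|n IH] F f; last by move=> [df Df /IH ?]; exists df.
move=> [df Df _] x Wx; have := Df x Wx => D.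
by apply: differentiable_continuous; exact: ex_diff.
Qed.

Lemma Cn_lin n E F G (W : set E) (f : E -> F) (L : boundedLinear F G) :
  Cn n W f -> Cn n W (fun x => L (f x)).
Proof.
elim: n F G f L => [|n IH] F G f L.
  by move=> cf x Wx; apply: continuous_comp (cf x Wx) _; exact: bl_continuous.
move=> [df Df Cdf]; exists (fun x => bcompr E L (df x)); last exact: IH.
by move=> x Wx; apply: is_diff_bcomp (Df x Wx) _; exact: is_diff_bl.
Qed.

Lemma Cn_add n E F (W : set E) (f g : E -> F) :
  Cn n W f -> Cn n W g -> Cn n W (fun x => f x + g x).
Proof.
elim: n F f g => [|n IH] F f g.
  by move=> cf cg x Wx; apply: continuousD; [exact: cf|exact: cg].
move=> [df Df Cdf] [dg Dg Cdg]; exists (fun x => df x + dg x); last exact: IH.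
move=> x Wx; have [? ?] := (Df x Wx, Dg x Wx).
exact: is_diffD.
Qed.

(** The derivative is a sum of two terms of the same shape: composition of
    operators turns [B] and [f], [dg] (resp. [g], [df]) into another bounded
    bilinear expression. The induction must therefore range over all [B]. *)
Lemma Cn_bilin n E F G H (W : set E) (B : boundedLinear F (boundedLinear G H))
    (f : E -> F) (g : E -> G) :
  Cn n W f -> Cn n W g -> Cn n W (fun x => B (f x) (g x)).
Proof.
elim: n F G H B f g => [|n IH] F G H B f g.
  by move=> cf cg x Wx; apply: bilin_continuous; [exact: cf|exact: cg].
move=> Cf Cg; have [Cf' Cg'] := (CnW Cf, CnW Cg).
move: Cf Cg => [df Df Cdf] [dg Dg Cdg].
exists (fun x => bcomp (bflip B (g x)) (df x) + bcomp (B (f x)) (dg x)).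
  by move=> x Wx; exact: is_diff_bilinear (Df x Wx) (Dg x Wx).
apply: Cn_add.
  exact: (IH _ _ _ (bcomp (bcompE E F H) (bflip B))).
exact: (IH _ _ _ (bcomp (bcompE E G H) B)).
Qed.

(** The chain rule exhibits the derivative as a bilinear expression in
    [dg (f x)] and [df x]. *)
Lemma Cn_comp n E F G (W : set E) (V : set F) (f : E -> F) (g : F -> G) :
  (forall x, W x -> V (f x)) -> Cn n W f -> Cn n V g ->
  Cn n W (fun x => g (f x)).
Proof.
move=> WV; elim: n G g => [|n IH] G g.
  by move=> cf cg x Wx; apply: continuous_comp (cf x Wx) _; exact: cg (WV x Wx).
move=> Cf [dg Dg Cdg]; have Cf' := CnW Cf; case: Cf => df Df Cdf.
exists (fun x => bcomp (dg (f x)) (df x)).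
  by move=> x Wx; exact: is_diff_bcomp (Df x Wx) (Dg _ (WV x Wx)).
exact: (Cn_bilin (bcompE E F G) (IH _ _ Cf' Cdg) Cdf).
Qed.

(** The derivative is a polynomial in the inverse itself, times [df]. *)
Lemma Cn_inv n E (W : set E) (f : E -> R^o) :
  (forall x, W x -> f x != 0) -> Cn n W f -> Cn n W (fun x => (f x)^-1 : R^o).
Proof.
move=> f0; elim: n => [|n IH].
  by move=> cf x Wx; apply: cvgV; [exact: f0|exact: cf].
move=> Cf; have Cf' := IH (CnW Cf); case: Cf => df Df Cdf.
pose sq x := bscale1 R^o (-1 : R^o) (bscale R^o (f x)^-1 (f x)^-1).
have sqE x : sq x = - (f x) ^- 2 by rewrite -exprVn expr2 -mulN1r.
exists (fun x => bscale (boundedLinear E R^o) (sq x) (df x)).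
  move=> x Wx; have Dfx := Df x Wx; have dfx : differentiable f x by exact: ex_diff.
  split; first exact: differentiableV (f0 x Wx).
  rewrite (diffV dfx (f0 x Wx)); apply/funext => v /=.
  by rewrite sqE (diff_val (is_diff_def := Dfx)).
apply: Cn_bilin Cdf.
exact: (Cn_lin (bscale1 R^o (-1 : R^o)) (Cn_bilin (bscale R^o) Cf' Cf')).
Qed.

End Cn_theory.

(** * Derivatives of functions of one real variable, relative to a set *)

Section OneVariable.
Context {R : realType}.
Implicit Types (A : set R) (u v : R -> R).

(** For [A := setT] this is the usual derivative, and for [A := Idelta delta] the
    derivative relative to [Idelta delta], one-sided at its endpoints. The rules
    of calculus are thus proved once for the two variables of the cylinder. *)
Definition has_deriv A u x d := forall e, 0 < e ->
  \forall z \near x, A z -> `|u z - u x - d * (z - x)| <= e * `|z - x|.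

Lemma has_deriv_lip A u x d : has_deriv A u x d ->
  \forall z \near x, A z -> `|u z - u x| <= (`|d| + 1) * `|z - x|.
Proof.
move=> /(_ _ ltr01); apply: filterS => z H /H {}H.
rewrite -[u z - u x](subrK (d * (z - x))) (le_trans (ler_normD _ _))//.
by rewrite addrC mulrDl lerD// normrM.
Qed.

Lemma has_deriv_ext A u v x d : A x -> (forall z, A z -> u z = v z) ->
  has_deriv A u x d -> has_deriv A v x d.
Proof.
move=> Ax uv H e e0; apply: filterS (H e e0) => z Hz Az.
by rewrite -!uv//; exact: Hz.
Qed.

Lemma has_derivD A u v x du dv : has_deriv A u x du -> has_deriv A v x dv ->
  has_deriv A (fun z => u z + v z) x (du + dv).
Proof.
move=> Du Dv e e0; have e20 : 0 < e / 2 by rewrite divr_gt0.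
apply: filterS2 (Du _ e20) (Dv _ e20) => z Hu Hv Az.
rewrite [e]splitr [leRHS]mulrDl.
rewrite [X in `|X|](_ : _ = u z - u x - du * (z - x) +
  (v z - v x - dv * (z - x))); last by ring.
by rewrite (le_trans (ler_normD _ _))// lerD// ?Hu// Hv.
Qed.

Lemma has_derivN A u x du : has_deriv A u x du ->
  has_deriv A (fun z => - u z) x (- du).
Proof.
move=> Du e e0; apply: filterS (Du e e0) => z H Az.
by rewrite mulNr -!opprD normrN; exact: H.
Qed.

Lemma has_derivB A u v x du dv : has_deriv A u x du -> has_deriv A v x dv ->
  has_deriv A (fun z => u z - v z) x (du - dv).
Proof. by move=> Du /has_derivN; exact: has_derivD. Qed.

Lemma has_derivM A u v x du dv : has_deriv A u x du -> has_deriv A v x dv ->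
  has_deriv A (fun z => u z * v z) x (du * v x + u x * dv).
Proof.
move=> Du Dv e e0.
pose K := `|v x| + `|u x| + (`|dv| + 1) * (`|du| + 1) + 1.
have K0 : 0 < K by rewrite ltr_wpDl// !addr_ge0// mulr_ge0// addr_ge0.
have [e' e'0 eK] : exists2 e', 0 < e' & e = e' * K.
  by exists (e / K); rewrite ?divr_gt0// divfK// gt_eqF.
near=> z => Az.
have H1 : `|u z - u x - du * (z - x)| <= e' * `|z - x|.
  by move: Az; near: z; exact: Du.
have H2 : `|v z - v x - dv * (z - x)| <= e' * `|z - x|.
  by move: Az; near: z; exact: Dv.
have H3 : `|u z - u x| <= (`|du| + 1) * `|z - x|.
  by move: Az; near: z; exact: has_deriv_lip.
have H4 : `|v z - v x| <= (`|dv| + 1) * `|z - x|.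
  by move: Az; near: z; exact: has_deriv_lip.
have H5 : `|z - x| <= e' by apply: ltW; near: z; exact: (@near_dist_lt _ R^o).
rewrite [X in `|X|](_ : _ = (u z - u x - du * (z - x)) * v x +
  u x * (v z - v x - dv * (z - x)) + (u z - u x) * (v z - v x)); last by ring.
apply: (@le_trans _ _ (e' * `|z - x| * `|v x| + `|u x| * (e' * `|z - x|)
    + (`|du| + 1) * `|z - x| * ((`|dv| + 1) * e'))).
  rewrite (le_trans (ler_normD _ _))// lerD//.
    rewrite (le_trans (ler_normD _ _))// lerD// normrM.
      by rewrite ler_wpM2r.
    by rewrite ler_wpM2l.
  rewrite normrM ler_pM// (le_trans H4)// ler_wpM2l//.
rewrite eK /K [leRHS](_ : _ = (e' * `|z - x| * `|v x| + `|u x| * (e' * `|z - x|)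
    + (`|du| + 1) * `|z - x| * ((`|dv| + 1) * e')) + e' * `|z - x|); last by ring.
by rewrite lerDl mulr_ge0// ltW.
Unshelve. all: by end_near. Qed.

Lemma has_deriv_cst A c x : has_deriv A (fun=> c) x 0.
Proof.
move=> e e0; apply: (@filterE _ (nbhs x)) => z _.
by rewrite mul0r !subrr normr0 mulr_ge0// ltW.
Qed.

Lemma has_derivZ A a u x du : has_deriv A u x du ->
  has_deriv A (fun z => a * u z) x (a * du).
Proof.
move=> Du; have := has_derivM (has_deriv_cst A a x) Du.
by rewrite mul0r add0r.
Qed.

Lemma has_deriv_comp A (B : set R) u v x du dv :
  (forall z, A z -> B (u z)) ->
  has_deriv A u x du -> has_deriv B v (u x) dv ->
  has_deriv A (fun z => v (u z)) x (dv * du).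
Proof.
move=> AB Du Dv e e0.
pose K := (`|du| + 1) + `|dv| + 1.
have K0 : 0 < K by rewrite ltr_wpDl// !addr_ge0// addr_ge0.
have [e' e'0 eK] : exists2 e', 0 < e' & e = e' * K.
  by exists (e / K); rewrite ?divr_gt0// divfK// gt_eqF.
have [d d0 Hd] := (@near_epsP _ R^o _ _).1 (Dv e' e'0).
have du0 : 0 < `|du| + 1 by rewrite ltr_wpDl.
near=> z => Az.
have H1 : `|u z - u x - du * (z - x)| <= e' * `|z - x|.
  by move: Az; near: z; exact: Du.
have H3 : `|u z - u x| <= (`|du| + 1) * `|z - x|.
  by move: Az; near: z; exact: has_deriv_lip.
have H2 : `|v (u z) - v (u x) - dv * (u z - u x)| <= e' * `|u z - u x|.
  apply: Hd; last exact: AB.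
  rewrite (le_lt_trans H3)// -ltr_pdivlMl//; near: z.
  by apply: (@near_dist_lt _ R^o); rewrite mulr_gt0// invr_gt0.
rewrite [X in `|X|](_ : _ = (v (u z) - v (u x) - dv * (u z - u x)) +
  dv * (u z - u x - du * (z - x))); last by ring.
apply: (@le_trans _ _ (e' * ((`|du| + 1) * `|z - x|) + `|dv| * (e' * `|z - x|))).
  rewrite (le_trans (ler_normD _ _))// lerD//.
    by rewrite (le_trans H2)// ler_wpM2l// ltW.
  by rewrite normrM ler_wpM2l.
rewrite eK /K [leRHS](_ : _ = e' * ((`|du| + 1) * `|z - x|) +
   `|dv| * (e' * `|z - x|) + e' * `|z - x|); last by ring.
by rewrite lerDl mulr_ge0// ltW.
Unshelve. all: by end_near. Qed.

Lemma has_deriv_lin A c x : has_deriv A (fun z => c * z) x c.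
Proof.
move=> e e0; apply: (@filterE _ (nbhs x)) => z _.
by rewrite mulrBr subrr normr0 mulr_ge0// ltW.
Qed.

Lemma has_deriv_continuous A u x d : has_deriv A u x d ->
  forall e, 0 < e -> \forall z \near x, A z -> `|u z - u x| < e.
Proof.
move=> D e e0; near=> z => Az.
have H3 : `|u z - u x| <= (`|d| + 1) * `|z - x|.
  by move: Az; near: z; exact: has_deriv_lip.
have du0 : 0 < `|d| + 1 by rewrite ltr_wpDl.
rewrite (le_lt_trans H3)// -ltr_pdivlMl//; near: z.
by apply: (@near_dist_lt _ R^o); rewrite mulr_gt0// invr_gt0.
Unshelve. all: by end_near. Qed.

Let mulL (d : R) : boundedLinear R^o R^o := bscale1 R^o (d : R^o).

Lemma has_derivTE u x d : has_deriv setT u x d <->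
  is_diff x (u : R^o -> R^o) (mulL d).
Proof.
split=> [H|/is_diff_epsP H] => [|e e0].
  apply/is_diff_epsP => e e0; apply: filterS (H e e0) => z; exact.
by apply: filterS (H e e0).
Qed.

Lemma has_derivTP u x d :
  has_deriv setT u x d <-> derivable u x 1 /\ derive1 u x = d.
Proof.
split=> [/has_derivTE H|[H <-]].
  have du : differentiable u x by exact: ex_diff.
  split; first exact/derivable1_diffP.
  by rewrite derive1E' // (diff_val (is_diff_def := H)) /= /GRing.scale/= mulr1.
apply/has_derivTE; split; first exact/derivable1_diffP.
by rewrite (deriv1E H); apply/funext => v; exact: mulrC.
Qed.

End OneVariable.

Section Interval.
Context {R : realType}.

Lemma within_continuousP (V : normedModType R) (A : set V) (f : V -> R) :
  {within A, continuous f} <->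
  forall x, A x -> forall e, 0 < e -> \forall z \near x, A z -> `|f z - f x| < e.
Proof.
split=> [/subspace_continuousP H x Ax e e0|H].
  exact: (H x Ax _ (@near_dist_lt _ R^o (f x) e e0)).
apply/subspace_continuousP => x Ax B /(@near_epsP _ R^o)[d d0 dB].
by apply: filterS (H x Ax d d0) => z Hz Az; apply: dB; exact: Hz.
Qed.

(** The two distances say that [c] lies between [y] and [y'], whichever is the
    larger. *)
Lemma MVT_interval (A : set R) (u du : R -> R) y y' : is_interval A ->
  (forall z, A z -> has_deriv A u z (du z)) -> A y -> A y' ->
  exists c, [/\ A c, `|c - y| <= `|y' - y|, `|c - y'| <= `|y' - y| &
    u y' - u y = du c * (y' - y)].
Proof.
move=> iA Du; wlog yy' : y y' / y <= y'.
  move=> H Ay Ay'; have [yy'|/ltW yy'] := leP y y'; first exact: H.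
  have [c [Ac cy' cy E]] := H _ _ yy' Ay' Ay.
  exists c; rewrite [`|y' - y|]distrC; split=> //.
  by rewrite -opprB E -mulrN opprB.
move=> Ay Ay'.
have sub z : y <= z <= y' -> A z by move=> ?; exact: iA Ay Ay' _ _.
have [||c] := @MVT_segment _ u du y y' yy'.
- move=> z; rewrite in_itv/= => /andP[yz zy'].
  have : has_deriv setT u z (du z).
    move=> e e0; have Az : A z by apply: sub; rewrite !ltW.
    near=> w => _.
    have : A w.
      apply: sub; apply/andP; split; rewrite ltW//; near: w.
        exact: lt_nbhsr.
      exact: lt_nbhsl.
    by near: w; exact: Du.
  by move=> /has_derivTP[dz <-]; rewrite derive1E; exact/derivableP.
- apply/subspace_continuousP => z; rewrite /= in_itv/= => zy.
  move=> B /(@near_epsP _ R^o)[d d0 dB].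
  apply: filterS (has_deriv_continuous (Du _ (sub _ zy)) d0) => w Hw.
  by rewrite /= in_itv/= => wy; apply: dB; apply: Hw; exact: sub.
rewrite in_itv/= => cy E; exists c; split=> //; first exact: sub.
  by case/andP: cy => yc cy'; rewrite !ger0_norm ?subr_ge0// lerD2r.
case/andP: cy => yc cy'.
by rewrite distrC !ger0_norm ?subr_ge0// lerD2l lerN2.
Unshelve. all: by end_near. Qed.
End Interval.

Section Cyl.
Context {R : realType} (delta : {posnum R}).
Local Notation I := (Idelta delta).

Lemma IdeltaP x : I x <-> `|x| <= 1 + delta%:num.
Proof. by rewrite /Idelta/= in_itv/= ler_norml opprD. Qed.

Lemma is_interval_Idelta : is_interval I.
Proof. exact: interval_is_interval. Qed.

(** No point of the interval is isolated, so derivatives relative to it are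
    unique. *)
Lemma Idelta_dnbhs_proper x : I x -> ProperFilter (within I x^').
Proof.
move=> /IdeltaP Ix; apply: Build_ProperFilter => /= /(@near_epsP _ R^o)[d d0 dI].
have r0 : 0 < delta%:num by [].
pose h := Num.min (d / 2) 1.
have h0 : 0 < h by rewrite lt_min ltr01 divr_gt0.
have hd : h < d by rewrite gt_min gtr_pMr// invf_lt1// ltr1n.
have h1 : h <= 1 by rewrite ge_min lexx orbT.
have [x0|x0] := leP x 0.
  apply: (dI (x + h)).
  - by rewrite addrC addKr ger0_norm// ltW.
  - by rewrite gt_eqF// ltrDl.
  - by apply/IdeltaP; move: Ix; rewrite !ler_norml => /andP[? ?]; lra.
apply: (dI (x - h)).
- by rewrite addrC addKr normrN ger0_norm// ltW.
- by rewrite lt_eqF// gtrBl.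
- by apply/IdeltaP; move: Ix; rewrite !ler_norml => /andP[? ?]; lra.
Qed.

Lemma has_derivI_cvg u x d : has_deriv I u x d <->
  diff_quotient u x y @[y --> within I x^'] --> d.
Proof.
have quot y : y != x -> u y - u x - d * (y - x) =
    (diff_quotient u x y - d) * (y - x).
  by move=> yx; rewrite /diff_quotient mulrBl mulrAC mulVf ?subr_eq0// mul1r.
split=> [H B /(@near_epsP _ R^o)[e e0 eB]|H e e0].
  have e20 : 0 < e / 2 by rewrite divr_gt0.
  apply: filterS (H _ e20) => y Hy yx Iy; apply: eB.
  have := Hy Iy; rewrite quot// normrM ler_pM2r ?normr_gt0 ?subr_eq0// => Hq.
  by rewrite (le_lt_trans Hq)// gtr_pMr// invf_lt1// ltr1n.
have H1 : \forall y \near x, y != x -> I y -> `|diff_quotient u x y - d| < e :=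
  H _ (@near_dist_lt _ R^o d e e0).
move: H1; apply: filterS => y Hy Iy; have [->|yx] := eqVneq y x.
  by rewrite !subrr mulr0 subr0 normr0 mulr0.
by rewrite quot// normrM ler_wpM2r// ltW//; exact: Hy.
Qed.

Lemma has_derivIP u x d : I x ->
  has_deriv I u x d <-> derivableI delta u x /\ deriveI delta u x = d.
Proof.
move=> Ix; have FF := Idelta_dnbhs_proper Ix.
rewrite has_derivI_cvg; split=> [H|[H <-] //].
by split; [apply/cvg_ex; exists d|exact: cvg_lim H].
Qed.

End Cyl.

(** * Functions of class C^k on the cylinder *)

Section Smooth.
Context {R : realType} (delta : {posnum R}).
Local Notation I := (Idelta delta).
Local Notation cyl := (cyl delta).
Local Notation isCk := (isCk delta).
Local Notation pd1 := (partial1 delta).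
Local Notation pd2 := (partial2 delta).
Local Notation N := (Ck_norm delta).
Implicit Types f g : R * R -> R.

Lemma isCkP k f : f \in isCk k <->
  [/\ smooth delta k f, periodic1 f & forall p, ~ cyl p -> f p = 0].
Proof. by rewrite /isCk inE. Qed.

Lemma cylP t x : cyl (t, x) <-> I x.
Proof. by split=> [[]//|Ix]; split. Qed.

Lemma prod_dist_lt (p q : R * R) d :
  `|q - p| < d <-> `|q.1 - p.1| < d /\ `|q.2 - p.2| < d.
Proof. by rewrite prod_normE gt_max; split=> [/andP[]|[-> ->]]. Qed.

Lemma isCk0P f : f \in isCk 0 <->
  [/\ forall p, cyl p -> forall e, 0 < e -> exists2 d, 0 < d & forall q, cyl q ->
        `|q.1 - p.1| < d -> `|q.2 - p.2| < d -> `|f q - f p| < e,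
      periodic1 f & forall p, ~ cyl p -> f p = 0].
Proof.
rewrite isCkP; split=> [[/=[/within_continuousP cf _] pf zf]|[cf pf zf]].
  split=> // p cp e e0; have [d d0 H] := (near_epsP _ _).1 (cf p cp e e0).
  by exists d => // q cq q1 q2; apply: H => //; apply/prod_dist_lt.
split=> //=; split=> //; apply/within_continuousP => p cp e e0.
have [d d0 H] := cf p cp e e0; apply/near_epsP; exists d => // q /prod_dist_lt[q1 q2].
by move=> cq; exact: H.
Qed.

Lemma partial1E f t x d : I x ->
  has_deriv setT (fun t => f (t, x)) t d -> pd1 f (t, x) = d.
Proof.
move=> Ix /has_derivTP[_ <-]; rewrite /partial1 patchE mem_set//.
Qed.

Lemma partial2E f t x d : I x ->
  has_deriv I (fun y => f (t, y)) x d -> pd2 f (t, x) = d.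
Proof.
move=> Ix /(has_derivIP _ _ Ix)[_ <-]; rewrite /partial2 patchE mem_set//.
Qed.

Lemma isCk_cyl k f p : f \in isCk k -> ~ cyl p -> f p = 0.
Proof. by move=> /isCkP[_ _ zf]; exact: zf. Qed.

Lemma periodic_partial1 f : periodic1 f -> periodic1 (pd1 f).
Proof.
move=> pf t x; rewrite /partial1 !patchE.
have -> : ((t + 1, x) \in cyl) = ((t, x) \in cyl) by [].
case: ifPn => //= _; rewrite /derive1; set u := (fun _ => _).
rewrite (_ : u = fun h => h^-1 *: (f (h + t, x) - f (t, x)))//.
by apply/funext => h; rewrite /u addrA !pf.
Qed.

Lemma periodic_partial2 f : periodic1 f -> periodic1 (pd2 f).
Proof.
move=> pf t x; rewrite /partial2 !patchE.
have -> : ((t + 1, x) \in cyl) = ((t, x) \in cyl) by [].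
by case: ifPn => //= _; congr deriveI; apply/funext => y; rewrite pf.
Qed.

Lemma smooth0 k f : smooth delta k f -> smooth delta 0 f.
Proof. by case: k => [|k] [cf _]. Qed.

Lemma isCk0 k f : f \in isCk k -> f \in isCk 0.
Proof. by move=> /isCkP[sf pf zf]; apply/isCkP; split=> //; exact: smooth0 sf. Qed.

Lemma isCk_pd1 k f : f \in isCk k.+1 -> pd1 f \in isCk k.
Proof.
move=> /isCkP[[_ [_ _ s1 s2]] pf zf]; apply/isCkP; split=> //.
  exact: periodic_partial1.
by move=> p cp; rewrite /partial1 patchE memNset.
Qed.

Lemma isCk_pd2 k f : f \in isCk k.+1 -> pd2 f \in isCk k.
Proof.
move=> /isCkP[[_ [_ _ s1 s2]] pf zf]; apply/isCkP; split=> //.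
  exact: periodic_partial2.
by move=> p cp; rewrite /partial2 patchE memNset.
Qed.

Lemma isCk_deriv1 k f t x : f \in isCk k.+1 -> I x ->
  has_deriv setT (fun t => f (t, x)) t (pd1 f (t, x)).
Proof.
move=> /isCkP[[_ [s1 _ _ _]] _ _] Ix; apply/has_derivTP.
split; first by apply: (s1 (t, x)); split.
by rewrite /partial1 patchE mem_set.
Qed.

Lemma isCk_deriv2 k f t x : f \in isCk k.+1 -> I x ->
  has_deriv I (fun y => f (t, y)) x (pd2 f (t, x)).
Proof.
move=> /isCkP[[_ [_ s2 _ _]] _ _] Ix; apply/has_derivIP => //.
split; first by apply: (s2 (t, x)); split.
by rewrite /partial2 patchE mem_set.
Qed.

(** Formulas for the partial derivatives give smoothness and identify the
    partial derivatives, which vanish off the cylinder like the formulas do. *)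
Lemma isCk_intro k f d1 d2 : f \in isCk 0 -> d1 \in isCk k -> d2 \in isCk k ->
  (forall t x, I x -> has_deriv setT (fun t => f (t, x)) t (d1 (t, x))) ->
  (forall t x, I x -> has_deriv I (fun y => f (t, y)) x (d2 (t, x))) ->
  [/\ f \in isCk k.+1, pd1 f = d1 & pd2 f = d2].
Proof.
move=> f0 c1 c2 H1 H2.
have E1 : pd1 f = d1.
  apply/funext => -[t x]; have [Ix|Ix] := pselect (I x).
    exact/partial1E/H1.
  have ctx : ~ cyl (t, x) by move/cylP.
  by rewrite (isCk_cyl c1 ctx) /partial1 patchE memNset.
have E2 : pd2 f = d2.
  apply/funext => -[t x]; have [Ix|Ix] := pselect (I x).
    exact/partial2E/H2.
  have ctx : ~ cyl (t, x) by move/cylP.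
  by rewrite (isCk_cyl c2 ctx) /partial2 patchE memNset.
split=> //; apply/isCkP; move: f0 => /isCkP[[cf _] pf zf]; split=> //=.
split=> //; split.
- by move=> [t x] /cylP Ix; have /has_derivTP[] := H1 t x Ix.
- by move=> [t x] /cylP Ix; have /(has_derivIP _ _ Ix)[] := H2 t x Ix.
- by rewrite E1; move/isCkP : c1 => -[].
- by rewrite E2; move/isCkP : c2 => -[].
Qed.

Lemma isCkW k f : f \in isCk k.+1 -> f \in isCk k.
Proof.
elim: k f => [|k IH] f cf; first exact: isCk0 cf.
have [|||||//] := @isCk_intro k f (pd1 f) (pd2 f).
- exact: isCk0 cf.
- exact/IH/isCk_pd1.
- exact/IH/isCk_pd2.
- by move=> t x; exact: isCk_deriv1 cf.
- by move=> t x; exact: isCk_deriv2 cf.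
Qed.

Lemma isCk_le m k f : (k <= m)%N -> f \in isCk m -> f \in isCk k.
Proof.
move=> /subnKC <-; elim: (m - k)%N f => [|j IH] f; first by rewrite addn0.
by rewrite addnS => /isCkW; exact: IH.
Qed.

Lemma cyl00 : cyl (0, 0).
Proof. by apply/cylP/IdeltaP; rewrite normr0 addr_ge0. Qed.

Lemma periodic1_int f (z : int) t x : periodic1 f -> f (t + z%:~R, x) = f (t, x).
Proof.
move=> pf.
have pfn n u : f (u + n%:R, x) = f (u, x).
  elim: n u => [|n IH] u; first by rewrite addr0.
  by rewrite -natr1 addrA pf.
case: z => n; first exact: pfn.
by rewrite NegzE -(pfn n.+1) mulrNz pmulrn subrK.
Qed.

(** Reduces statements on the noncompact cylinder to angles in [0, 1]. *)
Lemma periodic1_red f (t : R) : periodic1 f ->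
  exists2 z : int, 0 <= t + z%:~R <= 1 & forall y, f (t, y) = f (t + z%:~R, y).
Proof.
move=> pf; exists (- Num.floor t); last by move=> y; rewrite periodic1_int.
rewrite mulrNz subr_ge0 floor_le/= lerBlDr addrC ltW//.
by rewrite -intrD1 floorD1_gt.
Qed.

Let K01 : set (R * R) := `[0, 1]%classic `*` I.

Let compactK : compact K01.
Proof. by apply: compact_setX; exact: segment_compact. Qed.

Lemma isCk_bounded k f : f \in isCk k -> exists M, forall p, cyl p -> `|f p| <= M.
Proof.
move=> /isCk0/isCkP[[cf _] pf _].
have /compact_bounded[M [_ MP]] : compact (f @` K01).
  by apply: continuous_compact => //; apply: continuous_subspaceW cf => -[t x] [].
exists (M + 1) => -[t x] /cylP Ix.
have [z t01 ->] := periodic1_red t pf.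
apply: (MP (M + 1)); first by rewrite ltrDl.
by exists (t + z%:~R, x) => //; split=> //=; rewrite in_itv.
Qed.

Lemma sup_norm_ge k f p : f \in isCk k -> cyl p -> `|f p| <= sup_norm delta f.
Proof.
move=> cf cp; apply: sup_upper_bound; last by exists p.
split; first by exists `|f p|, p.
by have [M HM] := isCk_bounded cf; exists M => _ [q cq <-]; exact: HM.
Qed.

Lemma sup_norm_le f M : (forall p, cyl p -> `|f p| <= M) -> sup_norm delta f <= M.
Proof.
move=> fM; apply: ge_sup; last by move=> _ [p cp <-]; exact: fM.
by exists `|f (0, 0)|; exists (0, 0) => //; exact: cyl00.
Qed.

Lemma Ck_norm_ge k f p : f \in isCk k -> cyl p -> `|f p| <= N k f.
Proof.
by move=> cf cp; rewrite (le_trans (sup_norm_ge cf cp))// sup_norm_le_Ck_norm.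
Qed.

Lemma Ck_norm_pd1 k f : N k (pd1 f) <= N k.+1 f.
Proof. by rewrite /= !le_max lexx orbT. Qed.

Lemma Ck_norm_pd2 k f : N k (pd2 f) <= N k.+1 f.
Proof. by rewrite /= !le_max lexx !orbT. Qed.

Lemma Ck_norm_leS k f M : (forall p, cyl p -> `|f p| <= M) ->
  N k (pd1 f) <= M -> N k (pd2 f) <= M -> N k.+1 f <= M.
Proof. by move=> fM H1 H2; rewrite /= !ge_max H1 H2 sup_norm_le. Qed.

Lemma Ck_norm_leW k f : f \in isCk k.+1 -> N k f <= N k.+1 f.
Proof.
elim: k f => [|k IH] f cf; first exact: sup_norm_le_Ck_norm.
rewrite Ck_norm_leS//.
- by move=> p cp; exact: (Ck_norm_ge cf cp).
- exact: le_trans (IH _ (isCk_pd1 cf)) (Ck_norm_pd1 _ _).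
- exact: le_trans (IH _ (isCk_pd2 cf)) (Ck_norm_pd2 _ _).
Qed.

Lemma Ck_norm_le m k f : (k <= m)%N -> f \in isCk m -> N k f <= N m f.
Proof.
move=> /subnKC <-; elim: (m - k)%N f => [|j IH] f; first by rewrite addn0.
by rewrite addnS => cf; exact: le_trans (IH _ (isCkW cf)) (Ck_norm_leW cf).
Qed.

Lemma Ck_norm_ge0 k f : f \in isCk k -> 0 <= N k f.
Proof. by move=> cf; apply: le_trans (Ck_norm_ge cf cyl00). Qed.

Lemma isCkD k f g : f \in isCk k -> g \in isCk k -> f + g \in isCk k.
Proof. exact: rpredD. Qed.

Lemma isCkB k f g : f \in isCk k -> g \in isCk k -> f - g \in isCk k.
Proof. exact: rpredB. Qed.

Lemma isCkZ k a f : f \in isCk k -> a *: f \in isCk k.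
Proof. exact: rpredZ. Qed.

Lemma Ck_norm_D k f g : f \in isCk k -> g \in isCk k -> N k (f + g) <= N k f + N k g.
Proof. by move=> cf cg; exact: (ler_normD (MkCk cf) (MkCk cg)). Qed.

Lemma partialD k f g : f \in isCk k.+1 -> g \in isCk k.+1 ->
  pd1 (f + g) = pd1 f + pd1 g /\ pd2 (f + g) = pd2 f + pd2 g.
Proof.
move=> cf cg; have [|||t x Ix|t x Ix|//] :=
  @isCk_intro k (f + g) (pd1 f + pd1 g) (pd2 f + pd2 g).
- exact: isCkD (isCk0 cf) (isCk0 cg).
- by apply: isCkD; exact: isCk_pd1.
- by apply: isCkD; exact: isCk_pd2.
- by apply: has_derivD; [exact: isCk_deriv1 cf _|exact: isCk_deriv1 cg _].
- by apply: has_derivD; [exact: isCk_deriv2 cf _|exact: isCk_deriv2 cg _].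
Qed.

Lemma isCk0M f g : f \in isCk 0 -> g \in isCk 0 -> f * g \in isCk 0.
Proof.
move=> /isCkP[[cf _] pf zf] /isCkP[[cg _] pg zg]; apply/isCkP; split.
- by split=> // x; apply: cvgM; [exact: cf|exact: cg].
- by move=> t x; rewrite !fctE pf pg.
- by move=> p cp; rewrite !fctE zf// mul0r.
Qed.

Lemma isCkM k f g : f \in isCk k -> g \in isCk k -> f * g \in isCk k.
Proof.
elim: k f g => [|k IH] f g cf cg; first exact: isCk0M.
have [f1 g1] := (isCk_pd1 cf, isCk_pd1 cg).
have [f2 g2] := (isCk_pd2 cf, isCk_pd2 cg).
have [f' g'] := (isCkW cf, isCkW cg).
have [|||t x Ix|t x Ix|//] := @isCk_intro k (f * g)
  (pd1 f * g + f * pd1 g) (pd2 f * g + f * pd2 g).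
- by apply: isCk0M; [exact: isCk0 cf|exact: isCk0 cg].
- by apply: isCkD; exact: IH.
- by apply: isCkD; exact: IH.
- by apply: has_derivM; [exact: isCk_deriv1 cf _|exact: isCk_deriv1 cg _].
- by apply: has_derivM; [exact: isCk_deriv2 cf _|exact: isCk_deriv2 cg _].
Qed.

Lemma partialM k f g : f \in isCk k.+1 -> g \in isCk k.+1 ->
  pd1 (f * g) = pd1 f * g + f * pd1 g /\ pd2 (f * g) = pd2 f * g + f * pd2 g.
Proof.
move=> cf cg.
have [f1 g1] := (isCk_pd1 cf, isCk_pd1 cg).
have [f2 g2] := (isCk_pd2 cf, isCk_pd2 cg).
have [f' g'] := (isCkW cf, isCkW cg).
have [|||t x Ix|t x Ix|//] := @isCk_intro k (f * g)
  (pd1 f * g + f * pd1 g) (pd2 f * g + f * pd2 g).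
- by apply: isCk0M; [exact: isCk0 cf|exact: isCk0 cg].
- by apply: isCkD; exact: isCkM.
- by apply: isCkD; exact: isCkM.
- by apply: has_derivM; [exact: isCk_deriv1 cf _|exact: isCk_deriv1 cg _].
- by apply: has_derivM; [exact: isCk_deriv2 cf _|exact: isCk_deriv2 cg _].
Qed.

(** Each use of the Leibniz rule doubles the number of terms. *)
Lemma Ck_norm_M k f g : f \in isCk k -> g \in isCk k ->
  N k (f * g) <= 2 ^+ k * (N k f * N k g).
Proof.
elim: k f g => [|k IH] f g cf cg.
  rewrite mul1r; apply: sup_norm_le => p cp.
  by rewrite fctE normrM ler_pM// (Ck_norm_ge _ cp).
have [f0 g0] := (Ck_norm_ge0 cf, Ck_norm_ge0 cg).
have [f1 g1] := (isCk_pd1 cf, isCk_pd1 cg).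
have [f2 g2] := (isCk_pd2 cf, isCk_pd2 cg).
have [f' g'] := (isCkW cf, isCkW cg).
have half u v v' u' : u \in isCk k -> v \in isCk k -> u' \in isCk k ->
    v' \in isCk k -> N k u <= N k.+1 f -> N k v <= N k.+1 g ->
    N k u' <= N k.+1 f -> N k v' <= N k.+1 g ->
    N k (u * v + u' * v') <= 2 ^+ k.+1 * (N k.+1 f * N k.+1 g).
  move=> cu cv cu' cv' uf vg u'f v'g.
  rewrite (le_trans (Ck_norm_D (isCkM cu cv) (isCkM cu' cv')))//.
  rewrite exprS -mulrA mulr_natl mulr2n lerD//.
    by rewrite (le_trans (IH _ _ cu cv))// ler_wpM2l// ler_pM// Ck_norm_ge0.
  by rewrite (le_trans (IH _ _ cu' cv'))// ler_wpM2l// ler_pM// Ck_norm_ge0.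
have [E1 E2] := partialM cf cg.
apply: Ck_norm_leS => [p cp||].
- rewrite fctE normrM (@le_trans _ _ (N k.+1 f * N k.+1 g))//.
    by rewrite ler_pM// (Ck_norm_ge _ cp).
  by rewrite ler_peMl ?mulr_ge0// exprn_ege1// ler1n.
- rewrite E1; apply: half => //; by [exact: Ck_norm_pd1|exact: Ck_norm_leW].
- rewrite E2; apply: half => //; by [exact: Ck_norm_pd2|exact: Ck_norm_leW].
Qed.

(** * Composition of maps of the cylinder *)

Definition valued_in_I g := forall p, cyl p -> I (g p).

(** Composition of [f] with the skew map over the rotation by [om] whose second
    component is [g]. *)
Definition skew_comp om g f : R * R -> R := (fun p => f (p.1 + om, g p)) \_ cyl.

Lemma skew_compE om g f p : cyl p -> skew_comp om g f p = f (p.1 + om, g p).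
Proof. by move=> cp; rewrite /skew_comp patchE mem_set. Qed.

Lemma skew_comp_out om g f p : ~ cyl p -> skew_comp om g f p = 0.
Proof. by move=> cp; rewrite /skew_comp patchE memNset. Qed.

Lemma skew_comp_isCk0 om g f : valued_in_I g -> g \in isCk 0 -> f \in isCk 0 ->
  skew_comp om g f \in isCk 0.
Proof.
move=> ag /isCk0P[cg pg zg] /isCk0P[cf pf zf]; apply/isCk0P; split.
- move=> p cp e e0.
  have [|d d0 H] := cf (p.1 + om, g p) _ e e0; first exact/cylP/ag.
  have [d' d'0 H'] := cg p cp d d0.
  exists (Num.min d d'); first by rewrite lt_min d0.
  move=> q cq; rewrite !lt_min => /andP[q1 q1'] /andP[_ q2]; rewrite !skew_compE//.
  apply: H; first exact/cylP/ag.
    by rewrite /= opprD addrACA subrr addr0.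
  exact: H'.
- move=> t x; have [Ix|Ix] := pselect (I x).
    rewrite !skew_compE; [|exact/cylP..].
    by rewrite /= pg addrAC pf.
  by rewrite !skew_comp_out// => /cylP.
- by move=> p cp; exact: skew_comp_out.
Qed.

(** The increment in the angle is estimated by the mean value theorem at the
    displaced height [y'], where the partial derivative is close to its value at
    [(t, y)] by continuity. *)
Lemma isCk_diff f t y e : f \in isCk 1 -> I y -> 0 < e -> exists2 d, 0 < d &
  forall t' y', I y' -> `|t' - t| < d -> `|y' - y| < d ->
  `|f (t', y') - f (t, y) - pd1 f (t, y) * (t' - t) - pd2 f (t, y) * (y' - y)|
    <= e * (`|t' - t| + `|y' - y|).
Proof.
move=> cf Iy e0.
have /isCk0P[c1 _ _] := isCk_pd1 cf.
have [d1 d10 H1] := c1 (t, y) ((cylP _ _).2 Iy) e e0.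
have [d2 d20 H2] := (@near_epsP _ R^o _ _).1 (isCk_deriv2 t cf Iy e0).
exists (Num.min d1 d2); first by rewrite lt_min d10.
move=> t' y' Iy'; rewrite !lt_min => /andP[t1 t2] /andP[y1 y2].
have [c [_ ct _ E]] := @MVT_interval _ setT (fun t => f (t, y')) (fun t => pd1 f (t, y'))
  t t' (fun _ _ _ _ _ _ => Logic.I) (fun z _ => isCk_deriv1 z cf Iy') Logic.I Logic.I.
rewrite [X in `|X|](_ : _ = (f (t', y') - f (t, y') - pd1 f (t, y) * (t' - t)) +
  (f (t, y') - f (t, y) - pd2 f (t, y) * (y' - y))); last by ring.
rewrite [leRHS]mulrDr (le_trans (ler_normD _ _))// lerD//; last exact: H2.
rewrite E -mulrBl normrM ler_wpM2r// ltW// H1//=.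
exact: le_lt_trans ct t1.
Qed.

Lemma skew_comp_deriv1 om g f t x : valued_in_I g -> f \in isCk 1 -> g \in isCk 1 -> I x ->
  has_deriv setT (fun t => skew_comp om g f (t, x)) t
   (pd1 f (t + om, g (t, x)) + pd2 f (t + om, g (t, x)) * pd1 g (t, x)).
Proof.
move=> ag cf cg Ix.
apply: (@has_deriv_ext _ setT (fun t => f (t + om, g (t, x)))) => //.
  by move=> z _; rewrite skew_compE//; exact/cylP.
set d1 := pd1 f _; set d2 := pd2 f _; set dg := pd1 g _ => e e0.
pose K := 1 + (`|dg| + 1) + `|d2|.
have K0 : 0 < K by rewrite !ltr_pwDl// addr_ge0.
have [e' e'0 eK] : exists2 e', 0 < e' & e = e' * K.
  by exists (e / K); rewrite ?divr_gt0// divfK// gt_eqF.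
have [d d0 H] := isCk_diff (t + om) cf (ag _ ((cylP t x).2 Ix)) e'0.
have Dg := isCk_deriv1 t cg Ix.
near=> z => _.
have H1 : `|g (z, x) - g (t, x) - dg * (z - t)| <= e' * `|z - t|.
  by move: Logic.I; near: z; exact: Dg.
have H3 : `|g (z, x) - g (t, x)| <= (`|dg| + 1) * `|z - t|.
  by move: Logic.I; near: z; exact: has_deriv_lip.
have H4 : `|g (z, x) - g (t, x)| < d.
  by move: Logic.I; near: z; exact: has_deriv_continuous Dg _ d0.
have zt : z + om - (t + om) = z - t by rewrite opprD addrACA subrr addr0.
have := H (z + om) _ (ag _ ((cylP z x).2 Ix)); rewrite zt => /(_ _ H4) H2.
have {}H2 : `|f (z + om, g (z, x)) - f (t + om, g (t, x)) -
    d1 * (z - t) - d2 * (g (z, x) - g (t, x))| <= e' * (`|z - t| + `|g (z, x) - g (t, x)|).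
  by apply: H2; near: z; exact: (@near_dist_lt _ R^o).
rewrite [X in `|X|](_ : _ = (f (z + om, g (z, x)) - f (t + om, g (t, x)) -
  d1 * (z - t) - d2 * (g (z, x) - g (t, x))) +
  d2 * (g (z, x) - g (t, x) - dg * (z - t))); last by ring.
apply: (@le_trans _ _ (e' * (`|z - t| + (`|dg| + 1) * `|z - t|) + `|d2| * (e' * `|z - t|))).
  rewrite (le_trans (ler_normD _ _))// lerD//.
    by rewrite (le_trans H2)// ler_wpM2l ?lerD2l// ltW.
  by rewrite normrM ler_wpM2l.
by rewrite eK /K le_eqVlt; apply/orP; left; apply/eqP; ring.
Unshelve. all: by end_near. Qed.

Lemma skew_comp_deriv2 om g f t x : valued_in_I g -> f \in isCk 1 -> g \in isCk 1 -> I x ->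
  has_deriv I (fun y => skew_comp om g f (t, y)) x
   (pd2 f (t + om, g (t, x)) * pd2 g (t, x)).
Proof.
move=> ag cf cg Ix.
apply: (@has_deriv_ext _ I (fun y => f (t + om, g (t, y)))) => //.
  by move=> z Iz; rewrite skew_compE//; exact/cylP.
apply: (@has_deriv_comp _ I I (fun y => g (t, y)) (fun y => f (t + om, y))).
- by move=> z Iz; apply: ag; exact/cylP.
- exact: isCk_deriv2 cg Ix.
- by apply: isCk_deriv2 cf _; apply: ag; exact/cylP.
Qed.

(** The chain rule in both variables; the hypothesis on compositions of class
    [k] is what the induction in the next lemma provides. *)
Lemma skew_comp_deriv k om g f : valued_in_I g -> f \in isCk k.+1 -> g \in isCk k.+1 ->
  (forall h, h \in isCk k -> skew_comp om g h \in isCk k) ->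
  [/\ skew_comp om g f \in isCk k.+1,
   pd1 (skew_comp om g f) = skew_comp om g (pd1 f) + skew_comp om g (pd2 f) * pd1 g &
   pd2 (skew_comp om g f) = skew_comp om g (pd2 f) * pd2 g].
Proof.
move=> ag cf cg H; have [cf1 cg1] := (isCk_le (ltn0Sn k) cf, isCk_le (ltn0Sn k) cg).
apply: isCk_intro => [||| t x Ix|t x Ix].
- by apply: skew_comp_isCk0 => //; [exact: isCk0 cg|exact: isCk0 cf].
- apply: isCkD; last apply: isCkM; last exact: isCk_pd1.
    exact/H/isCk_pd1.
  exact/H/isCk_pd2.
- by apply: isCkM; [exact/H/isCk_pd2|exact: isCk_pd2].
- by rewrite !fctE !skew_compE; [exact: skew_comp_deriv1|exact/cylP..].
- by rewrite !fctE !skew_compE; [exact: skew_comp_deriv2|exact/cylP..].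
Qed.

Lemma skew_comp_isCk k om g f : valued_in_I g -> f \in isCk k -> g \in isCk k ->
  skew_comp om g f \in isCk k.
Proof.
move=> ag; elim: k f => [|k IH] f cf cg; first exact: skew_comp_isCk0.
have [|//] := skew_comp_deriv (om := om) ag cf cg.
by move=> h ch; apply: IH ch _; exact: isCkW.
Qed.

Lemma skew_comp_pd k om g f : valued_in_I g -> f \in isCk k.+1 -> g \in isCk k.+1 ->
  pd1 (skew_comp om g f) = skew_comp om g (pd1 f) + skew_comp om g (pd2 f) * pd1 g /\
  pd2 (skew_comp om g f) = skew_comp om g (pd2 f) * pd2 g.
Proof.
move=> ag cf cg; have [|_ -> ->//] := skew_comp_deriv (om := om) ag cf cg.
by move=> h ch; apply: skew_comp_isCk ag ch _; exact: isCkW.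
Qed.

End Smooth.

(** * Mixed partial derivatives and moduli of continuity *)

Section MixedPartials.
Context {R : realType} (delta : {posnum R}).
#[local] Opaque partial1 partial2 skew_comp.
Local Notation I := (Idelta delta).
Local Notation cyl := (cyl delta).
Local Notation isCk := (isCk delta).
Local Notation pd1 := (partial1 delta).
Local Notation pd2 := (partial2 delta).
Local Notation N := (Ck_norm delta).
Local Notation valued_in_I := (valued_in_I delta).
Local Notation skew_comp := (skew_comp delta).
Implicit Types f g : R * R -> R.

Lemma MVT_fibre f t y y' : f \in isCk 1 -> I y -> I y' -> exists c,
  [/\ I c, `|c - y| <= `|y' - y| &
    f (t, y') - f (t, y) = pd2 f (t, c) * (y' - y)].
Proof.
move=> cf Iy Iy'.
have [c [Ic cy _ E]] := @MVT_interval _ I (fun y => f (t, y)) (fun y => pd2 f (t, y))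
  y y' (@is_interval_Idelta _ delta) (fun z Iz => isCk_deriv2 t cf Iz) Iy Iy'.
by exists c.
Qed.

(** Both mixed derivatives at [(t, y)] are limits of the same second difference,
    to which the mean value theorem is applied in either order. The second
    height is chosen inside the interval, so its endpoints are no exception. *)
Lemma schwarz f f1 f2 f12 f21 t y :
  (forall t x, I x -> has_deriv setT (fun t => f (t, x)) t (f1 (t, x))) ->
  (forall t x, I x -> has_deriv I (fun y => f (t, y)) x (f2 (t, x))) ->
  (forall t x, I x -> has_deriv setT (fun t => f2 (t, x)) t (f12 (t, x))) ->
  (forall t x, I x -> has_deriv I (fun y => f1 (t, y)) x (f21 (t, x))) ->
  f12 \in isCk 0 -> f21 \in isCk 0 -> I y -> f12 (t, y) = f21 (t, y).
Proof.
move=> D1 D2 D12 D21 /isCk0P[k12 _ _] /isCk0P[k21 _ _] Iy.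
apply/eqP; rewrite -subr_eq0 -normr_eq0 eq_le normr_ge0 andbT.
apply/ler_addgt0Pl => e e0; rewrite addr0.
have e20 : 0 < e / 2 by rewrite divr_gt0.
have cty := (cylP delta t y).2 Iy.
have [d d0 H] := k12 _ cty _ e20; have [d' d'0 H'] := k21 _ cty _ e20.
have [h [h0 hd hd' [y' [Iy' yy']]]] : exists h, [/\ 0 < h, h < d, h < d' &
    exists y', I y' /\ `|y' - y| = h].
  pose h := Num.min (Num.min (d / 2) (d' / 2)) 1.
  have h0 : 0 < h by rewrite !lt_min ltr01 !divr_gt0.
  have h1 : h <= 1 by rewrite ge_min lexx orbT.
  have hd : h < d by rewrite !gt_min gtr_pMr// invf_lt1// ltr1n.
  have hd' : h < d' by rewrite !gt_min [d' / 2 < _]gtr_pMr// invf_lt1// ltr1n orbT.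
  have r0 : 0 < delta%:num by [].
  exists h; split=> //; move/IdeltaP: Iy; rewrite ler_norml => /andP[? ?].
  have [x0|x0] := leP y 0.
    exists (y + h); split; first by apply/IdeltaP; rewrite ler_norml; lra.
    by rewrite addrC addKr ger0_norm// ltW.
  exists (y - h); split; first by apply/IdeltaP; rewrite ler_norml; lra.
  by rewrite addrC addKr normrN ger0_norm// ltW.
pose t' := t + h.
have tt' : `|t' - t| = h by rewrite /t' addrC addKr ger0_norm// ltW.
pose u := fun s => f (s, y') - f (s, y).
have T (A : R) : [set: R] A by [].
have [c [_ ct _ Ec]] := @MVT_interval _ setT u (fun s => f1 (s, y') - f1 (s, y))
  t t' (fun _ _ _ _ _ _ => Logic.I)
  (fun z _ => has_derivB (D1 z y' Iy') (D1 z y Iy)) (T t) (T t').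
have [b [Ib bd _ Eb]] := @MVT_interval _ I (fun y => f1 (c, y)) (fun y => f21 (c, y))
  y y' (@is_interval_Idelta _ delta) (fun z Iz => D21 c z Iz) Iy Iy'.
pose v := fun z => f (t', z) - f (t, z).
have [b' [Ib' bd' _ Eb']] := @MVT_interval _ I v (fun z => f2 (t', z) - f2 (t, z))
  y y' (@is_interval_Idelta _ delta)
  (fun z Iz => has_derivB (D2 t' z Iz) (D2 t z Iz)) Iy Iy'.
have [c' [_ ct' _ Ec']] := @MVT_interval _ setT (fun s => f2 (s, b'))
  (fun s => f12 (s, b')) t t' (fun _ _ _ _ _ _ => Logic.I)
  (fun z _ => D12 z b' Ib') (T t) (T t').
have E : f12 (c', b') = f21 (c, b).
  have nz : (t' - t) * (y' - y) != 0.
    by rewrite mulf_neq0// -normr_gt0 ?tt' ?yy'.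
  apply: (mulIf nz).
  have X1 : v y' - v y = f12 (c', b') * (t' - t) * (y' - y).
    by rewrite Eb' Ec'.
  have Y1 : u t' - u t = f21 (c, b) * (y' - y) * (t' - t).
    by rewrite Ec Eb.
  rewrite mulrA -X1 [RHS]mulrA mulrAC -Y1.
  by rewrite /u /v; ring.
rewrite (_ : _ - _ = (f21 (c, b) - f21 (t, y)) - (f12 (c', b') - f12 (t, y)));
  last by rewrite E; ring.
rewrite [e]splitr (le_trans (ler_normB _ _))// lerD// ltW//.
- apply: H'; [exact/cylP| |].
    by rewrite (le_lt_trans ct)// tt'.
  by rewrite (le_lt_trans bd)// yy'.
- apply: H; [exact/cylP| |].
    by rewrite (le_lt_trans ct')// tt'.
  by rewrite (le_lt_trans bd')// yy'.
Qed.

Lemma partial_comm k f : f \in isCk k.+2 -> pd1 (pd2 f) = pd2 (pd1 f).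
Proof.
move=> cf; have [c1 c2] := (isCk_pd1 cf, isCk_pd2 cf).
have [c12 c21] := (isCk_pd1 c2, isCk_pd2 c1).
apply/funext => -[t y]; have [Iy|Iy] := pselect (I y); last first.
  have ny : ~ cyl (t, y) by move/cylP.
  by rewrite (isCk_cyl c12 ny) (isCk_cyl c21 ny).
apply: (@schwarz f (pd1 f) (pd2 f) (pd1 (pd2 f)) (pd2 (pd1 f)) t y _ _ _ _ _ _ Iy)
  => [s x Ix|s x Ix|s x Ix|s x Ix||].
- exact: isCk_deriv1 cf Ix.
- exact: isCk_deriv2 cf Ix.
- exact: isCk_deriv1 c2 Ix.
- exact: isCk_deriv2 c1 Ix.
- exact: isCk0 c12.
- exact: isCk0 c21.
Qed.

(** A change of [g] in [skew_comp om g f] moves the second argument of [f] and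
    leaves the first one in place: only oscillations in the second variable, of
    all partial derivatives of order at most [k], have to be controlled. *)
Fixpoint osc k (eta m : R) f : Prop :=
  (forall t y y', I y -> I y' -> `|y' - y| <= eta -> `|f (t, y') - f (t, y)| <= m) /\
  if k is j.+1 then osc j eta m (pd1 f) /\ osc j eta m (pd2 f) else True.

Lemma osc0 k eta m f : osc k eta m f -> forall t y y', I y -> I y' ->
  `|y' - y| <= eta -> `|f (t, y') - f (t, y)| <= m.
Proof. by case: k => [|k] []. Qed.

Lemma osc_le k eta eta' m m' f :
  eta' <= eta -> m <= m' -> osc k eta m f -> osc k eta' m' f.
Proof.
move=> le_eta le_m; elim: k f => [|k IH] f /= [H].
  by split=> // t y y' Iy Iy' yy'; rewrite (le_trans _ le_m)// H// (le_trans yy').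
move=> [/IH ? /IH ?]; split=> // t y y' Iy Iy' yy'.
by rewrite (le_trans _ le_m)// H// (le_trans yy').
Qed.

Lemma oscW k eta m f : osc k.+1 eta m f -> osc k eta m f.
Proof.
elim: k f => [|k IH] f; first by move=> [].
by move=> [H [/IH ? /IH ?]].
Qed.

(** One more derivative makes the modulus linear, uniformly on bounded sets. *)
Lemma osc_lip k f eta : f \in isCk k.+1 -> 0 <= eta ->
  osc k eta (N k.+1 f * eta) f.
Proof.
move=> + eta0; elim: k f => [|k IH] f cf.
  split=> // t y y' Iy Iy' yy'; have [c [Ic _ ->]] := MVT_fibre t cf Iy Iy'.
  rewrite normrM ler_pM//; apply: le_trans (Ck_norm_pd2 _ _ _).
  exact: Ck_norm_ge (isCk_pd2 cf) ((cylP _ _ _).2 Ic).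
have cf1 := isCk_le (ltn0Sn _) cf.
split=> /= [t y y' Iy Iy' yy'|].
  have [c [Ic _ ->]] := MVT_fibre t cf1 Iy Iy'.
  rewrite normrM ler_pM//; apply: le_trans (Ck_norm_pd2 _ k.+1 _).
  exact: Ck_norm_ge (isCk_pd2 cf) ((cylP _ _ _).2 Ic).
split.
  by apply: osc_le (lexx _) _ (IH _ (isCk_pd1 cf)); rewrite ler_wpM2r// Ck_norm_pd1.
by apply: osc_le (lexx _) _ (IH _ (isCk_pd2 cf)); rewrite ler_wpM2r// Ck_norm_pd2.
Qed.

(** Uniform continuity, from the compactness of [0, 1] x I and periodicity. *)
Lemma osc0_exists f m : f \in isCk 0 -> 0 < m ->
  exists2 eta, 0 < eta & osc 0 eta m f.
Proof.
move=> /isCk0P[cf pf _] m0.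
pose K : set (R * R) := `[0, 1]%classic `*` I.
pose P eta (p : R * R) := forall y', I y' -> `|y' - p.2| <= eta ->
  `|f (p.1, y') - f p| <= m.
have cK : compact K by apply: compact_setX; exact: segment_compact.
have /(_ R 0^'+ P _)[|e /= e0 H] :=
    (near_covering_withinP _).2 ((compact_near_coveringP _).1 cK).
  move=> p [_ Ip]; have m20 : 0 < m / 2 by rewrite divr_gt0.
  have [d d0 H] := cf p ((cylP _ _ _).2 Ip) _ m20.
  have d20 : 0 < d / 2 by rewrite divr_gt0.
  have dd : d / 2 < d by rewrite gtr_pMr// invf_lt1// ltr1n.
  exists ([set q | `|q - p| < d / 2], [set eta | eta < d / 2]).
    split; first exact: (@near_dist_lt _ (R * R)%type p _ d20).
    by exists (d / 2) => // z /=; rewrite sub0r normrN => zd _; rewrite (le_lt_trans (ler_norm _)).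
  move=> [q eta] /= [/prod_dist_lt[q1 q2] etad] [_ Iq] y' Iy' yq.
  rewrite [m]splitr -[_ - _](subrKA (f p)) (le_trans (ler_normD _ _))// lerD// ltW//.
    apply: H => /=; [exact/cylP|exact: lt_trans q1 dd|].
    rewrite -[_ - _](subrKA q.2) (le_lt_trans (ler_normD _ _))// [d]splitr.
    by rewrite ler_ltD// (le_trans yq)// ltW.
  by rewrite distrC H//=; [exact: lt_trans q1 dd|exact: lt_trans q2 dd].
exists (e / 2); first by rewrite divr_gt0.
split=> // t y y' Iy Iy' yy'.
have [z t01 E] := periodic1_red t pf; rewrite !E.
have := H (e / 2) _ _ (t + z%:~R, y); rewrite /P/=; apply => //.
- by rewrite sub0r normrN ger0_norm ?divr_ge0 ?ltW// gtr_pMr// invf_lt1// ltr1n.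
- by rewrite divr_gt0.
Qed.

Lemma osc_exists k f m : f \in isCk k -> 0 < m ->
  exists2 eta, 0 < eta & osc k eta m f.
Proof.
move=> + m0; have base f' (cf' : f' \in isCk 0) := osc0_exists cf' m0.
elim: k f => [|k IH] f cf; first exact: base.
have [e1 e10 H1] := IH _ (isCk_pd1 cf); have [e2 e20 H2] := IH _ (isCk_pd2 cf).
have [e3 e30 H3] := base _ (isCk0 cf).
exists (Num.min e3 (Num.min e1 e2)); first by rewrite !lt_min e30 e10.
split=> /=.
  by move=> t y y' Iy Iy'; rewrite le_min => /andP[? _]; exact: (osc0 H3).
split; [apply: osc_le (lexx _) H1|apply: osc_le (lexx _) H2];
  by rewrite !ge_min lexx ?orbT.
Qed.

End MixedPartials.

(** * Estimates for the composition of maps of the cylinder *)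

Section Estimates.
Context {R : realType} (delta : {posnum R}).
#[local] Opaque partial1 partial2 skew_comp.
Local Notation I := (Idelta delta).
Local Notation cyl := (cyl delta).
Local Notation isCk := (isCk delta).
Local Notation pd1 := (partial1 delta).
Local Notation pd2 := (partial2 delta).
Local Notation N := (Ck_norm delta).
Local Notation valued_in_I := (valued_in_I delta).
Local Notation skew_comp := (skew_comp delta).
Local Notation osc := (osc delta).
Implicit Types f g : R * R -> R.

Lemma partialB k f g : f \in isCk k.+1 -> g \in isCk k.+1 ->
  pd1 (f - g) = pd1 f - pd1 g /\ pd2 (f - g) = pd2 f - pd2 g.
Proof.
move=> cf cg; have [|||t x Ix|t x Ix|//] :=
  @isCk_intro _ delta k (f - g) (pd1 f - pd1 g) (pd2 f - pd2 g).
- exact: isCkB (isCk0 cf) (isCk0 cg).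
- by apply: isCkB; exact: isCk_pd1.
- by apply: isCkB; exact: isCk_pd2.
- by apply: has_derivB; [exact: isCk_deriv1 cf _|exact: isCk_deriv1 cg _].
- by apply: has_derivB; [exact: isCk_deriv2 cf _|exact: isCk_deriv2 cg _].
Qed.

Lemma partialZ k a f : f \in isCk k.+1 ->
  pd1 (a *: f) = a *: pd1 f /\ pd2 (a *: f) = a *: pd2 f.
Proof.
move=> cf; have [|||t x Ix|t x Ix|//] :=
  @isCk_intro _ delta k (a *: f) (a *: pd1 f) (a *: pd2 f).
- exact: isCkZ (isCk0 cf).
- exact: isCkZ (isCk_pd1 cf).
- exact: isCkZ (isCk_pd2 cf).
- by apply: has_derivZ; exact: isCk_deriv1 cf _.
- by apply: has_derivZ; exact: isCk_deriv2 cf _.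
Qed.

Lemma Ck_norm_M_le k f g a b : f \in isCk k -> g \in isCk k -> N k f <= a -> N k g <= b ->
  N k (f * g) <= 2 ^+ k * (a * b).
Proof.
move=> cf cg fa gb; rewrite (le_trans (Ck_norm_M cf cg))// ler_wpM2l//.
by apply: ler_pM => //; [exact: Ck_norm_ge0 cf|exact: Ck_norm_ge0 cg].
Qed.

Lemma Ck_norm_D_le k f g a b : f \in isCk k -> g \in isCk k -> N k f <= a -> N k g <= b ->
  N k (f + g) <= a + b.
Proof. by move=> cf cg fa gb; rewrite (le_trans (Ck_norm_D cf cg))// lerD. Qed.

Lemma skew_comp_bound k (M : R) : 0 <= M -> exists2 c, 0 <= c & forall om g f, valued_in_I g ->
  f \in isCk k -> g \in isCk k -> N k g <= M -> N k (skew_comp om g f) <= c * N k f.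
Proof.
move=> M0; elim: k => [|k [c c0 IH]].
  exists 1 => // om g f ag cf cg _; rewrite mul1r; apply: sup_norm_le => p cp.
  by rewrite skew_compE//; apply: (Ck_norm_ge cf); apply/cylP/ag.
(* one summand for the values of the composition, and then one for each term
   of the chain rule *)
exists (1 + c + 2 ^+ k * (c * M)); first by rewrite !addr_ge0// !mulr_ge0.
move=> om g f ag cf cg gM; have [E1 E2] := skew_comp_pd om ag cf cg.
have [cf1 cf2] := (isCk_pd1 cf, isCk_pd2 cf).
have [cg1 cg2] := (isCk_pd1 cg, isCk_pd2 cg).
have cg' := isCkW cg; have gM' : N k g <= M := le_trans (Ck_norm_leW cg) gM.
have X0 := Ck_norm_ge0 cf.
have P1 : N k (skew_comp om g (pd1 f)) <= c * N k.+1 f.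
  by rewrite (le_trans (IH _ _ _ ag cf1 cg' gM'))// ler_wpM2l// Ck_norm_pd1.
have P2 : N k (skew_comp om g (pd2 f)) <= c * N k.+1 f.
  by rewrite (le_trans (IH _ _ _ ag cf2 cg' gM'))// ler_wpM2l// Ck_norm_pd2.
have C1 := skew_comp_isCk om ag cf1 cg'; have C2 := skew_comp_isCk om ag cf2 cg'.
have Q0 : 0 <= 2 ^+ k * (c * N k.+1 f * M) by rewrite !mulr_ge0.
have cX0 : 0 <= c * N k.+1 f by rewrite mulr_ge0.
rewrite [leRHS](_ : _ = N k.+1 f + c * N k.+1 f + 2 ^+ k * (c * N k.+1 f * M)); last by ring.
apply: Ck_norm_leS => [p cp||].
- rewrite skew_compE// (@le_trans _ _ (N k.+1 f))//.
    by apply: (Ck_norm_ge cf); apply/cylP/ag.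
  by rewrite -addrA lerDl addr_ge0.
- rewrite E1 -addrA ler_wpDl//; apply: Ck_norm_D_le => //; first exact: isCkM.
  by apply: Ck_norm_M_le => //; exact: le_trans (Ck_norm_pd1 _ _ _) gM.
- rewrite E2 ler_wpDl ?addr_ge0//; apply: Ck_norm_M_le => //.
  exact: le_trans (Ck_norm_pd2 _ _ _) gM.
Qed.

(** Keeping the modulus of [f] as a datum lets the estimate serve twice: for a
    single [f] of class C^k, where [m] is small by uniform continuity, and
    uniformly on balls of C^(k + 1), where [m] is linear in the distance of [g]
    and [g']. *)
Lemma skew_comp_cont k (M : R) : 0 <= M -> exists2 c, 0 <= c &
  forall om g g' f m, valued_in_I g -> valued_in_I g' -> f \in isCk k -> g \in isCk k ->
  g' \in isCk k -> N k g <= M -> N k g' <= M -> 0 <= m ->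
  osc k (N k (g' - g)) m f ->
  N k (skew_comp om g' f - skew_comp om g f) <= c * (m + N k f * N k (g' - g)).
Proof.
move=> M0; elim: k => [|k [c c0 IH]].
  exists 1 => // om g g' f m ag ag' cf cg cg' _ _ m0 H; rewrite mul1r.
  apply: sup_norm_le => p cp; rewrite fctE/= -![(- _) p]/(- _ p) !skew_compE//.
  rewrite (@le_trans _ _ m)//; last first.
    by rewrite lerDl mulr_ge0//; [exact: Ck_norm_ge0 cf|exact: Ck_norm_ge0 (isCkB cg' cg)].
  apply: (osc0 H); [exact: ag|exact: ag'|].
  exact: (Ck_norm_ge (isCkB cg' cg) cp).
have [cB cB0 HB] := skew_comp_bound k M0.
(* here the product in the chain rule contributes two terms: the change of the
   composition and the change of the derivative of g *)
exists (1 + c + 2 ^+ k * (c * M) + 2 ^+ k * cB).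
  by rewrite !addr_ge0// !mulr_ge0.
move=> om g g' f m ag ag' cf cg cg' gM gM' m0 H.
set d := g' - g; have cd : d \in isCk k.+1 by exact: isCkB.
have [E1 E2] := skew_comp_pd om ag cf cg; have [E1' E2'] := skew_comp_pd om ag' cf cg'.
have [cf1 cf2] := (isCk_pd1 cf, isCk_pd2 cf).
have [cg1 cg2] := (isCk_pd1 cg, isCk_pd2 cg).
have [cg1' cg2'] := (isCk_pd1 cg', isCk_pd2 cg').
have [cd1 cd2] := (isCk_pd1 cd, isCk_pd2 cd).
have [[wg wg'] wd] := (isCkW cg, isCkW cg', isCkW cd).
have gM1 := le_trans (Ck_norm_leW cg) gM.
have gM1' := le_trans (Ck_norm_leW cg') gM'.
pose X := m + N k.+1 f * N k.+1 d.
have [f0 d0] := (Ck_norm_ge0 cf, Ck_norm_ge0 cd).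
have X0 : 0 <= X by rewrite addr_ge0// mulr_ge0.
have sub h : h \in isCk k -> N k h <= N k.+1 f -> osc k (N k.+1 d) m h ->
    N k (skew_comp om g' h - skew_comp om g h) <= c * X.
  move=> ch hf oh; have := IH om g g' h m ag ag' ch wg wg' gM1 gM1' m0.
  move=> /(_ (osc_le (Ck_norm_leW cd) (lexx _) oh)) /le_trans; apply.
  rewrite ler_wpM2l// lerD2l; apply: ler_pM => //.
  - exact: Ck_norm_ge0 ch.
  - exact: Ck_norm_ge0 wd.
  - exact: Ck_norm_leW.
case: H => h0 [h1 h2].
have P1 := sub _ cf1 (Ck_norm_pd1 _ _ _) h1; have P2 := sub _ cf2 (Ck_norm_pd2 _ _ _) h2.
have B2 : N k (skew_comp om g (pd2 f)) <= cB * N k.+1 f.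
  by rewrite (le_trans (HB _ _ _ ag cf2 wg gM1))// ler_wpM2l// Ck_norm_pd2.
have C h (ch : h \in isCk k) := skew_comp_isCk om ag ch wg.
have C' h (ch : h \in isCk k) := skew_comp_isCk om ag' ch wg'.
have D h (ch : h \in isCk k) := isCkB (C' h ch) (C h ch).
have S p dp : p \in isCk k -> dp \in isCk k -> N k p <= M -> N k dp <= N k.+1 d ->
  N k ((skew_comp om g' (pd2 f) - skew_comp om g (pd2 f)) * p + skew_comp om g (pd2 f) * dp)
    <= 2 ^+ k * (c * M) * X + 2 ^+ k * cB * X.
  move=> cp cdp pM dpd; apply: Ck_norm_D_le; [exact/isCkM/cp/D|exact/isCkM/cdp/C| |].
    rewrite -mulrA [c * M * X]mulrAC; apply: Ck_norm_M_le => //; exact: D.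
  apply: (@le_trans _ _ (2 ^+ k * (cB * N k.+1 f * N k.+1 d))).
    by apply: Ck_norm_M_le => //; exact: C.
  rewrite -!mulrA ler_wpM2l// ler_wpM2l// /X; exact: ler_wpDl.
have S0 : 0 <= 2 ^+ k * (c * M) * X + 2 ^+ k * cB * X.
  by rewrite addr_ge0// !mulr_ge0.
rewrite [leRHS](_ : _ = X + c * X + (2 ^+ k * (c * M) * X + 2 ^+ k * cB * X));
  last by rewrite /X; ring.
have [DE1 DE2] := partialB (skew_comp_isCk om ag' cf cg') (skew_comp_isCk om ag cf cg).
have [dE1 dE2] := partialB cg' cg.
apply: Ck_norm_leS => [p cp||].
- rewrite fctE/= -![(- _) p]/(- _ p) !skew_compE//.
  apply: (@le_trans _ _ X); last by rewrite -addrA lerDl addr_ge0// mulr_ge0.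
  apply: (@le_trans _ _ m); last by rewrite lerDl mulr_ge0.
  by apply: h0; [exact: ag|exact: ag'|exact: (Ck_norm_ge cd cp)].
- rewrite DE1 E1 E1' (_ : _ - _ = (skew_comp om g' (pd1 f) - skew_comp om g (pd1 f)) +
    ((skew_comp om g' (pd2 f) - skew_comp om g (pd2 f)) * pd1 g' + skew_comp om g (pd2 f) * pd1 d)).
    rewrite -[leRHS]addrA ler_wpDl//; apply: Ck_norm_D_le => //; first exact: D.
      by apply: isCkD; apply: isCkM => //; [exact: D|exact: C].
    apply: S => //; [exact: le_trans (Ck_norm_pd1 _ _ _) gM'|exact: Ck_norm_pd1].
  rewrite dE1; move: (skew_comp om g' (pd1 f)) (skew_comp om g (pd1 f))
    (skew_comp om g' (pd2 f)) (skew_comp om g (pd2 f)) => ? ? ? ?; ring.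
- rewrite DE2 E2 E2' (_ : _ - _ =
    ((skew_comp om g' (pd2 f) - skew_comp om g (pd2 f)) * pd2 g' + skew_comp om g (pd2 f) * pd2 d)).
    rewrite ler_wpDl ?addr_ge0 ?mulr_ge0//.
    apply: S => //; [exact: le_trans (Ck_norm_pd2 _ _ _) gM'|exact: Ck_norm_pd2].
  by rewrite /d dE2; ring.
Qed.

(** Write r(f) for the remainder. Along the fibres its derivative is
    r(d f / d x) * d g / d x plus the difference of the values of
    [skew_comp om _ (pd2 f)] at [g'] and [g] times the derivative of [g' - g];
    the induction hypothesis bounds the first term and [skew_comp_cont] the
    second. In the angle, r(d f / d t) appears only after exchanging the mixed
    derivatives of [f]. *)
Lemma skew_comp_taylor k (M : R) : 0 <= M -> exists2 c, 0 <= c &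
  forall om g g' f m, valued_in_I g -> valued_in_I g' -> f \in isCk k.+1 -> g \in isCk k ->
  g' \in isCk k -> N k g <= M -> N k g' <= M -> 0 <= m ->
  osc k.+1 (N k (g' - g)) m f ->
  N k (skew_comp om g' f - skew_comp om g f - skew_comp om g (pd2 f) * (g' - g)) <=
    c * N k (g' - g) * (m + N k.+1 f * N k (g' - g)).
Proof.
move=> M0; elim: k => [|k [c c0 IH]].
  exists 1 => // om g g' f m ag ag' cf cg cg' _ _ m0 [_ [_ H]]; rewrite mul1r.
  have cd := isCkB cg' cg.
  apply: sup_norm_le => p cp; rewrite -[X in `|X|]/(skew_comp om g' f p - skew_comp om g f p -
    skew_comp om g (pd2 f) p * (g' p - g p)) !skew_compE//.
  have [c [Ic cy ->]] := MVT_fibre (p.1 + om) cf (ag p cp) (ag' p cp).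
  rewrite -mulrBl normrM mulrC.
  have dp : `|g' p - g p| <= N 0 (g' - g) := Ck_norm_ge cd cp.
  apply: ler_pM => //; rewrite (@le_trans _ _ m)//; last first.
    by rewrite lerDl mulr_ge0//; [exact: Ck_norm_ge0 cf|exact: Ck_norm_ge0 cd].
  by apply: H.1 => //; [exact: ag|exact: le_trans cy dp].
have [c' c'0 HC] := skew_comp_cont k M0.
exists (1 + c + 2 ^+ k * (c * M) + 2 ^+ k * c').
  by rewrite !addr_ge0// !mulr_ge0.
move=> om g g' f m ag ag' cf cg cg' gM gM' m0 H.
set d := g' - g; have cd : d \in isCk k.+1 by exact: isCkB.
have [cf1 cf2] := (isCk_pd1 cf, isCk_pd2 cf).
have [cf12 cf22] := (isCk_pd1 cf2, isCk_pd2 cf2).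
have wf := isCkW cf.
have [E1 E2] := skew_comp_pd om ag wf cg; have [E1' E2'] := skew_comp_pd om ag' wf cg'.
have [F1 F2] := skew_comp_pd om ag cf2 cg.
have [cg1 cg2] := (isCk_pd1 cg, isCk_pd2 cg).
have [cg1' cg2'] := (isCk_pd1 cg', isCk_pd2 cg').
have [cd1 cd2] := (isCk_pd1 cd, isCk_pd2 cd).
have [[wg wg'] wd] := (isCkW cg, isCkW cg', isCkW cd).
have [wf1 wf2] := (isCkW cf1, isCkW cf2).
have gM1 := le_trans (Ck_norm_leW cg) gM.
have gM1' := le_trans (Ck_norm_leW cg') gM'.
pose X := m + N k.+2 f * N k.+1 d.
have [f0 d0] := (Ck_norm_ge0 cf, Ck_norm_ge0 cd).
have X0 : 0 <= X by rewrite addr_ge0// mulr_ge0.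
pose r h := skew_comp om g' h - skew_comp om g h - skew_comp om g (pd2 h) * d.
have sub h : h \in isCk k.+1 -> N k.+1 h <= N k.+2 f -> osc k.+1 (N k.+1 d) m h ->
    N k (r h) <= c * (N k.+1 d * X).
  move=> ch hf oh; have := IH om g g' h m ag ag' ch wg wg' gM1 gM1' m0.
  move=> /(_ (osc_le (Ck_norm_leW cd) (lexx _) oh)) /le_trans; apply.
  rewrite -mulrA ler_wpM2l//; have := Ck_norm_leW cd; have := Ck_norm_ge0 wd => wd0 dd.
  apply: ler_pM => //; first by rewrite addr_ge0// mulr_ge0//; exact: Ck_norm_ge0 ch.
  by rewrite lerD2l; apply: ler_pM => //; exact: Ck_norm_ge0 ch.
case: H => h0 [h1 h2].
have P1 := sub _ cf1 (Ck_norm_pd1 _ _ _) h1; have P2 := sub _ cf2 (Ck_norm_pd2 _ _ _) h2.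
have C h (ch : h \in isCk k) := skew_comp_isCk om ag ch wg.
have C' h (ch : h \in isCk k) := skew_comp_isCk om ag' ch wg'.
have D h (ch : h \in isCk k) := isCkB (C' h ch) (C h ch).
have B2 : N k (skew_comp om g' (pd2 f) - skew_comp om g (pd2 f)) <= c' * X.
  have := HC om g g' (pd2 f) m ag ag' wf2 wg wg' gM1 gM1' m0.
  move=> /(_ (osc_le (Ck_norm_leW cd) (lexx _) (oscW h2))) /le_trans; apply.
  rewrite ler_wpM2l// lerD2l; apply: ler_pM => //.
  - exact: Ck_norm_ge0 wf2.
  - exact: Ck_norm_ge0 wd.
  - by apply: le_trans (Ck_norm_leW cf2) _; exact: Ck_norm_pd2.
  - exact: Ck_norm_leW.
have Cr h : h \in isCk k.+1 -> r h \in isCk k.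
  move=> ch; have [ch' ch2] := (isCkW ch, isCk_pd2 ch).
  by apply: isCkB (D _ ch') _; apply: isCkM => //; exact: C.
pose Y := N k.+1 d * X; have Y0 : 0 <= Y by rewrite mulr_ge0.
have S p dp : p \in isCk k -> dp \in isCk k -> N k p <= M -> N k dp <= N k.+1 d ->
  N k (r (pd2 f) * p + (skew_comp om g' (pd2 f) - skew_comp om g (pd2 f)) * dp)
    <= 2 ^+ k * (c * M) * Y + 2 ^+ k * c' * Y.
  move=> cp cdp pM dpd; apply: Ck_norm_D_le; [exact/isCkM/cp/Cr|exact/isCkM/cdp/D| |].
    rewrite -mulrA [c * M * Y]mulrAC; apply: Ck_norm_M_le => //; exact: Cr.
  rewrite [leRHS](_ : _ = 2 ^+ k * (c' * X * N k.+1 d)); last by rewrite /Y; ring.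
  by apply: Ck_norm_M_le => //; exact: D.
have S0 : 0 <= 2 ^+ k * (c * M) * Y + 2 ^+ k * c' * Y.
  by rewrite addr_ge0// !mulr_ge0.
rewrite [leRHS](_ : _ = Y + c * Y + (2 ^+ k * (c * M) * Y + 2 ^+ k * c' * Y));
  last by rewrite /Y /X; ring.
have Cg f' (cf' : f' \in isCk k.+1) := skew_comp_isCk om ag cf' cg.
have Cg' f' (cf' : f' \in isCk k.+1) := skew_comp_isCk om ag' cf' cg'.
have CM := isCkM (Cg _ cf2) cd.
have CB := isCkB (Cg' _ wf) (Cg _ wf).
have [RE1 RE2] := partialB CB CM.
have [ME1 ME2] := partialM (Cg _ cf2) cd.
have [DE1 DE2] := partialB (Cg' _ wf) (Cg _ wf).
have [dE1 dE2] := partialB cg' cg.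
have cm := partial_comm cf.
apply: Ck_norm_leS => [p cp||].
- change (`|skew_comp om g' f p - skew_comp om g f p -
    skew_comp om g (pd2 f) p * (g' p - g p)| <=
    Y + c * Y + (2 ^+ k * (c * M) * Y + 2 ^+ k * c' * Y)).
  rewrite !(skew_compE _ _ _ cp).
  have [b [Ib bd ->]] := MVT_fibre (p.1 + om) (isCk_le (ltn0Sn _) cf) (ag p cp) (ag' p cp).
  rewrite -mulrBl normrM mulrC.
  have dp : `|d p| <= N k.+1 d := Ck_norm_ge cd cp.
  have mX : m <= X by rewrite lerDl mulr_ge0.
  have pm : `|pd2 f (p.1 + om, b) - pd2 f (p.1 + om, g p)| <= m.
    exact: (@osc0 _ _ k.+1 _ _ _ h2 (p.1 + om) _ _ (ag p cp) Ib (le_trans bd dp)).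
  apply: (le_trans (ler_pM (normr_ge0 _) (normr_ge0 _) dp (le_trans pm mX))).
  by rewrite -[leRHS]addrA lerDl; exact: addr_ge0 (mulr_ge0 c0 Y0) S0.
- rewrite RE1 DE1 ME1 E1 E1' F1 (_ : _ - _ = r (pd1 f) +
    (r (pd2 f) * pd1 g + (skew_comp om g' (pd2 f) - skew_comp om g (pd2 f)) * pd1 d)).
    rewrite -[leRHS]addrA; apply: (ler_wpDl Y0).
    apply: (Ck_norm_D_le _ _ P1).
    - exact: Cr.
    - by apply: isCkD; apply: isCkM; [exact: Cr|exact: cg1|exact: D|exact: cd1].
    - by apply: (S _ _ cg1 cd1 (le_trans (Ck_norm_pd1 _ _ _) gM)); exact: Ck_norm_pd1.
  rewrite /r -cm.
  rewrite /d dE1.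
  move: (pd1 (pd2 f)) (pd2 (pd2 f)) => f12 f22.
  move: (pd1 f) (pd2 f) (pd1 g) (pd1 g') => f1 f2 dg dg'.
  move: (skew_comp om g' f1) (skew_comp om g f1) (skew_comp om g' f2) (skew_comp om g f2) => ? ? ? ?.
  move: (skew_comp om g f12) (skew_comp om g f22) => ? ?.
  ring.
- rewrite RE2 DE2 ME2 E2 E2' F2 (_ : _ - _ =
    (r (pd2 f) * pd2 g + (skew_comp om g' (pd2 f) - skew_comp om g (pd2 f)) * pd2 d)).
    apply: (ler_wpDl (addr_ge0 Y0 (mulr_ge0 c0 Y0))).
    by apply: (S _ _ cg2 cd2 (le_trans (Ck_norm_pd2 _ _ _) gM)); exact: Ck_norm_pd2.
  rewrite /r /d dE2; move: (skew_comp om g' (pd2 f)) (skew_comp om g (pd2 f))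
    (skew_comp om g (pd2 (pd2 f))) => ? ? ?; ring.
Qed.

End Estimates.

(** * Differentiability of the composition operator *)

Section CompositionOperator.
Context {R : realType} (delta : {posnum R}).
#[local] Opaque partial1 partial2 skew_comp.
Local Notation I := (Idelta delta).
Local Notation cyl := (cyl delta).
Local Notation isCk := (isCk delta).
Local Notation pd1 := (partial1 delta).
Local Notation pd2 := (partial2 delta).
Local Notation N := (Ck_norm delta).
Local Notation valued_in_I := (valued_in_I delta).
Local Notation skew_comp := (skew_comp delta).
Local Notation osc := (osc delta).
Local Notation Ck := (Ck delta).

Lemma Ck_ext k (f g : Ck k) : f = g :> (R * R -> R) -> f = g.
Proof. exact: val_inj. Qed.

Definition mulCk_at k (f g : Ck k) : Ck k := MkCk (isCkM (CkP f) (CkP g)).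

Lemma mulCk_at_norm k (f g : Ck k) : `|mulCk_at f g| <= 2 ^+ k * `|f| * `|g|.
Proof. by rewrite -mulrA; exact: Ck_norm_M (CkP f) (CkP g). Qed.

Definition mulCk_l k (f : Ck k) : boundedLinear (Ck k) (Ck k).
Proof.
apply: (@bounded_linear _ _ _ (mulCk_at f) (2 ^+ k * `|f|)) => [a g h|g].
  by apply/Ck_ext/funext => p; rewrite /= !fctE /GRing.scale/=; ring.
exact: mulCk_at_norm.
Defined.

Definition mulCk k : boundedLinear (Ck k) (boundedLinear (Ck k) (Ck k)).
Proof.
apply: (@bounded_linear _ _ _ (@mulCk_l k) (2 ^+ k)) => [a g h|f].
  by apply: bl_ext => f; apply/Ck_ext/funext => p; rewrite /= !fctE /GRing.scale/=; ring.
apply: bl_norm_le => [|g]; first by rewrite mulr_ge0.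
exact: mulCk_at_norm.
Defined.

Lemma isCk_pd2_lt j m f : (j < m)%N -> f \in isCk m -> pd2 f \in isCk j.
Proof. by move=> jm cf; exact: isCk_pd2 (isCk_le jm cf). Qed.

Definition derCk_at j m (jm : (j < m)%N) (f : Ck m) : Ck j :=
  MkCk (isCk_pd2_lt jm (CkP f)).

(** The derivative along the fibres; [j] need not be [m - 1], which avoids
    casts between equal indices. *)
Definition derCk j m (jm : (j < m)%N) : boundedLinear (Ck m) (Ck j).
Proof.
apply: (@bounded_linear _ _ _ (derCk_at jm) 1) => [a g h|f].
  apply/Ck_ext => /=.
  have [_ ->] := partialD (isCk_le jm (CkP (a *: g))) (isCk_le jm (CkP h)).
  have [_ ->//] := partialZ a (isCk_le jm (CkP g)).
rewrite mul1r; apply: le_trans (Ck_norm_pd2 _ _ _) _; exact: Ck_norm_le jm (CkP f).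
Defined.

(** The uniform distance to the endpoints makes the condition open in C^r; taking
    values in the closed interval is not an open condition. *)
Definition interior_valued r : set (Ck r) := [set g |
  exists2 rho, rho < 1 + delta%:num & forall p, cyl p -> `|g p| <= rho].

Lemma interior_valued_I r (g : Ck r) : interior_valued g -> valued_in_I g.
Proof. by move=> [rho r1 H] p cp; apply/IdeltaP; exact: le_trans (H p cp) (ltW r1). Qed.

Lemma open_interior_valued r : open (@interior_valued r).
Proof.
rewrite openE => g [rho r1 H]; apply: (near_epsP g (@interior_valued r)).2.
exists ((1 + delta%:num - rho) / 2); first by rewrite divr_gt0// subr_gt0.
move=> g' gg'; exists ((1 + delta%:num + rho) / 2).
  by rewrite ltr_pdivrMr// mulr_natr mulr2n ltrD2l.
move=> p cp; rewrite (_ : g' p = g p + (g' - g : Ck r) p); last first.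
  by rewrite /= addrC subrK.
have H' : `|(g' - g : Ck r) p| <= `|g' - g| := Ck_norm_ge (CkP _) cp.
rewrite (le_trans (ler_normD _ _))// (le_trans (lerD (H p cp) (le_trans H' (ltW gg'))))//.
by rewrite le_eqVlt; apply/orP; left; apply/eqP; field.
Qed.

Lemma comp_op_ex om m r (g : Ck r) : (r <= m)%N -> valued_in_I g ->
  exists L : boundedLinear (Ck m) (Ck r), forall f, L f = skew_comp om g f :> (R * R -> R).
Proof.
move=> rm ag.
have [c c0 H] := skew_comp_bound delta r (normr_ge0 g).
pose L (f : Ck m) : Ck r := MkCk (skew_comp_isCk om ag (isCk_le rm (CkP f)) (CkP g)).
have lL : linear L.
  move=> a f h; apply/Ck_ext/funext => p /=; have [cp|ncp] := pselect (cyl p).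
    by rewrite !fctE !skew_compE.
  by rewrite !fctE !skew_comp_out// scaler0 addr0.
have bL f : `|L f| <= c * `|f|.
  apply: le_trans (H om g f ag (isCk_le rm (CkP f)) (CkP g) (lexx _)) _.
  by rewrite ler_wpM2l//; exact: Ck_norm_le rm (CkP f).
by exists (bounded_linear lL bL).
Qed.

(** A total function of [g], as [Cn] requires, the choice being irrelevant for
    [g] with values outside the interval. *)
Definition comp_op om m r (g : Ck r) : boundedLinear (Ck m) (Ck r) :=
  xget 0 [set L : boundedLinear (Ck m) (Ck r) | forall f, L f = skew_comp om g f :> (R * R -> R)].

Lemma comp_opE om m r (g : Ck r) f : (r <= m)%N -> valued_in_I g ->
  comp_op om m g f = skew_comp om g f :> (R * R -> R).
Proof.
move=> rm ag; rewrite /comp_op; case: xgetP => [L _ ->//|H].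
by have [L HL] := comp_op_ex om rm ag; have := H L HL.
Qed.

Lemma near_interior_valued r (g0 : Ck r) : interior_valued g0 ->
  \forall g \near g0, interior_valued g /\ `|g| <= `|g0| + 1.
Proof.
move=> Ag0; near=> g; split.
  by near: g; exact: (open_nbhs_nbhs (conj (@open_interior_valued r) Ag0)).
rewrite -[g](subrK g0) (le_trans (ler_normD _ _))// addrC lerD2l ltW//.
Unshelve. all: by end_near. Qed.

Lemma comp_op_bounded om m r (g0 : Ck r) : (r <= m)%N -> interior_valued g0 ->
  exists2 c, 0 <= c & \forall g \near g0, `|comp_op om m g| <= c.
Proof.
move=> rm Ag0; have [c c0 H] := skew_comp_bound delta r (addr_ge0 (normr_ge0 g0) ler01).
exists c => //; apply: filterS (near_interior_valued Ag0) => g [/interior_valued_I ag gM].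
apply: bl_norm_le => // f.
rewrite [X in X <= _](_ : _ = N r (skew_comp om g f)); last first.
  by rewrite -(comp_opE om f rm ag).
apply: le_trans (H om g f ag (isCk_le rm (CkP f)) (CkP g) gM) _.
by rewrite ler_wpM2l//; exact: Ck_norm_le rm (CkP f).
Qed.

(** With one derivative lost, the dependence on [g] is continuous for the operator
    norm, and not just pointwise. *)
Lemma comp_op_lip om m r (g0 : Ck r) : (r < m)%N -> interior_valued g0 ->
  exists2 c, 0 <= c & \forall g \near g0, `|comp_op om m g - comp_op om m g0| <= c * `|g - g0|.
Proof.
move=> rm Ag0; have [c c0 H] := skew_comp_cont delta r (addr_ge0 (normr_ge0 g0) ler01).
have a0 := interior_valued_I Ag0; exists (c + c); first exact: addr_ge0.
apply: filterS (near_interior_valued Ag0) => g [/interior_valued_I ag gM].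
apply: bl_norm_le => [|f]; first by rewrite mulr_ge0// addr_ge0.
have cf := isCk_le rm (CkP f); have cf' := isCkW cf.
have g0M : N r g0 <= `|g0| + 1 by rewrite lerDl.
have d0 : 0 <= N r (g - g0) := normr_ge0 (g - g0).
have f0 : 0 <= N r.+1 f := Ck_norm_ge0 cf.
rewrite [X in X <= _](_ : _ = N r (skew_comp om g f - skew_comp om g0 f)); last first.
  by rewrite -(comp_opE om f (ltnW rm) ag) -(comp_opE om f (ltnW rm) a0).
apply: le_trans (H om g0 g f _ a0 ag cf' (CkP g0) (CkP g) g0M gM _ (osc_lip cf d0)) _.
  exact: mulr_ge0.
apply: (@le_trans _ _ (c * (`|f| * `|g - g0| + `|f| * `|g - g0|))).
  rewrite ler_wpM2l// lerD// ler_wpM2r//.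
    exact: Ck_norm_le rm (CkP f).
  exact: Ck_norm_le (ltnW rm) (CkP f).
by rewrite le_eqVlt; apply/orP; left; apply/eqP; ring.
Qed.

(** For a fixed [f] one derivative is enough; the modulus comes from uniform
    continuity. *)
Lemma comp_op_diff_at om j m r (jm : (j < m)%N) (g0 : Ck r) (f : Ck m) :
  (r <= j)%N -> interior_valued g0 ->
  is_diff g0 (fun g => comp_op om m g f) (mulCk r (comp_op om j g0 (derCk jm f))).
Proof.
move=> rj Ag0; apply/is_diff_epsP => e e0; have rm := leq_ltn_trans rj jm.
have [c c0 H] := skew_comp_taylor delta r (addr_ge0 (normr_ge0 g0) ler01).
have a0 := interior_valued_I Ag0; have cf := isCk_le rm (CkP f).
have c10 : 0 < 2 * (c + 1) by rewrite mulr_gt0// ltr_wpDl.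
pose e' := e / (2 * (c + 1)); have e'0 : 0 < e' by rewrite divr_gt0.
have [eta eta0 oscf] := osc_exists cf e'0.
have M0 : 0 < N r.+1 f + 1 by rewrite ltr_wpDl// Ck_norm_ge0.
near=> g.
have [/interior_valued_I ag gM] : interior_valued g /\ `|g| <= `|g0| + 1.
  by near: g; exact: near_interior_valued.
have d1 : `|g - g0| <= eta by apply: ltW; near: g; exact: (near_dist_lt g0 eta0).
have d2 : (N r.+1 f + 1) * `|g - g0| <= e'.
  rewrite -ler_pdivlMl//; apply: ltW; near: g; apply: (near_dist_lt g0).
  by rewrite mulr_gt0// invr_gt0.
have g0M : N r g0 <= `|g0| + 1 by rewrite lerDl.
rewrite [X in X <= _](_ : _ = N r (skew_comp om g f - skew_comp om g0 f -
    skew_comp om g0 (pd2 f) * (g - g0))); last first.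
  rewrite -(comp_opE om f (ltnW rm) ag) -(comp_opE om f (ltnW rm) a0).
  by rewrite -(comp_opE om (derCk jm f) rj a0).
apply: le_trans (H om g0 g f e' a0 ag cf (CkP g0) (CkP g) g0M gM (ltW e'0) _) _.
  exact: osc_le d1 (lexx _) oscf.
rewrite mulrAC; apply: ler_wpM2r; first exact: normr_ge0 (g - g0).
apply: (@le_trans _ _ (c * (e' + e'))).
  apply: ler_wpM2l => //; rewrite lerD2l; apply: le_trans d2.
  by apply: ler_wpM2r; [exact: normr_ge0 (g - g0)|rewrite lerDl].
rewrite -mulr2n -mulr_natl /e'.
rewrite (_ : c * _ = e * (c / (c + 1))).
  by rewrite ler_piMr ?(ltW e0)// ler_pdivrMr ?mul1r ?lerDl// ltr_wpDl.
by field; rewrite gt_eqF// ltr_wpDl.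
Unshelve. all: by end_near. Qed.

(** The map sending [C] to the bilinear expression k * C (d f / d x) in [k] and
    [f]. *)
Definition derComp j m r (jm : (j < m)%N) :
  boundedLinear (boundedLinear (Ck j) (Ck r))
    (boundedLinear (Ck r) (boundedLinear (Ck m) (Ck r))) :=
  bcomp (precomp _ (mulCk r))
   (bcomp (bflip (bcompE (Ck m) (Ck r) (Ck r))) (precomp (Ck r) (derCk jm))).

(** For the operator norm two derivatives are needed: the Taylor remainder has to
    be small uniformly for [f] in the unit ball. *)
Lemma comp_op_diff om j m r (jm : (j < m)%N) (g0 : Ck r) :
  (r < j)%N -> interior_valued g0 ->
  is_diff g0 (comp_op om m (r := r)) (derComp r jm (comp_op om j g0)).
Proof.
move=> rj Ag0; apply/is_diff_epsP => e e0; have rm := ltn_trans rj jm.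
have rm' : (r.+1 < m)%N := leq_ltn_trans rj jm.
have [c c0 H] := skew_comp_taylor delta r (addr_ge0 (normr_ge0 g0) ler01).
have a0 := interior_valued_I Ag0.
have c10 : 0 < 2 * (c + 1) by rewrite mulr_gt0// ltr_wpDl.
near=> g.
have [/interior_valued_I ag gM] : interior_valued g /\ `|g| <= `|g0| + 1.
  by near: g; exact: near_interior_valued.
have d1 : 2 * (c + 1) * `|g - g0| <= e.
  rewrite -ler_pdivlMl//; apply: ltW; near: g; apply: (near_dist_lt g0).
  by rewrite mulr_gt0// invr_gt0.
have g0M : N r g0 <= `|g0| + 1 by rewrite lerDl.
apply: bl_norm_le => [|f]; first by rewrite mulr_ge0// ltW.
have cf := isCk_le rm (CkP f); have cf' := isCk_le rm' (CkP f).
rewrite [X in X <= _](_ : _ = N r (skew_comp om g f - skew_comp om g0 f -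
    skew_comp om g0 (pd2 f) * (g - g0))); last first.
  rewrite -(comp_opE om f (ltnW rm) ag) -(comp_opE om f (ltnW rm) a0).
  by rewrite -(comp_opE om (derCk jm f) (ltnW rj) a0) mulrC.
have d0 : 0 <= N r (g - g0) := normr_ge0 (g - g0).
apply: le_trans (H om g0 g f _ a0 ag cf (CkP g0) (CkP g) g0M gM _ (osc_lip cf' d0)) _.
  by rewrite mulr_ge0// Ck_norm_ge0.
apply: (@le_trans _ _ (c * `|g - g0| * (`|f| * `|g - g0| + `|f| * `|g - g0|))).
  rewrite ler_wpM2l ?mulr_ge0//.
  by rewrite lerD// ler_wpM2r//; [exact: Ck_norm_le rm' (CkP f)|exact: Ck_norm_le rm (CkP f)].
rewrite (_ : c * _ * _ = 2 * c * `|g - g0| * `|g - g0| * `|f|); last by ring.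
rewrite ler_wpM2r// ler_wpM2r// (le_trans _ d1)// ler_wpM2r// ler_wpM2l//.
by rewrite lerDl.
Unshelve. all: by end_near. Qed.

(** The derivative at [g] is a bounded linear image of the same operator at [g],
    acting on functions with one derivative less: induction on [s]. *)
Lemma Cn_comp_op om s m r : (r + s < m)%N -> Cn s (@interior_valued r)
  (comp_op om m (r := r)).
Proof.
elim: s m => [|s IH] m.
  rewrite addn0 => rm g0 Ag0; apply/continuous_epsP => e e0.
  have [c c0 H] := comp_op_lip om rm Ag0.
  near=> g; apply: (@le_lt_trans _ _ ((c + 1) * `|g - g0|)).
    apply: (@le_trans _ _ (c * `|g - g0|)); first by near: g.
    by rewrite ler_wpM2r// lerDl.
  rewrite -ltr_pdivlMl ?ltr_wpDl//; near: g; apply: (near_dist_lt g0).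
  by rewrite mulr_gt0// invr_gt0 ltr_wpDl.
rewrite addnS; case: m => [//|j]; rewrite ltnS => rsj.
have rj : (r < j)%N := leq_ltn_trans (leq_addr _ _) rsj.
(* j = m - 1 derivatives are left *)
exists (fun g => derComp r (ltnSn j) (comp_op om j g)).
  by move=> g Ag; exact: comp_op_diff.
by apply: Cn_lin; exact: IH.
Unshelve. all: by end_near. Qed.

(** No derivative is lost pointwise in [f], unlike for the operator norm. *)
Lemma comp_op_continuous_at om m r (g0 : Ck r) (f : Ck m) :
  (r <= m)%N -> interior_valued g0 -> {for g0, continuous (fun g => comp_op om m g f)}.
Proof.
move=> rm Ag0; apply/continuous_epsP => e e0.
have [c c0 H] := skew_comp_cont delta r (addr_ge0 (normr_ge0 g0) ler01).
have a0 := interior_valued_I Ag0; have cf := isCk_le rm (CkP f).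
have c10 : 0 < 2 * (c + 1) by rewrite mulr_gt0// ltr_wpDl.
pose e' := e / (2 * (c + 1)); have e'0 : 0 < e' by rewrite divr_gt0.
have [eta eta0 oscf] := osc_exists cf e'0.
have M0 : 0 < N r f + 1 by rewrite ltr_wpDl// Ck_norm_ge0.
near=> g.
have [/interior_valued_I ag gM] : interior_valued g /\ `|g| <= `|g0| + 1.
  by near: g; exact: near_interior_valued.
have d1 : `|g - g0| <= eta by apply: ltW; near: g; exact: (near_dist_lt g0 eta0).
have d2 : (N r f + 1) * `|g - g0| <= e'.
  rewrite -ler_pdivlMl//; apply: ltW; near: g; apply: (near_dist_lt g0).
  by rewrite mulr_gt0// invr_gt0.
have g0M : N r g0 <= `|g0| + 1 by rewrite lerDl.
rewrite [X in X < _](_ : _ = N r (skew_comp om g f - skew_comp om g0 f)); last first.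
  by rewrite -(comp_opE om f rm ag) -(comp_opE om f rm a0).
apply: le_lt_trans (H om g0 g f e' a0 ag cf (CkP g0) (CkP g) g0M gM (ltW e'0) _) _.
  exact: osc_le d1 (lexx _) oscf.
apply: (@le_lt_trans _ _ (c * (e' + e'))).
  apply: ler_wpM2l => //; rewrite lerD2l; apply: le_trans d2.
  by apply: ler_wpM2r; [exact: normr_ge0 (g - g0)|rewrite lerDl].
rewrite -mulr2n -mulr_natl /e'.
rewrite (_ : c * _ = e * (c / (c + 1))).
  by rewrite gtr_pMr ?ltr_pdivrMr ?mul1r ?ltrDl// ltr_wpDl.
by field; rewrite gt_eqF// ltr_wpDl.
Unshelve. all: by end_near. Qed.

Lemma comp_op_continuous om m r (E : normedModType R) (F : E -> Ck m) (G : E -> Ck r) x :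
  (r <= m)%N -> interior_valued (G x) -> {for x, continuous F} -> {for x, continuous G} ->
  {for x, continuous (fun y => comp_op om m (G y) (F y))}.
Proof.
move=> rm AG cF cG; apply/continuous_epsP => e e0.
have [c c0 Hc] := comp_op_bounded om rm AG.
have c10 : 0 < c + 1 by rewrite ltr_wpDl.
have e20 : 0 < e / 2 by rewrite divr_gt0.
have cGF : {for x, continuous (fun y => comp_op om m (G y) (F x))}.
  apply: (@continuous_comp _ _ _ G (fun g => comp_op om m g (F x)) x cG).
  exact: comp_op_continuous_at.
near=> y.
have -> : comp_op om m (G y) (F y) - comp_op om m (G x) (F x) =
    comp_op om m (G y) (F y - F x) +
    (comp_op om m (G y) (F x) - comp_op om m (G x) (F x)).
  by rewrite linearB /= subrKA.
rewrite [e]splitr (le_lt_trans (ler_normD _ _))// ltr_leD//; last first.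
  by apply: ltW; near: y; exact: ((continuous_epsP _ _).1 cGF).
have Gc : `|comp_op om m (G y)| <= c by near: y; exact: cG _ Hc.
apply: (@le_lt_trans _ _ ((c + 1) * `|F y - F x|)).
  apply: le_trans (bl_norm _ _) _; apply: ler_wpM2r => //.
  by rewrite (le_trans Gc)// lerDl.
rewrite -ltr_pdivlMl//; near: y; apply: ((continuous_epsP _ _).1 cF).
by rewrite mulr_gt0// invr_gt0.
Unshelve. all: by end_near. Qed.

(** The increment splits into the increments in each argument and the mixed term
    (comp_op (G y) - comp_op (G x)) (F y - F x), which is o(|y - x|) since
    [comp_op] is continuous in operator norm when [r < m]. *)
Lemma comp_op_joint_diff om j m r (jm : (j < m)%N) (E : normedModType R)
    (F : E -> Ck m) (G : E -> Ck r) x (dF : boundedLinear E (Ck m))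
    (dG : boundedLinear E (Ck r)) :
  (r <= j)%N -> interior_valued (G x) -> is_diff x F dF -> is_diff x G dG ->
  is_diff x (fun y => comp_op om m (G y) (F y))
    (bcomp (comp_op om m (G x)) dF +
     bcomp (mulCk r (comp_op om j (G x) (derCk jm (F x)))) dG).
Proof.
move=> rj AG DF DG.
have D1 := is_diff_bcomp DF (is_diff_bl (comp_op om m (G x)) (F x)).
have D2 := is_diff_bcomp DG (comp_op_diff_at om jm (F x) rj AG).
have D3 : is_diff x (fun y => (comp_op om m (G y) - comp_op om m (G x)) (F y - F x))
    (0 : boundedLinear E (Ck r)).
  apply/is_diff_epsP => e e0.
  have cG : {for x, continuous G} by apply: differentiable_continuous; exact: ex_diff.
  have cC : {for x, continuous (fun y => comp_op om m (G y))}.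
    apply: (@continuous_comp _ _ _ G (comp_op om m (r := r)) x cG).
    apply: (@Cn_comp_op om 0 m r); last exact: AG.
    by rewrite addn0; exact: leq_ltn_trans rj jm.
  have k0 : 0 < `|dF| + 1 by rewrite ltr_wpDl.
  near=> y.
  have H1 : `|F y - F x| <= (`|dF| + 1) * `|y - x|.
    by near: y; exact: is_diff_lip.
  have H2 : `|comp_op om m (G y) - comp_op om m (G x)| <= (`|dF| + 1)^-1 * e.
    apply: ltW; near: y; apply: ((continuous_epsP _ _).1 cC).
    by rewrite mulr_gt0// invr_gt0.
  rewrite [X in `|X|](_ : _ = (comp_op om m (G y) - comp_op om m (G x)) (F y - F x)).
    apply: le_trans (bl_norm _ _) _.
    apply: le_trans (ler_pM (normr_ge0 _) (normr_ge0 _) H2 H1) _.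
    by rewrite le_eqVlt; apply/orP; left; apply/eqP; field; rewrite gt_eqF.
  by rewrite [F x - F x]subrr linear0 subr0; exact: subr0.
have D := is_diffB (is_diffD (is_diffD D1 D2) D3) (is_diff_cst (comp_op om m (G x) (F x)) x).
have -> : (fun y => comp_op om m (G y) (F y)) =
    (fun y => comp_op om m (G x) (F y)) + (fun y => comp_op om m (G y) (F x)) +
    (fun y => (comp_op om m (G y) - comp_op om m (G x)) (F y - F x)) -
    cst (comp_op om m (G x) (F x)).
  apply/funext => y; rewrite !fctE blB !linearB /=.
  move: (comp_op om m (G y) (F y)) (comp_op om m (G x) (F y))
    (comp_op om m (G y) (F x)) (comp_op om m (G x) (F x)) => p q s t.
  rewrite opprK [- q + t]addrC [p - s + _]addrACA -opprD [q + s]addrC.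
  by rewrite [s + q + _]addrC subrK addrK.
by apply: (is_diff_eq D); apply/funext => v; rewrite !fctE subr0; exact: addr0.
Unshelve. all: by end_near. Qed.

(** In the derivative, the term in [dF] involves [comp_op] as an operator, which
    is one degree less regular than its values, and the term in [dG] involves
    [comp_op] evaluated at the derivative of [F]: both have the regularity
    required of a derivative. *)
Lemma Cn_comp_op_eval om s m r (E : normedModType R) (W : set E)
    (F : E -> Ck m) (G : E -> Ck r) : (r + s <= m)%N ->
  (forall x, W x -> interior_valued (G x)) -> Cn s W F -> Cn s W G ->
  Cn s W (fun x => comp_op om m (G x) (F x)).
Proof.
elim: s m F => [|s IH] m F.
  rewrite addn0 => rm WA cF cG x Wx.
  by apply: comp_op_continuous (WA x Wx) (cF x Wx) (cG x Wx).
rewrite addnS; case: m F => [//|j] F; rewrite ltnS => rsj WA.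
move=> CF CG; have [CF' CG'] := (CnW CF, CnW CG).
have rj : (r <= j)%N := leq_trans (leq_addr _ _) rsj.
case: CF CG => dF DF CdF [dG DG CdG].
exists (fun x => bcomp (comp_op om j.+1 (G x)) (dF x) +
     bcomp (mulCk r (comp_op om j (G x) (derCk (ltnSn j) (F x)))) (dG x)).
  by move=> x Wx; apply: comp_op_joint_diff (DF x Wx) (DG x Wx) => //; exact: WA.
apply: Cn_add.
  apply: (Cn_bilin (bcompE E (Ck j.+1) (Ck r)) _ CdF).
  by apply: Cn_comp WA CG' (Cn_comp_op _ _); rewrite ltnS.
apply: (Cn_bilin (bcomp (bcompE E (Ck r) (Ck r)) (mulCk r)) _ CdG).
apply: IH => //.
exact: (Cn_lin (derCk (ltnSn j)) CF').
Qed.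

End CompositionOperator.

(** * Averages and the renormalization formula *)

Section Renorm.
Context {R : realType} (delta : {posnum R}).
#[local] Opaque partial1 partial2 skew_comp.
Local Notation I := (Idelta delta).
Local Notation cyl := (cyl delta).
Local Notation isCk := (isCk delta).
Local Notation pd1 := (partial1 delta).
Local Notation pd2 := (partial2 delta).
Local Notation N := (Ck_norm delta).
Local Notation valued_in_I := (valued_in_I delta).
Local Notation skew_comp := (skew_comp delta).
Local Notation Ck := (Ck delta).

Implicit Types f g h : R * R -> R.

Definition height : R * R -> R := (fun p => p.2) \_ cyl.

Lemma heightE p : cyl p -> height p = p.2.
Proof. by move=> cp; rewrite /height patchE mem_set. Qed.

Lemma height_out p : ~ cyl p -> height p = 0.
Proof. by move=> cp; rewrite /height patchE memNset. Qed.

Lemma cyl_cst_isCk k (c : R) : (fun=> c) \_ cyl \in isCk k.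
Proof.
have out p : ~ cyl p -> ((fun=> c) \_ cyl) p = 0.
  by move=> cp; rewrite patchE memNset.
have inc p : cyl p -> ((fun=> c) \_ cyl) p = c.
  by move=> cp; rewrite patchE mem_set.
have c0 : (fun=> c) \_ cyl \in isCk 0.
  apply/isCk0P; split=> //.
  by move=> p cp e e0; exists 1 => // q cq _ _; rewrite !inc// subrr normr0.
case: k => [//|k]; have z : (0 : R * R -> R) \in isCk k by exact: rpred0.
have [|||t x Ix|t x Ix|//] := @isCk_intro _ delta k ((fun=> c) \_ cyl) 0 0 => //.
- apply: (@has_deriv_ext _ setT (fun=> c)) => //; last exact: has_deriv_cst.
  by move=> t' _; rewrite inc//; exact/cylP.
- apply: (@has_deriv_ext _ I (fun=> c)) => //; last exact: has_deriv_cst.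
  by move=> x' Ix'; rewrite inc//; exact/cylP.
Qed.

Lemma height_isCk k : height \in isCk k.
Proof.
have c0 : height \in isCk 0.
  apply/isCk0P; split.
  - by move=> p cp e e0; exists e => // q cq _; rewrite !heightE.
  - move=> t x; have [Ix|Ix] := pselect (I x); first by rewrite !heightE//; exact/cylP.
    by rewrite !height_out// => /cylP.
  - by move=> p cp; rewrite height_out.
case: k => [//|k]; have z : (0 : R * R -> R) \in isCk k by exact: rpred0.
have [t x Ix|t x Ix|//] := @isCk_intro _ delta k height 0 _ c0 z (cyl_cst_isCk k 1).
- apply: (@has_deriv_ext _ setT (fun=> x)) => //; last exact: has_deriv_cst.
  by move=> t' _; rewrite heightE//; exact/cylP.
- rewrite patchE mem_set; last exact/cylP.
  apply: (@has_deriv_ext _ I (fun z => 1 * z)) => //; last exact: has_deriv_lin.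
  by move=> x' Ix'; rewrite mul1r heightE//; exact/cylP.
Qed.

Definition heightCk k : Ck k := MkCk (height_isCk k).

Lemma p0_cst f x c : (forall t, f (t, x) = c) -> p0 f x = c.
Proof.
move=> fc; rewrite /p0; under eq_Rintegral do rewrite fc.
rewrite Rintegral_cst//= lebesgue_measure_itv/= lte_fin ltr01.
by rewrite -EFinB/= subr0 mulr1.
Qed.

Lemma p0_affine k f h x t : f \in isCk k -> h \in isCk k -> I x ->
  p0 (fun q => f q + t * h q) x = p0 f x + t * p0 h x.
Proof.
move=> cf ch Ix.
have int g : g \in isCk k ->
    lebesgue_measure.-integrable `[0, 1]%classic (EFin \o (fun s => g (s, x))).
  move=> /isCk0/isCk0P[cg _ _]; apply: continuous_compact_integrable.
    exact: segment_compact.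
  apply/(@within_continuousP _ R^o) => s _ e e0.
  have [d d0' H] := cg (s, x) ((cylP _ _ _).2 Ix) e e0.
  apply/(@near_epsP _ R^o); exists d => // s' ss' _; apply: H => //=.
  by rewrite subrr normr0.
rewrite /p0 RintegralD//; [|exact: int|]; last first.
  by apply: (int (t *: h)); exact: isCkZ.
by rewrite RintegralZl//; exact: int.
Qed.

Lemma renormE (om : R) g : renorm delta om g =
  (p0 g 1)^-1 *: skew_comp om (skew_comp 0 (p0 g 1 *: height) g) g.
Proof.
apply/funext => p; rewrite /renorm patchE; case: ifPn => cp.
  move/set_mem: cp => cp; rewrite fctE !skew_compE// fctE heightE// addr0//.
by move: cp => /negP cp; rewrite fctE skew_comp_out ?scaler0// => /mem_set.
Qed.

End Renorm.

(** * Maps in the domain of the one-dimensional operator *)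

Section DomainFacts.
Context {R : realType} (delta : {posnum R}).
#[local] Opaque partial1 partial2 skew_comp.
Local Notation I := (Idelta delta).
Local Notation cyl := (cyl delta).
Local Notation isCk := (isCk delta).
Local Notation pd1 := (partial1 delta).
Local Notation pd2 := (partial2 delta).
Local Notation valued_in_I := (valued_in_I delta).
Local Notation skew_comp := (skew_comp delta).
Local Notation Ck := (Ck delta).
Implicit Types f g h : R * R -> R.

Let d0 : 0 < delta%:num. Proof. by []. Qed.

(** By evenness the derivative vanishes at 0, where its sign is not prescribed. *)
Lemma unimodal_decr (psi : R -> R) : M_delta delta psi ->
  forall y y', 0 <= y -> y <= y' -> I y' -> psi y' <= psi y.
Proof.
move=> [dpsi [_ [_ [ev [_ sg]]]]] y y' y0 yy' Iy'.
have Iy : I y.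
  move/IdeltaP: Iy'; rewrite !ler_norml => /andP[? ?]; apply/IdeltaP.
  by rewrite ler_norml; move: d0 => ?; lra.
have D z : I z -> has_deriv I psi z (deriveI delta psi z).
  by move=> Iz; apply/has_derivIP => //; split=> //; exact: dpsi.
have I0 : I 0 by apply/IdeltaP; rewrite normr0 addr_ge0.
have D0 : deriveI delta psi 0 = 0.
  have : has_deriv I psi 0 (deriveI delta psi 0 * -1).
    apply: (@has_deriv_ext _ I (fun z => psi (-1 * z))) => //.
      by move=> z Iz; rewrite mulN1r ev.
    apply: (@has_deriv_comp _ I I (fun z => -1 * z)); last by rewrite mulr0; exact: D.
      by move=> z /IdeltaP Iz; apply/IdeltaP; rewrite mulN1r normrN.
    exact: has_deriv_lin.
  by move/(has_derivIP _ _ I0) => [_]; lra.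
have [c [Ic cy cy' E]] := MVT_interval (@is_interval_Idelta _ delta) D Iy Iy'.
have c0 : 0 <= c.
  move: cy'; rewrite [`|y' - y|]ger0_norm ?subr_ge0// ler_norml => /andP[]; lra.
rewrite -subr_le0 E mulr_le0_ge0 ?subr_ge0//.
have [->|cn0] := eqVneq c 0; first by rewrite D0.
have {}c0 : 0 < c by rewrite lt_neqAle eq_sym cn0.
by have := sg c Ic cn0; rewrite pmulr_rlt0// => /ltW.
Qed.

Section Psi.
Variables (r : nat) (Psi : R * R -> R).
Hypotheses (r1 : (1 <= r)%N) (DPsi : D0_T delta r Psi).
Let psi := p0 Psi.
Let a := psi 1.

Lemma D0_isCk : Psi \in isCk r. Proof. by case: DPsi => -[[]]. Qed.

Lemma D0_M : M_delta delta psi. Proof. by case: DPsi => -[[]]. Qed.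

Lemma D0E t x : Psi (t, x) = psi x.
Proof.
have [Ix|Ix] := pselect (I x).
  by case: DPsi => -[_ H] _; rewrite -(H t x)//; exact/cylP.
have out s : Psi (s, x) = 0 by apply: (isCk_cyl D0_isCk) => /cylP.
by rewrite out /psi (p0_cst out).
Qed.

Lemma D0_pd2 t x : I x -> pd2 Psi (t, x) = deriveI delta psi x.
Proof.
move=> Ix; have := isCk_deriv2 t (isCk_le r1 D0_isCk) Ix.
have -> : (fun y => Psi (t, y)) = psi by apply/funext => y; exact: D0E.
by move=> /(has_derivIP _ _ Ix)[_ <-].
Qed.

(** The second inequality is contained in -a' < b' < 1, where
    a' = (1 + delta) a. *)
Lemma D0_a : a < 0 /\ (1 + delta%:num) * - a < 1.
Proof. by case: DPsi => _ [_ a0 _ /andP[b1 b2] _]; split=> //; rewrite -/psi -/a in b1 b2; lra. Qed.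

Lemma D0_ax x : I x -> `|a * x| <= (1 + delta%:num) * - a.
Proof.
move=> /IdeltaP Ix; rewrite normrM ltr0_norm ?D0_a.1// mulrC.
by rewrite ler_wpM2r// oppr_ge0 ltW// D0_a.1.
Qed.

Lemma D0_Iax x : I x -> I (a * x).
Proof.
move=> Ix; apply/IdeltaP; rewrite (le_trans (D0_ax Ix))//.
by have [_] := D0_a; move: d0; lra.
Qed.

Lemma Idelta_unit x : `|x| <= 1 -> I x.
Proof. by move=> x1; apply/IdeltaP; rewrite (le_trans x1)// lerDl. Qed.

Lemma D0_psi_abs x : I x -> psi x = psi `|x|.
Proof.
move=> Ix; have [_ [_ [_ [ev _]]]] := D0_M.
by have [x0|x0] := ger0P x; rewrite // ev.
Qed.

Lemma D0_psi_le1 x : I x -> psi x <= 1.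
Proof.
move=> Ix; have [_ [_ [_ [_ [p01 _]]]]] := D0_M.
rewrite D0_psi_abs// -[leRHS]p01; apply: unimodal_decr D0_M _ _ _ _ _ => //.
by apply/IdeltaP; rewrite normr_id; exact/IdeltaP.
Qed.

Lemma D0_psi_decr_abs x y : `|x| <= `|y| -> I y -> psi y <= psi x.
Proof.
move=> xy Iy; rewrite (D0_psi_abs Iy) (@D0_psi_abs x); last first.
  by apply/IdeltaP; rewrite (le_trans xy)//; exact/IdeltaP.
apply: unimodal_decr D0_M _ _ _ _ _ => //.
by apply/IdeltaP; rewrite normr_id; exact/IdeltaP.
Qed.

Lemma D0_psi_unit x : `|x| <= 1 -> `|psi x| <= 1.
Proof.
move=> x1; have Ix := Idelta_unit x1; rewrite ler_norml D0_psi_le1// andbT.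
have : psi 1 <= psi x by apply: D0_psi_decr_abs; [rewrite normr1|apply: Idelta_unit; rewrite normr1].
have [_] := D0_a; rewrite -/a => a1.
have : a * delta%:num <= 0 by rewrite mulr_le0_ge0// ltW// D0_a.1.
by move: d0; lra.
Qed.

Lemma D0_b_le x : I x -> psi ((1 + delta%:num) * a) <= psi (a * x).
Proof.
move=> Ix; have [_ [_ a0 Ia' _ _]] := DPsi; rewrite -/psi -/a in a0 Ia'.
apply: D0_psi_decr_abs => //; rewrite (le_trans (D0_ax Ix))// mulrN -normrN ler_norm//.
Qed.

Lemma D0_psiax x : I x -> - ((1 + delta%:num) * a) < psi (a * x) <= 1.
Proof.
move=> Ix; rewrite D0_psi_le1 ?andbT; last exact: D0_Iax.
have [_ [_ _ _ /andP[b1 _] _]] := DPsi.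
exact: lt_le_trans b1 (D0_b_le Ix).
Qed.

Lemma D0_psiax_gt0 x : I x -> 0 < psi (a * x).
Proof.
move=> Ix; have /andP[+ _] := D0_psiax Ix; apply: le_lt_trans.
by rewrite oppr_ge0 mulr_ge0_le0 ?addr_ge0// ltW// D0_a.1.
Qed.

Lemma D0_psiax_unit x : I x -> `|psi (a * x)| <= 1.
Proof.
by move=> Ix; rewrite gtr0_norm ?D0_psiax_gt0//; have /andP[] := D0_psiax Ix.
Qed.

Lemma D0_Rpsi x : I x -> I (a^-1 * psi (psi (a * x))).
Proof.
move=> Ix; have a0 := D0_a.1.
have y1 := D0_psiax_unit Ix; have Iy := Idelta_unit y1.
have up : psi (psi (a * x)) <= psi (psi ((1 + delta%:num) * a)).
  apply: D0_psi_decr_abs => //.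
  rewrite ger0_norm; last first.
    have [_ [_ _ _ /andP[b1 _] _]] := DPsi; apply: le_trans (ltW b1).
    by rewrite oppr_ge0 mulr_ge0_le0 ?addr_ge0// ltW.
  by rewrite gtr0_norm ?D0_psiax_gt0//; exact: D0_b_le.
have lo : a <= psi (psi (a * x)).
  by apply: D0_psi_decr_abs; [rewrite normr1|apply: Idelta_unit; rewrite normr1].
have [_ [_ _ _ _ c1]] := DPsi; rewrite -/psi -/a in c1.
have /andP[hi1 hi2] : - (1 + delta%:num) <= a^-1 * psi (psi (a * x)) <= 1.
  apply/andP; split.
    rewrite mulrC ler_ndivlMr// mulNr (le_trans up)// ltW//.
  by rewrite mulrC ler_ndivrMr// mul1r.
by apply/IdeltaP; rewrite ler_norml hi1 (le_trans hi2)// lerDl.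
Qed.

End Psi.
End DomainFacts.

Section RenormDomain.
Context {R : realType} (delta : {posnum R}).
#[local] Opaque partial1 partial2 skew_comp.
Local Notation I := (Idelta delta).
Local Notation cyl := (cyl delta).
Local Notation isCk := (isCk delta).
Local Notation pd1 := (partial1 delta).
Local Notation pd2 := (partial2 delta).
Local Notation valued_in_I := (valued_in_I delta).
Local Notation skew_comp := (skew_comp delta).
Local Notation Ck := (Ck delta).
Local Notation height := (height delta).
Implicit Types f g h : R * R -> R.

Let d0 : 0 < delta%:num. Proof. by []. Qed.

Section Psi.
Variables (r : nat) (Psi : R * R -> R).
Hypotheses (r1 : (1 <= r)%N) (DPsi : D0_T delta r Psi).
Let psi := p0 Psi.
Let a := psi 1.

Let aneg : a < 0 := (D0_a DPsi).1.

(** The inner argument a x has absolute value at most -a' < 1, and the inner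
    value lies in [-1, 1]; both leave room for a perturbation that is small in
    the uniform norm. *)
Lemma D0_stable : exists2 rho, 0 < rho & forall alpha f, `|alpha - a| <= rho ->
  (forall p, cyl p -> `|f p - Psi p| <= rho) ->
  [/\ alpha != 0, forall x, I x -> `|alpha * x| <= 1 &
   forall t x, I x -> `|f (t, alpha * x)| <= 1 + delta%:num / 2].
Proof.
have a1 : (1 + delta%:num) * - a < 1 := (D0_a DPsi).2.
have D0 : 0 < 1 + delta%:num by rewrite addr_gt0.
pose s := (1 - (1 + delta%:num) * - a) / (1 + delta%:num).
have s0 : 0 < s by rewrite divr_gt0// subr_gt0.
(* the bounds ensure in turn alpha != 0, |alpha x| <= 1 and the margin delta / 2 *)
exists (Num.min (- a / 2) (Num.min s (delta%:num / 2))).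
  by rewrite !lt_min s0 !divr_gt0// oppr_gt0.
move=> alpha f; rewrite !le_min => /and3P[al1 al2 al3] fP.
have al x : I x -> `|alpha * x| <= 1.
  move=> /IdeltaP Ix; rewrite normrM.
  have : `|alpha| <= s - a.
    rewrite -(subrK a alpha) (le_trans (ler_normD _ _))// lerD//.
    by rewrite ltr0_norm.
  move=> al; apply: (le_trans (ler_pM (normr_ge0 _) (normr_ge0 _) al Ix)).
  rewrite mulrDl /s divfK ?gt_eqF//; lra.
split=> //.
- apply: contraTneq al1 => ->; rewrite sub0r normrN ltr0_norm//.
  by rewrite -ltNge ltr_pdivrMr// ltr_pMr ?oppr_gt0// ltr1n.
- move=> t x Ix; have c : cyl (t, alpha * x).
    by apply/cylP/IdeltaP; rewrite (le_trans (al x Ix))// lerDl.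
  rewrite -(subrK (Psi (t, alpha * x)) (f _)) (le_trans (ler_normD _ _))//.
  rewrite addrC lerD//.
    rewrite (D0E DPsi); apply: (D0_psi_unit DPsi); exact: al.
  by rewrite (le_trans (fP _ c))// !ge_min lexx !orbT.
Qed.

Lemma D0_renormE om t x : I x ->
  renorm delta om Psi (t, x) = a^-1 * psi (psi (a * x)).
Proof.
move=> Ix; have cp := (cylP delta t x).2 Ix.
by rewrite /renorm patchE mem_set// !(D0E DPsi).
Qed.

Lemma D0_renorm_isCk om k : Psi \in isCk k -> renorm delta om Psi \in isCk k.
Proof.
move=> cPsi; rewrite renormE -/psi -/a; apply: isCkZ.
have ch : a *: height \in isCk k by apply: isCkZ; exact: height_isCk.
have a1 : valued_in_I (a *: height).
  by move=> [t x] /[dup] c /cylP Ix; rewrite fctE heightE//; exact: (D0_Iax DPsi).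
apply: skew_comp_isCk => //; last exact: skew_comp_isCk.
move=> [t x] /[dup] c /cylP Ix; rewrite skew_compE// fctE heightE// (D0E DPsi).
exact: (Idelta_unit delta (D0_psiax_unit DPsi Ix)).
Qed.

Lemma D0_renorm_defined : renorm_defined delta Psi.
Proof.
split; first by rewrite -/psi -/a lt_eqF.
move=> [t x] /cylP Ix; split; first exact: (D0_Iax DPsi).
by rewrite (D0E DPsi); exact: (Idelta_unit delta (D0_psiax_unit DPsi Ix)).
Qed.

(** The factors [a] and [a^-1] cancel. *)
Lemma D0_renorm_deriv om t x : I x ->
  pd2 (renorm delta om Psi) (t, x) =
  deriveI delta psi (psi (a * x)) * deriveI delta psi (a * x).
Proof.
move=> Ix; apply: partial2E => //.
have Iax := D0_Iax DPsi Ix.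
have D y : I y -> has_deriv I psi y (deriveI delta psi y).
  move=> Iy; apply/has_derivIP => //; split=> //; exact: (D0_M DPsi).1.
have D1 : has_deriv I (fun y => psi (a * y)) x (deriveI delta psi (a * x) * a).
  apply: (@has_deriv_comp _ I I (fun y => a * y)) => //.
  - by move=> z Iz; exact: (D0_Iax DPsi).
  - exact: has_deriv_lin.
  - exact: D.
have D2 : has_deriv I (fun y => a^-1 * psi (psi (a * y))) x
    (a^-1 * (deriveI delta psi (psi (a * x)) * (deriveI delta psi (a * x) * a))).
  apply: has_derivZ; apply: (@has_deriv_comp _ I I (fun y => psi (a * y))) => //.
    by move=> z Iz; exact: (Idelta_unit delta (D0_psiax_unit DPsi Iz)).
  by apply: D; exact: (Idelta_unit delta (D0_psiax_unit DPsi Ix)).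
apply: (@has_deriv_ext _ I (fun y => a^-1 * psi (psi (a * y)))) => //.
  by move=> z Iz; rewrite D0_renormE.
move: D2; congr has_deriv; field; exact: ltr0_neq0.
Qed.

(** For the sign of the derivative: psi(a x) is positive, so the outer factor is
    negative, and a x has the sign opposite to that of x. *)
Lemma D0_D_T om : D_T delta r om Psi.
Proof.
have cT := D0_renorm_isCk om (D0_isCk DPsi).
have E : p0 (renorm delta om Psi) = fun x => renorm delta om Psi (0, x).
  apply/funext => x; apply: p0_cst => t; have [Ix|Ix] := pselect (I x).
    by rewrite !D0_renormE.
  by rewrite !(isCk_cyl cT)// => /cylP.
have DE x : I x -> has_deriv I (p0 (renorm delta om Psi)) x
    (pd2 (renorm delta om Psi) (0, x)).
  by move=> Ix; rewrite E; exact: isCk_deriv2 (isCk_le r1 cT) Ix.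
have [_ [_ [_ [ev [p01 sg]]]]] := D0_M DPsi.
split; [by case: DPsi => -[]|exact: D0_renorm_defined|split=> //].
  by move=> [t x] /cylP Ix; rewrite D0_renormE//; exact: (D0_Rpsi DPsi).
have I0 : I 0 by apply/IdeltaP; rewrite normr0 addr_ge0.
split; [|split; [|split; [|split; [|split]]]].
- by move=> x Ix; have /(has_derivIP _ _ Ix)[] := DE x Ix.
- apply/(@within_continuousP _ R^o) => x Ix e e0.
  have /isCk0P[cp _ _] := isCk_pd2 (isCk_le r1 cT).
  have [d d0' H] := cp (0, x) ((cylP _ _ _).2 Ix) e e0.
  apply/(@near_epsP _ R^o); exists d => // y yx Iy.
  have /(has_derivIP _ _ Ix)[_ ->] := DE x Ix.
  have /(has_derivIP _ _ Iy)[_ ->] := DE y Iy.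
  by apply: H => //=; rewrite subrr normr0.
- by move=> x Ix; rewrite E D0_renormE//; exact: (D0_Rpsi DPsi).
- move=> x Ix; have Inx : I (- x) by apply/IdeltaP; rewrite normrN; exact/IdeltaP.
  by rewrite E !D0_renormE// mulrN (ev : forall x, I x -> psi (- x) = psi x)//; exact: (D0_Iax DPsi).
- by rewrite E D0_renormE// mulr0 (p01 : psi 0 = 1) mulVf// lt_eqF.
- move=> x Ix x0.
  have /(has_derivIP _ _ Ix)[_ ->] := DE x Ix.
  rewrite D0_renorm_deriv//.
  have Iax := D0_Iax DPsi Ix.
  have y0 := D0_psiax_gt0 DPsi Ix; have Iy := Idelta_unit delta (D0_psiax_unit DPsi Ix).
  have s1 : deriveI delta psi (psi (a * x)) < 0.
    by have := sg _ Iy (lt0r_neq0 y0); rewrite pmulr_rlt0.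
  have ax0 : a * x != 0 by rewrite mulf_neq0// lt_eqF.
  have := sg _ Iax ax0; rewrite -mulrA nmulr_rlt0// => s2.
  by rewrite mulrCA nmulr_rlt0.
Qed.

End Psi.
End RenormDomain.

(** * Curves in a normed space *)

Section Curves.
Context {R : realType}.
Implicit Types E F : normedModType R.

Lemma Cn_id n E (W : set E) : Cn n W (fun x : E => x).
Proof.
have -> : (fun x : E => x) = bscale1 E 1 by apply/funext => x; rewrite /= scale1r.
elim: n => [|n IH]; first by move=> x _; exact: bl_continuous.
by exists (fun=> bscale1 E 1); [move=> x _; exact: is_diff_bl|exact: Cn_cst].
Qed.

(** The derivative of a curve of velocity [v]. *)
Definition tang E (v : E) : boundedLinear R^o E := bflip (bscale E) v.

Lemma tangD E (u v : E) : tang u + tang v = tang (u + v).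
Proof. by apply: bl_ext => t; exact: esym (scalerDr _ _ _). Qed.

Lemma bcomp_tang E F (L : boundedLinear E F) v : bcomp L (tang v) = tang (L v).
Proof. by apply: bl_ext => t; rewrite /= linearZ. Qed.

Lemma is_diff_bl_eq E F (f : E -> F) x (L L' : boundedLinear E F) :
  L = L' -> is_diff x f L -> is_diff x f L'.
Proof. by move=> ->. Qed.

Lemma curve_line E (u v : E) : is_diff (0 : R^o) (fun t : R^o => u + t *: v) (tang v).
Proof.
apply/is_diff_epsP => e e0; apply: (@filterE _ (nbhs (0 : R^o))) => t.
rewrite [X in `|X|](_ : _ = 0) ?normr0 ?mulr_ge0 ?(ltW e0)//.
rewrite /tang/= subr0 scale0r addr0 [u + _]addrC addrK; exact: subrr.
Qed.

(** Continuity of [c] suffices because the curve passes through 0. *)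
Lemma curve_scale0 E (c : R^o -> E) : {for 0, continuous c} ->
  is_diff (0 : R^o) (fun t : R^o => t *: c t) (tang (c 0)).
Proof.
move=> /continuous_epsP cc; apply/is_diff_epsP => e e0.
near=> t; rewrite [X in `|X|](_ : _ = t *: (c t - c 0)).
  rewrite subr0 normrZ mulrC; apply: ler_wpM2r => //.
  by apply: ltW; near: t; exact: cc.
by rewrite /tang/= scale0r !subr0 scalerBr.
Unshelve. all: by end_near. Qed.

Lemma curve_inv (a b : R) : a != 0 ->
  is_diff (0 : R^o) (fun t : R^o => (a + t * b)^-1 : R^o) (tang (- (a ^- 2 * b) : R^o)).
Proof.
move=> a0; have D := curve_line (a : R^o) (b : R^o).
have Da : differentiable (fun t : R^o => (a : R^o) + t *: (b : R^o)) (0 : R^o).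
  exact: ex_diff.
have nz : (fun t : R^o => (a : R^o) + t *: (b : R^o)) 0 != 0.
  by rewrite /= scale0r addr0.
split; first exact: differentiableV Da nz.
rewrite (diffV Da nz); apply/funext => t /=.
rewrite (diff_val (is_diff_def := D)) /= scale0r addr0 /GRing.scale/=.
ring.
Qed.

Lemma curve_scale E (be : R^o -> R^o) (S : R^o -> E) be' v :
  is_diff (0 : R^o) be (tang be') -> is_diff (0 : R^o) S (tang v) ->
  is_diff (0 : R^o) (fun t => be t *: S t) (tang (be' *: S 0 + be 0 *: v)).
Proof.
move=> Db DS; have := is_diff_bilinear (bscale E) Db DS.
by apply: is_diff_bl_eq; rewrite !bcomp_tang tangD.
Qed.

Lemma curve_cvg E (c : R^o -> E) v : is_diff (0 : R^o) c (tang v) ->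
  t^-1 *: (c t - c 0) @[t --> (0 : R)^'] --> v.
Proof.
move=> /is_diff_epsP D B /near_epsP[e e0 eB].
have e20 : 0 < e / 2 by rewrite divr_gt0.
apply: filterS (D _ e20) => t; rewrite subr0 => Ht t0; apply: eB.
rewrite [X in `|X|](_ : _ = t^-1 *: (c t - c 0 - tang v t)).
  rewrite normrZ normfV ltr_pdivrMl ?normr_gt0// (le_lt_trans Ht)// mulrC.
  by rewrite ltr_pM2l ?normr_gt0// gtr_pMr// invf_lt1// ltr1n.
by rewrite [RHS]scalerBr /tang/= scalerA mulVf// scale1r.
Qed.

End Curves.

(** * The renormalization operator *)

Section Final.
Context {R : realType} (delta : {posnum R}).
#[local] Opaque partial1 partial2 skew_comp.
Local Notation I := (Idelta delta).
Local Notation cyl := (cyl delta).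
Local Notation isCk := (isCk delta).
Local Notation pd1 := (partial1 delta).
Local Notation pd2 := (partial2 delta).
Local Notation valued_in_I := (valued_in_I delta).
Local Notation skew_comp := (skew_comp delta).
Local Notation Ck := (Ck delta).
Local Notation height := (height delta).
Local Notation heightCk := (heightCk delta).

Lemma cyl01 : cyl (0, 1).
Proof. by apply/cylP/IdeltaP; rewrite normr1 lerDl. Qed.

(** This replaces the average of [f (_, 1)] in the extension: both agree on
    functions that do not depend on the angle. *)
Definition eval01 m : boundedLinear (Ck m) R^o.
Proof.
apply: (@bounded_linear _ _ _ (fun f : Ck m => f (0, 1) : R^o) 1) => [c f g //|f].
by rewrite mul1r; exact: Ck_norm_ge (CkP f) cyl01.
Defined.

Definition linear_fibre r : boundedLinear R^o (Ck r) := bflip (bscale (Ck r)) (heightCk r).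

Lemma linear_fibreE r al p : cyl p -> linear_fibre r al p = al * p.2.
Proof. by move=> cp; rewrite /= /GRing.scale/= heightE. Qed.

Lemma linear_fibre_interior r al : (forall x, I x -> `|al * x| <= 1) ->
  interior_valued (linear_fibre r al).
Proof.
move=> al1; exists 1; first by rewrite ltrDl.
by move=> [t x] /[dup] c /cylP Ix; rewrite linear_fibreE//; exact: al1.
Qed.

Lemma half_interior_valued r (G : Ck r) :
  (forall t x, I x -> `|G (t, x)| <= 1 + delta%:num / 2) -> interior_valued G.
Proof.
move=> H; exists (1 + delta%:num / 2).
  by rewrite ltrD2l gtr_pMr// invf_lt1// ltr1n.
by move=> [t x] /cylP Ix; exact: H.
Qed.

Definition inner_ext m r (f : Ck m) : Ck r := comp_op 0 m (linear_fibre r (eval01 m f)) f.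

(** Equals [renorm] at the points of [D0_T], and is smooth on an open set of
    functions that may depend on the angle. *)
Definition renorm_ext om m r (f : Ck m) : Ck r :=
  bscale (Ck r) ((eval01 m f)^-1 : R^o) (comp_op om m (inner_ext r f) f).

Section Psi.
Variables (r m : nat) (Psi : Ck m).
Hypotheses (r1 : (1 <= r)%N) (rm : (r <= m)%N) (DPsi : D0_T delta r Psi).
Let a := p0 Psi 1.

Lemma eval01_Psi : eval01 m Psi = a.
Proof. exact: D0E DPsi 0 1. Qed.

(** The conditions under which [renorm_ext] is smooth hold on a ball. *)
Lemma inner_ext_near : exists2 rho, 0 < rho & forall f : Ck m, `|f - Psi| < rho ->
  [/\ eval01 m f != 0, interior_valued (linear_fibre r (eval01 m f)) &
      interior_valued (inner_ext r f)].
Proof.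
have [rho rho0 H] := D0_stable DPsi; exists rho => // f fPsi.
have fP p : cyl p -> `|f p - Psi p| <= rho.
  by move=> cp; apply: le_trans (ltW fPsi); exact: Ck_norm_ge (CkP (f - Psi)) cp.
have [|al0 al1 fal] := H (eval01 m f) f _ fP.
  by rewrite -/a -eval01_Psi; exact: fP cyl01.
have A1 : interior_valued (linear_fibre r (eval01 m f)) by exact: linear_fibre_interior.
split=> //; apply: half_interior_valued => t x Ix; have c := (cylP delta t x).2 Ix.
rewrite /inner_ext (comp_opE _ _ rm (interior_valued_I A1)) skew_compE//.
by rewrite linear_fibreE// addr0; exact: fal.
Qed.

Lemma renorm_extE om : renorm_ext om r Psi = renorm delta om Psi :> (R * R -> R).
Proof.
have [rho rho0 H] := inner_ext_near; have [|_ A1 A2] := H Psi.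
  by rewrite subrr normr0.
rewrite renormE -/a -eval01_Psi; apply/funext => p.
rewrite [LHS]/((eval01 m Psi)^-1 * comp_op om m (inner_ext r Psi) Psi p).
rewrite (comp_opE _ _ rm (interior_valued_I A2)).
by rewrite /inner_ext (comp_opE _ _ rm (interior_valued_I A1)).
Qed.

Lemma Cn_renorm_ext om s : (r + s <= m)%N ->
  exists W : set (Ck m), [/\ open W, W Psi & Cn s W (@renorm_ext om m r)].
Proof.
move=> rsm; have [rho rho0 H] := inner_ext_near.
exists [set f | `|f - Psi| < rho]; split.
- rewrite openE => f /= fr; apply: (near_epsP f _).2.
  exists (rho - `|f - Psi|); first by rewrite subr_gt0.
  move=> g gf /=; rewrite -(subrKA f) (le_lt_trans (ler_normD _ _))//.
  by rewrite -ltrBrDr.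
- by rewrite /= subrr normr0.
have Cid := @Cn_id R s (Ck m) [set f | `|f - Psi| < rho].
have Cev := Cn_lin (eval01 m) Cid.
have Cinner : Cn s [set f | `|f - Psi| < rho] (@inner_ext m r).
  apply: Cn_comp_op_eval rsm _ Cid (Cn_lin (linear_fibre r) Cev).
  by move=> f /H[].
apply: Cn_bilin.
  by apply: Cn_inv Cev => f /H[].
by apply: Cn_comp_op_eval rsm _ Cid Cinner => f /H[].
Qed.

Section Direction.
Hypothesis rm' : (r < m)%N.
Variables (om : R) (h : Ck r).
Let b := p0 h 1.
Let ft (t : R) := (fun q => Psi q + t * h q).
Let al (t : R) : R := a + t * b.

Let p0_ft t : p0 (ft t) 1 = al t.
Proof. by apply: p0_affine (isCk_le rm (CkP Psi)) (CkP h) cyl01.2. Qed.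

Let G (t : R^o) : Ck r :=
  comp_op 0 m (linear_fibre r (al t)) Psi + t *: comp_op 0 r (linear_fibre r (al t)) h.

Let S (t : R^o) : Ck r := comp_op om m (G t) Psi + t *: comp_op om r (G t) h.

Let renorm_curve (t : R^o) : Ck r := ((al t)^-1 : R^o) *: S t.

(** For small [t] the perturbed function may be renormalized, and its image is
    given by the operators [comp_op], linearity separating [Psi] from [h]. *)
Lemma gateaux_near : \forall t \near (0 : R), [/\ renorm_defined delta (ft t),
  interior_valued (linear_fibre r (al t)), interior_valued (G t) &
  renorm_curve t = renorm delta om (ft t) :> (R * R -> R)].
Proof.
have [rho rho0 H] := D0_stable DPsi.
have K0 : 0 < `|b| + `|h| + 1 by rewrite ltr_wpDl.
apply/(@near_epsP _ R^o); exists (rho / (`|b| + `|h| + 1)); first by rewrite divr_gt0.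
move=> t; rewrite subr0 ltr_pdivlMr// => /ltW trho.
have [|p cp|al0 al1 fal] := H (al t) (ft t).
- rewrite /al addrC addKr normrM (le_trans _ trho)// ler_wpM2l//.
  by rewrite -addrA lerDl addr_ge0.
- rewrite /ft addrC addKr normrM (le_trans _ trho)// ler_wpM2l//.
  apply: le_trans (Ck_norm_ge (CkP h) cp) _.
  by rewrite [`|b| + _]addrC -addrA lerDl addr_ge0.
have A1 : interior_valued (linear_fibre r (al t)) by exact: linear_fibre_interior.
have GE p : cyl p -> G t p = ft t (p.1, al t * p.2).
  move=> cp; have aA := interior_valued_I A1.
  rewrite /G [LHS]/(comp_op 0 m (linear_fibre r (al t)) Psi p +
    t * comp_op 0 r (linear_fibre r (al t)) h p).
  by rewrite !comp_opE// !skew_compE// !linear_fibreE// !addr0.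
have A2 : interior_valued (G t).
  apply: half_interior_valued => s x Ix; rewrite GE; last exact/cylP.
  exact: fal.
split=> //.
- rewrite /renorm_defined p0_ft; split=> // -[s x] /cylP Ix; split.
    exact/(Idelta_unit delta)/al1.
  apply/IdeltaP; apply: le_trans (fal s x Ix) _.
  by rewrite lerD2l ler_piMr// invf_le1// ler1n.
apply/funext => p; have [cp|ncp] := pselect (cyl p); last first.
  rewrite (isCk_cyl (CkP (renorm_curve t)) ncp) /renorm patchE memNset//.
rewrite /renorm patchE mem_set// p0_ft -GE//.
rewrite /renorm_curve [LHS]/((al t)^-1 * (comp_op om m (G t) Psi p +
  t * comp_op om r (G t) h p)).
congr (_ * _).
by have aA2 := interior_valued_I A2; rewrite !comp_opE// !skew_compE.
Qed.

Let D := derCk delta rm'.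
Let la0 : Ck r := linear_fibre r a.
Let G0 : Ck r := comp_op 0 m la0 Psi.
Let dG : Ck r := mulCk delta r (comp_op 0 r la0 (D Psi)) (linear_fibre r b) +
  comp_op 0 r la0 h.
Let dS : Ck r := mulCk delta r (comp_op om r G0 (D Psi)) dG + comp_op om r G0 h.
Let L : Ck r := (- (a ^- 2 * b)) *: comp_op om m G0 Psi + a^-1 *: dS.

Lemma gateaux_diff : is_diff (0 : R^o) renorm_curve (tang L).
Proof.
have [_ A1 A2 _] := nbhs_singleton gateaux_near.
have al0 : al 0 = a by rewrite /al mul0r addr0.
have G00 : G 0 = G0 by rewrite /G al0 scale0r addr0.
have S00 : S 0 = comp_op om m G0 Psi by rewrite /S G00 scale0r addr0.
have a0 : a != 0 by rewrite lt_eqF// (D0_a DPsi).1.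
have Dlin : is_diff (0 : R^o) (fun t : R^o => linear_fibre r (al t)) (tang (linear_fibre r b)).
  rewrite [X in is_diff _ X](_ : _ = (fun t : R^o => linear_fibre r a + t *: linear_fibre r b)).
    exact: curve_line.
  by apply/funext => t; rewrite /al linearD -linearZ.
have cst0 (f : Ck m) : is_diff (0 : R^o) (fun _ : R^o => f) (0 : boundedLinear R^o (Ck m)).
  exact: is_diff_cst.
have curve om' (g : R^o -> Ck r) v : interior_valued (g 0) -> is_diff (0 : R^o) g (tang v) ->
    is_diff (0 : R^o) (fun t => comp_op om' m (g t) Psi + t *: comp_op om' r (g t) h)
      (tang (mulCk delta r (comp_op om' r (g 0) (D Psi)) v + comp_op om' r (g 0) h)).
  move=> Ag Dg; rewrite -tangD.
  have D1 := comp_op_joint_diff om' rm' (leqnn r) Ag (cst0 Psi) Dg.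
  have cg : {for (0 : R^o), continuous g}.
    by apply: differentiable_continuous; exact: ex_diff.
  have ch : {for (0 : R^o), continuous (fun _ : R^o => h)} by exact: cvg_cst.
  have D2 := curve_scale0 (comp_op_continuous (om := om') (leqnn r) Ag ch cg).
  have D1' : is_diff (0 : R^o) (fun t => comp_op om' m (g t) Psi)
      (tang (mulCk delta r (comp_op om' r (g 0) (D Psi)) v)).
    have Z : bcomp (comp_op om' m (g 0)) (0 : boundedLinear R^o (Ck m)) = 0.
      by apply: bl_ext => t; exact: (linear0 (comp_op om' m (g 0))).
    by apply: is_diff_bl_eq D1; rewrite bcomp_tang Z; exact: add0r.
  exact: is_diffD.
have DG : is_diff (0 : R^o) G (tang dG).
  by have := curve 0 _ _ A1 Dlin; rewrite al0.
have DS : is_diff (0 : R^o) S (tang dS) by have := curve om _ _ A2 DG; rewrite G00.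
have := curve_scale (curve_inv b a0) DS.
by rewrite S00 /= mul0r addr0.
Qed.

Lemma gateaux_formula : L = renorm_derivative delta om Psi h :> (R * R -> R).
Proof.
have [_ A1 A2 _] := nbhs_singleton gateaux_near.
have al0 : al 0 = a by rewrite /al mul0r addr0.
have G00 : G 0 = G0 by rewrite /G al0 scale0r addr0.
rewrite al0 in A1; rewrite G00 in A2.
have [aA1 aA2] := (interior_valued_I A1, interior_valued_I A2).
have a0 : a != 0 by rewrite lt_eqF// (D0_a DPsi).1.
apply/funext => -[t x]; have [Ix|nIx] := pselect (I x); last first.
  have nc : ~ cyl (t, x) by move=> /cylP.
  by rewrite (isCk_cyl (CkP L) nc) /renorm_derivative patchE memNset.
have c := (cylP delta t x).2 Ix.
have laE s : la0 (s, x) = a * x by rewrite /la0 linear_fibreE//; exact/cylP.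
have G0E : G0 (t, x) = p0 Psi (a * x).
  by rewrite /G0 comp_opE// skew_compE// laE (D0E DPsi).
have Iax : I (a * x) := D0_Iax DPsi Ix.
have Iy : I (p0 Psi (a * x)) := Idelta_unit delta (D0_psiax_unit DPsi Ix).
rewrite /renorm_derivative patchE mem_set// -/a -/b.
have -> : L (t, x) = - (a ^- 2 * b) * comp_op om m G0 Psi (t, x) +
    a^-1 * (comp_op om r G0 (D Psi) (t, x) *
      (comp_op 0 r la0 (D Psi) (t, x) * linear_fibre r b (t, x) + comp_op 0 r la0 h (t, x)) +
      comp_op om r G0 h (t, x)) by [].
have E1 : comp_op om m G0 Psi (t, x) = p0 Psi (p0 Psi (a * x)).
  by rewrite comp_opE// skew_compE// G0E (D0E DPsi).
have E2 : comp_op om r G0 (D Psi) (t, x) = deriveI delta (p0 Psi) (p0 Psi (a * x)).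
  by rewrite comp_opE// skew_compE// G0E; exact: (D0_pd2 r1 DPsi).
have E3 : comp_op 0 r la0 (D Psi) (t, x) = deriveI delta (p0 Psi) (a * x).
  by rewrite comp_opE// skew_compE// laE; exact: (D0_pd2 r1 DPsi).
have E5 : comp_op 0 r la0 h (t, x) = h (t, a * x).
  by rewrite comp_opE// skew_compE// laE addr0.
have E6 : comp_op om r G0 h (t, x) = h (t + om, p0 Psi (a * x)).
  by rewrite comp_opE// skew_compE// G0E.
rewrite E1 E2 E3 E5 E6 linear_fibreE//=; field; exact: a0.
Qed.

Lemma gateaux : is_gateaux delta r (renorm delta om) Psi h (renorm_derivative delta om Psi h).
Proof.
exists (fun t => t^-1 *: (renorm_curve t - renorm_curve 0)), L; split.
- have E0 : renorm_curve 0 = renorm delta om Psi :> (R * R -> R).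
    have [_ _ _ ->] := nbhs_singleton gateaux_near.
    by congr renorm; apply/funext => q; rewrite /ft mul0r addr0.
  apply: cvg_within; apply: filterS gateaux_near => t [_ _ _ E].
  apply/funext => p.
  have -> : (t^-1 *: (renorm_curve t - renorm_curve 0) : Ck r) p =
      t^-1 * (renorm_curve t p - renorm_curve 0 p) by [].
  by congr (_ * (_ - _)); [exact: (congr1 (@^~ p) E)|exact: (congr1 (@^~ p) E0)].
- exact: gateaux_formula.
- exact: curve_cvg gateaux_diff.
Qed.

End Direction.
End Psi.
End Final.
Theorem theorem2p12 (R : realType) (delta : {posnum R}) (r s : nat)
    (omega : R) (Phi : Ck delta (r + s)) :
  (1 <= r)%N ->
  D_T delta r omega Phi ->
  renorm delta omega Phi = Phi :> (R * R -> R) ->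
  D0_T delta r Phi ->
  exists U : set (Ck delta (r + s)),
    [/\ exists2 V : set (Ck delta (r + s)),
          open V & U = V `&` [set Psi : Ck delta (r + s) | D0_T delta r Psi],
        U Phi,
        exists2 T : Ck delta (r + s) -> Ck delta r,
          forall Psi, U Psi ->
            D_T delta r omega Psi /\
            T Psi = renorm delta omega Psi :> (R * R -> R)
          & Cn_on s U T
      & (1 <= s)%N -> forall Psi, U Psi -> forall h : Ck delta r,
          (\forall t \near 0^',
             renorm_defined delta (fun q => Psi q + t * h q)) /\
          is_gateaux delta r (renorm delta omega) Psi h
            (renorm_derivative delta omega Psi h)].
Proof.
move=> r1 _ _ DPhi; have rm : (r <= r + s)%N := leq_addr s r.
exists [set Psi : Ck delta (r + s) | D0_T delta r Psi]; split=> //.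
- by exists setT; [exact: openT|rewrite setTI].
- exists (@renorm_ext _ delta omega (r + s) r).
    by move=> Psi DPsi; split; [exact: D0_D_T r1 DPsi omega|exact: renorm_extE].
  move=> Psi DPsi; have [W [oW WPsi CW]] := Cn_renorm_ext rm DPsi omega (leqnn (r + s)).
  by exists W, (@renorm_ext _ delta omega (r + s) r); split.
- move=> s1 Psi DPsi h; have rm' : (r < r + s)%N by rewrite -[ltnLHS]addn0 ltn_add2l.
  split; last exact: (gateaux r1 rm DPsi rm').
  by apply: cvg_within; apply: filterS (gateaux_near rm DPsi omega h) => t [].
Qed.
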